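(* Let $d \ge 1$ and let $P \subset \mathbb{R}^d$ be a $d$-dimensional proper locally anti-blocking polytope. Then $P$ has at least $2^d \cdot d!$ flags, and $P$ has exactly $2^d \cdot d!$ flags if and only if $P$ is a generalized Hanner polytope.
   Context: A coordinate subspace of $\mathbb{R}^d$ is a linear span of a subset of the standard basis vectors $e_1,\dots,e_d$. A polytope $P \subset \mathbb{R}^d$ is locally anti-blocking if for every coordinate subspace $H$ of $\mathbb{R}^d$ one has $\mathrm{proj}_H P = P \cap H$, where $\mathrm{proj}_H$ is the orthogonal projection onto $H$. (Central symmetry is not required.) A locally anti-blocking polytope is proper if the origin lies in its interior. Flags: the faces of a $d$-dimensional polytope $P$ include the empty face (of dimension $-1$) and $P$ itself. A flag (also called full or complete flag) of $P$ is a sequence $(F_{-1},F_0,\dots,F_d)$ where $F_i$ is an $i$-dimensional face of $P$ and $F_i \subsetneq F_j$ for $i<j$. Generalized Hanner polytopes are defined recursively: (1) any segment in $\mathbb{R}^1$ with $0$ in its interior is a generalized Hanner polytope; (2) the polar dual $P^\circ = \{x : \langle x,y\rangle \le 1 \text{ for all } y \in P\}$ of a generalized Hanner polytope $P$ is a generalized Hanner polytope; (3) the convex hull $P \vee Q$ of two lower-dimensional generalized Hanner polytopes $P$ and $Q$, of dimensions $k$ and $l$, embedded in two orthogonal subspaces (of dimensions $k$ and $l$) of $\mathbb{R}^{k+l}$, is a generalized Hanner polytope. *)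

(* Defs.v *)
From HB Require Import structures.
From mathcomp Require Import all_boot all_order all_algebra.
From mathcomp Require Import all_classical reals topology normedtype convex.

Set Implicit Arguments.
Unset Strict Implicit.
Unset Printing Implicit Defensive.

Import Order.TTheory GRing.Theory Num.Theory.
Import numFieldNormedType.Exports.

Local Open Scope classical_set_scope.
Local Open Scope ring_scope.

Section Polytopes.
Context {R : realType} {d : nat}.
Implicit Types (A P F : set 'rV[R]_d) (U : {vspace 'rV[R]_d}).

Definition dotv (x y : 'rV[R]_d) : R := \sum_(i < d) x 0 i * y 0 i.

Definition convex_hull A : set 'rV[R]_d := smallest (@convex_set R 'rV[R]_d) A.

Definition polytope P : Prop :=
  exists s : seq 'rV[R]_d, P = convex_hull [set` s].

Definition affine_hull A : set 'rV[R]_d :=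
  [set x | exists (n : nat) (v : 'I_n -> 'rV[R]_d) (c : 'I_n -> R),
     [/\ forall i, A (v i), \sum_i c i = 1 & x = \sum_i c i *: v i]].

(* The dimension is -1 for the empty set, and otherwise the dimension of the
   direction space of the affine hull. *)
Definition has_dim A (k : int) : Prop :=
  (A = set0 /\ k = -1) \/
  exists (x : 'rV[R]_d) (U : {vspace 'rV[R]_d}),
    affine_hull A = [set x + u | u in [set` U]] /\ k = (\dim U)%:Z.

(* Taking a = 0 with b = 1 or b = 0 shows that the empty set and P itself
   are faces of P. *)
Definition face P F : Prop :=
  exists (a : 'rV[R]_d) (b : R),
    (forall x, P x -> dotv a x <= b) /\ F = P `&` [set x | dotv a x = b].

(* Indices are shifted by one: F i is the face of dimension i - 1. *)
Definition flags P : set ('I_d.+2 -> set 'rV[R]_d) :=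
  [set F | (forall i : 'I_d.+2, face P (F i) /\ has_dim (F i) (i%:Z - 1)) /\
           (forall i j : 'I_d.+2, (i < j)%N -> F i `<` F j)].

Definition coord_subspace (I : {set 'I_d}) : {vspace 'rV[R]_d} :=
  <<[seq (delta_mx 0 i)%R | i in I]>>%VS.

(* The image of A under the orthogonal projection onto U. *)
Definition orth_proj U A : set 'rV[R]_d :=
  [set y | y \in U /\
           exists2 x, A x & forall u, u \in U -> dotv (x - y) u = 0].

Definition locally_anti_blocking P : Prop :=
  polytope P /\
  forall I : {set 'I_d},
    orth_proj (coord_subspace I) P = P `&` [set` coord_subspace I].

Definition proper_locally_anti_blocking P : Prop :=
  locally_anti_blocking P /\ interior P 0.

Definition polar P : set 'rV[R]_d :=
  [set x | forall y, P y -> dotv x y <= 1].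

End Polytopes.

(* In the third rule the rows of S (resp. T) are an orthonormal basis of a
   k-dimensional (resp. l-dimensional) subspace of R^(k+l), the two subspaces
   being orthogonal; x |-> x *m S and y |-> y *m T are the corresponding
   linear isometric embeddings. *)
Inductive generalized_Hanner {R : realType} :
    forall d : nat, set 'rV[R]_d -> Prop :=
| Hanner_segment (a b : R) of a < 0 & 0 < b :
    generalized_Hanner [set x : 'rV[R]_1 | a <= x 0 0 <= b]
| Hanner_polar (d : nat) (P : set 'rV[R]_d) of generalized_Hanner P :
    generalized_Hanner (polar P)
| Hanner_join (k l : nat) (P : set 'rV[R]_k) (Q : set 'rV[R]_l)
    (S : 'M[R]_(k, k + l)) (T : 'M[R]_(l, k + l)) of
    generalized_Hanner P & generalized_Hanner Q &
    S *m S^T = 1%:M & T *m T^T = 1%:M & S *m T^T = 0 :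
    generalized_Hanner
      (convex_hull ([set x *m S | x in P] `|` [set y *m T | y in Q])).

(* Main.v *)
(* Adding all coordinate projections of its vertices presents P as the convex hull
   of a finite configuration that is closed under coordinate projections.

   Lower bound, by induction on the number n of coordinates.  For a coordinate i
   and a sign s let T be the face of P on which s x_i is maximal.  Suppose first
   that T meets either both open sides or no open side of each hyperplane x_j = 0
   with j <> i.  Then T and its dual face are, up to translation, locally
   anti-blocking in complementary sets of m and n - 1 - m coordinates.  A flag of
   [0, T] and a flag of [T, P] can be shuffled in C(n - 1, m) ways: each shuffle is
   a monotone path in a grid of faces that is filled in by flips.  So at least
   2^(n-1) (n-1)! flags have their vertex in T and their facet above T.  For
   different (i, s) these flags are different, because if x is the vertex and u the
   dual vertex of the facet then x_k u_k >= 0 for all k, sum_k x_k u_k = 1, and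
   x_i u_i = 1.  If T lies on one side of x_j = 0, then replacing either half of P
   by the mirror image of the other yields polytopes P' and P'' with
   2 f(P) > f(P') + f(P''), and one concludes by induction on the number of
   coordinates in which P is not symmetric.

   Equality.  Every flag is then a shuffle for some (i, s).  Call i and j adjacent
   if the sum of the points of P furthest in directions i and j is not in P.
   Vertices of P are supported on stable sets and vertices of the polar on cliques,
   and an induced path on four vertices would give a flag that is not a shuffle.
   A graph without such paths, or its complement, is disconnected; accordingly P or
   its polar is a join of polytopes of the same kind.

   Conversely, proper faces of a join are pairs of proper faces, so that flags of a
   join are shuffles of flags of its two parts, and polarity preserves flags. *)

Require Import Defs.
From mathcomp Require Import all_boot all_order all_algebra.
From mathcomp Require Import all_classical reals interval_inference topology normedtype convex.
From mathcomp Require Import ring lra zify.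
From mathcomp Require Import fintype finset.

Set Implicit Arguments.
Unset Strict Implicit.
Unset Printing Implicit Defensive.

Import Order.TTheory GRing.Theory Num.Theory.
Import numFieldNormedType.Exports.

Local Open Scope ring_scope.

(** * Face lattices of vector configurations *)

(** Points are kept as finite families, repetitions and non-vertices allowed, and a face is the set
    of indices at which a valid functional is tight. Flags are then elements of finite sets, and
    projections or mirror images of points can be adjoined freely. Appending a coordinate 1 makes
    affine statements linear, so the rank of the span of a face is its dimension plus one, and a
    strict chain of the greatest length that the rank allows is automatically a flag. The grid needs
    only two facts: rank grows strictly along faces, and between faces A < B < C there is a face
    other than B. Shuffles are told apart because every face of the grid remembers its meet and its
    join with T. Lower-dimensional configurations stay in R^d, with a set S of active coordinates,
    so the induction never changes the ambient type. What is passed down the Hanner recursion is the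
    graph together with the supports of generators, not extremality: equality in the flag count need
    not be shown to be inherited by the two parts. *)

Section DotProduct.
Context {R : realType} {n : nat}.
Implicit Types (x y z : 'rV[R]_n) (a : R).

Lemma dotvC x y : dotv x y = dotv y x.
Proof. by apply: eq_bigr => i _; rewrite mulrC. Qed.

Lemma dotvDr x y z : dotv x (y + z) = dotv x y + dotv x z.
Proof. by rewrite -big_split; apply: eq_bigr => i _; rewrite mxE mulrDr. Qed.

Lemma dotvZr a x y : dotv x (a *: y) = a * dotv x y.
Proof. by rewrite mulr_sumr; apply: eq_bigr => i _; rewrite mxE mulrCA. Qed.

Lemma dotvDl x y z : dotv (x + y) z = dotv x z + dotv y z.
Proof. by rewrite !(dotvC _ z) dotvDr. Qed.

Lemma dotvZl a x y : dotv (a *: x) y = a * dotv x y.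
Proof. by rewrite !(dotvC _ y) dotvZr. Qed.

Lemma dotv0r x : dotv x 0 = 0.
Proof. by apply: big1 => i _; rewrite mxE mulr0. Qed.

Lemma dotv0l x : dotv 0 x = 0.
Proof. by rewrite dotvC dotv0r. Qed.

Lemma dotvNr x y : dotv x (- y) = - dotv x y.
Proof. by rewrite -scaleN1r dotvZr mulN1r. Qed.

Lemma dotvNl x y : dotv (- x) y = - dotv x y.
Proof. by rewrite !(dotvC _ y) dotvNr. Qed.

Lemma dotvBr x y z : dotv x (y - z) = dotv x y - dotv x z.
Proof. by rewrite dotvDr dotvNr. Qed.

Lemma dotvBl x y z : dotv (x - y) z = dotv x z - dotv y z.
Proof. by rewrite dotvDl dotvNl. Qed.

Lemma dotv_suml (K : finType) (P : pred K) (F : K -> 'rV[R]_n) y :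
  dotv (\sum_(k | P k) F k) y = \sum_(k | P k) dotv (F k) y.
Proof.
elim/big_ind2: _ => [|x1 x2 y1 y2 <- <-|//]; first exact: dotv0l.
by rewrite dotvDl.
Qed.

Lemma dotv_sumr (K : finType) (P : pred K) (F : K -> 'rV[R]_n) y :
  dotv y (\sum_(k | P k) F k) = \sum_(k | P k) dotv y (F k).
Proof. by rewrite dotvC dotv_suml; apply: eq_bigr => k _; rewrite dotvC. Qed.

Lemma dotv_mulmx x y : dotv x y = (x *m y^T) 0 0.
Proof. by rewrite mxE; apply: eq_bigr => i _; rewrite mxE. Qed.

Lemma dotv_delta x i : dotv x (delta_mx 0 i) = x 0 i.
Proof.
rewrite /dotv (bigD1 i) //= mxE !eqxx mulr1 big1 ?addr0 // => k ki.
by rewrite mxE (negbTE ki) andbF mulr0.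
Qed.

Lemma dotv_eq x y : (forall z, dotv z x = dotv z y) -> x = y.
Proof.
by move=> e; apply/rowP => i; rewrite -!dotv_delta -!(dotvC (delta_mx _ _)).
Qed.

End DotProduct.

Section ConeLattice.
Context {R : realType} {n : nat} {I : finType}.
Implicit Types (w : I -> 'rV[R]_n) (c : 'rV[R]_n) (A B X T : {set I}).

Definition nonneg_on w X c := forall i, i \in X -> 0 <= dotv (w i) c.

Definition zeros w X c : {set I} := [set i in X | dotv (w i) c == 0].

(** These are the faces of the cone generated by the [w i], the whole cone included. The cone may
    contain lines, so the empty set need not be a face. *)
Definition face_lattice w X : {set {set I}} :=
  [set A : {set I} | `[< exists2 c, nonneg_on w X c & A = zeros w X c >]].

Lemma face_latticeP w X A :
  reflect (exists2 c, nonneg_on w X c & A = zeros w X c) (A \in face_lattice w X).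
Proof. by rewrite inE; apply: asboolP. Qed.

Lemma zeros_in w X c : nonneg_on w X c -> zeros w X c \in face_lattice w X.
Proof. by move=> h; apply/face_latticeP; exists c. Qed.

Lemma zeros_sub w X c : zeros w X c \subset X.
Proof. by apply/fintype.subsetP => i; rewrite inE => /andP[]. Qed.

Lemma face_sub w X A : A \in face_lattice w X -> A \subset X.
Proof. by case/face_latticeP => c _ ->; apply: zeros_sub. Qed.

Lemma face_top w X : X \in face_lattice w X.
Proof.
apply/face_latticeP; exists 0 => [i _|]; first by rewrite dotv0r.
by apply/setP => i; rewrite inE dotv0r eqxx andbT.
Qed.

Lemma face_cap w X A B :
  A \in face_lattice w X -> B \in face_lattice w X -> A :&: B \in face_lattice w X.
Proof.
case/face_latticeP => c hc -> /face_latticeP[e he ->].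
apply/face_latticeP; exists (c + e) => [i iX|].
  by rewrite dotvDr addr_ge0 ?hc ?he.
apply/setP => i; rewrite !inE dotvDr; case iX: (i \in X) => //=.
by rewrite paddr_eq0 ?hc ?he.
Qed.

Lemma nonneg_face w X A c : A = zeros w X c -> nonneg_on w X c ->
  forall i, i \in X -> i \notin A -> 0 < dotv (w i) c.
Proof.
by move=> -> h i iX; rewrite inE iX lt0r h // andbT.
Qed.

Lemma zero_face w X A c i : A = zeros w X c -> i \in A -> dotv (w i) c = 0.
Proof. by move=> -> ; rewrite inE => /andP[_ /eqP]. Qed.

(* A functional that is only valid on the face T becomes valid on X after
   adding a large multiple of the functional that exposes T. *)
Lemma face_of_face w X T : T \in face_lattice w X ->
  forall A, (A \in face_lattice w T) = (A \in face_lattice w X) && (A \subset T).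
Proof.
case/face_latticeP => t ht eT A; have sT : T \subset X by rewrite eT zeros_sub.
apply/idP/andP => [AT|[/face_latticeP[c hc ->] sA]]; last first.
  apply/face_latticeP; exists c => [i /(fintype.subsetP sT)|]; first exact: hc.
  apply/setP => i; rewrite !inE; apply/idP/idP => /andP[iX ci].
    by rewrite ci (fintype.subsetP sA) // inE iX ci.
  by rewrite ci (fintype.subsetP sT).
split; last exact: face_sub AT.
case/face_latticeP: AT => c hc ->.
pose N := \sum_(i in X :\: T) (1 + `|dotv (w i) c|) / dotv (w i) t.
have pt i : i \in X -> i \notin T -> 0 < dotv (w i) t by apply: nonneg_face.
have big i : i \in X -> i \notin T -> 0 < dotv (w i) (c + N *: t).
  move=> iX iT; rewrite dotvDr dotvZr.
  have : (1 + `|dotv (w i) c|) / dotv (w i) t <= N.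
    rewrite /N (bigD1 i) ?inE ?iT //= lerDl sumr_ge0 // => k /andP[].
    rewrite inE => /andP[kT kX] _.
    by rewrite divr_ge0 ?addr_ge0 // ltW // pt.
  rewrite ler_pdivrMr ?pt // => h.
  by have := ler_norm (- dotv (w i) c); rewrite normrN; lra.
have onT i : i \in T -> dotv (w i) (c + N *: t) = dotv (w i) c.
  by move=> iT; rewrite dotvDr dotvZr (zero_face eT iT) mulr0 addr0.
apply/face_latticeP; exists (c + N *: t) => [i iX|].
  by case: (boolP (i \in T)) => iT; [rewrite onT // hc|rewrite ltW // big].
apply/setP => i; rewrite !inE; case: (boolP (i \in T)) => iT.
  by rewrite onT // (fintype.subsetP sT).
apply/esym/negbTE/negP => /andP[iX]; apply/negP.
by rewrite gt_eqF // big.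
Qed.

Lemma face_trans w X T A :
  T \in face_lattice w X -> A \in face_lattice w T -> A \in face_lattice w X.
Proof. by move=> h; rewrite (face_of_face h) => /andP[]. Qed.

Lemma face_restrict w X T A :
  T \in face_lattice w X -> A \in face_lattice w X -> A \subset T ->
  A \in face_lattice w T.
Proof. by move=> h hA s; rewrite (face_of_face h) hA s. Qed.

(** Ratio test: [t] is the least quotient of [e] by [c] among the generators off the face exposed by
    [c]. The sign of [e] is arbitrary, and on that face [e - t *: c] agrees with [e]. *)
Lemma exists_ratio_min w X c e : nonneg_on w X c -> X != zeros w X c ->
  exists t, nonneg_on w (X :\: zeros w X c) (e - t *: c) /\
    exists2 i, i \in X :\: zeros w X c & dotv (w i) (e - t *: c) = 0.
Proof.
move=> hc hX.
have [k kX] : exists k, k \in X :\: zeros w X c.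
  apply/set0Pn; rewrite finset.setD_eq0; apply: contra hX => s.
  by rewrite eqEsubset s zeros_sub.
have pos i : i \in X :\: zeros w X c -> 0 < dotv (w i) c.
  by rewrite inE => /andP[h1 h2]; apply: nonneg_face h2 h1.
case: (@arg_minP _ R I k (mem (X :\: zeros w X c))
         (fun i => dotv (w i) e / dotv (w i) c) kX) => m mX hm.
exists (dotv (w m) e / dotv (w m) c); split; last first.
  by exists m => //; rewrite dotvBr dotvZr divfK ?subrr ?gt_eqF ?pos.
move=> i iX; rewrite dotvBr dotvZr subr_ge0 -ler_pdivlMr ?pos //; exact: hm.
Qed.

(** With [c] exposing [B] and [e] exposing [A] in [C], the functional [e - t *: c] equals [e] on
    [B]. So it is positive on [B :\: A], while the ratio test makes it vanish at a generator outside
    [B]: its zeros are the other face. *)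
Lemma face_flip w X A B C : A \in face_lattice w X -> B \in face_lattice w X ->
  C \in face_lattice w X -> A \proper B -> B \proper C ->
  exists B', [/\ B' \in face_lattice w X, A \proper B', B' \proper C & B' != B].
Proof.
move=> hA hB hC AB BC.
have : A \in face_lattice w C.
  by apply: (face_restrict hC hA); apply: proper_sub; apply: proper_trans BC.
case/face_latticeP => e he eA.
have : B \in face_lattice w C by apply: (face_restrict hC hB); apply: proper_sub.
case/face_latticeP => c hc eB.
have [|t [h1 [k kB k0]]] := @exists_ratio_min w C c e hc.
  by rewrite -eB; apply: contraTneq BC => ->; rewrite properxx.
rewrite -eB in h1 kB.
have onB i : i \in B -> dotv (w i) (e - t *: c) = dotv (w i) e.
  by move=> iB; rewrite dotvBr dotvZr (zero_face eB iB) mulr0 subr0.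
have hf : nonneg_on w C (e - t *: c).
  move=> i iC; case: (boolP (i \in B)) => iB; first by rewrite onB // he.
  by apply: h1; rewrite inE iB.
have sAB := proper_sub AB; have sBC := proper_sub BC.
move: kB; rewrite inE => /andP[kB kC].
exists (zeros w C (e - t *: c)); split.
- exact: face_trans hC (zeros_in hf).
- apply/properP; split; last first.
    exists k; first by rewrite inE kC k0 eqxx.
    by apply: contra kB => /(fintype.subsetP sAB).
  apply/fintype.subsetP => i iA; rewrite inE.
  rewrite onB ?(fintype.subsetP sAB) // (zero_face eA iA) eqxx andbT.
  by apply: (fintype.subsetP sBC); apply: (fintype.subsetP sAB).
- case/properP: AB => _ [m mB mA].
  apply/properP; split; first exact: zeros_sub.
  exists m; first exact: (fintype.subsetP sBC).
  rewrite inE onB //; apply/negP => /andP[mC]; apply/negP.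
  by rewrite gt_eqF //; apply: (nonneg_face eA).
- by apply: contraNneq kB => <-; rewrite inE kC k0 eqxx.
Qed.

(** For the lifted points used later this is the affine dimension plus one, with 0 for the empty
    face. *)
Definition face_rank w A : nat := \rank (\sum_(i in A) <<w i>>)%MS.

Lemma span_member w A i : i \in A -> (w i <= \sum_(i in A) <<w i>>)%MS.
Proof. by move=> iA; rewrite (sumsmx_sup i) // genmxE. Qed.

Lemma span_orth w A c : (forall i, i \in A -> dotv (w i) c = 0) ->
  forall x : 'rV_n, (x <= \sum_(i in A) <<w i>>)%MS -> dotv x c = 0.
Proof.
move=> h x; have: (\sum_(i in A) <<w i>> <= kermx c^T)%MS.
  apply/sumsmx_subP => i iA; rewrite genmxE; apply/sub_kermxP.
  by apply/rowP => j; rewrite (ord1 j) -dotv_mulmx (h i iA) mxE.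
move=> s1 s2; have /sub_kermxP := submx_trans s2 s1.
by rewrite dotv_mulmx => ->; rewrite mxE.
Qed.

Lemma face_rank_sub w A B : A \subset B -> (face_rank w A <= face_rank w B)%N.
Proof.
move=> s; apply: mxrankS; apply/sumsmx_subP => i iA.
by rewrite genmxE span_member // (fintype.subsetP s).
Qed.

Lemma face_rank_lt w A B c k : A \subset B ->
  (forall i, i \in A -> dotv (w i) c = 0) -> k \in B -> dotv (w k) c != 0 ->
  (face_rank w A < face_rank w B)%N.
Proof.
move=> s h kB kn; apply: rank_ltmx; rewrite ltmxE; apply/andP; split.
  by apply/sumsmx_subP => i iA; rewrite genmxE span_member // (fintype.subsetP s).
apply: contra kn => /(submx_trans (span_member w kB)) /(span_orth h) ->.
by rewrite eqxx.
Qed.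

Lemma face_rank_proper w X A B : A \in face_lattice w X -> B \subset X ->
  A \proper B -> (face_rank w A < face_rank w B)%N.
Proof.
case/face_latticeP => c hc eA sB /properP[s [k kB kA]].
apply: (@face_rank_lt w A B c k) => // [i iA|]; first exact: (zero_face eA).
by rewrite gt_eqF // (nonneg_face eA) // (fintype.subsetP sB).
Qed.

Lemma face_rank0 w : face_rank w finset.set0 = 0%N.
Proof. by rewrite /face_rank big_set0 mxrank0. Qed.

Lemma separating_functional w A (x : 'rV[R]_n) :
  ~~ (x <= \sum_(i in A) <<w i>>)%MS ->
  exists c, (forall i, i \in A -> dotv (w i) c = 0) /\ dotv x c != 0.
Proof.
set U := (\sum_(i in A) _)%MS.
rewrite submxE => /rV0Pn[j hj].
have e (y : 'rV_n) : dotv y (col j (cokermx U))^T = (y *m cokermx U) 0 j.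
  by rewrite dotv_mulmx trmxK colE mulmxA -colE mxE.
exists (col j (cokermx U))^T; split => [i iA|]; last by rewrite e.
have : (w i <= U)%MS by apply: span_member.
by rewrite e submxE => /eqP ->; rewrite mxE.
Qed.

(* A functional that vanishes on A and at one further point of B, but not on B,
   is tilted by the functional exposing A until it becomes valid on B. *)
Lemma face_between w X A B : A \in face_lattice w X -> B \in face_lattice w X ->
  A \proper B -> (face_rank w A + 1 < face_rank w B)%N ->
  exists C, [/\ C \in face_lattice w X, A \proper C & C \proper B].
Proof.
move=> hA hB AB rk; have sAB := proper_sub AB.
have /face_latticeP[c hc eA] := face_restrict hB hA sAB.
have [_ [k kB kA]] := properP AB.
have [m [mB hm]] : exists m, m \in B /\
    ~~ (w m <= \sum_(i in k |: A) <<w i>>)%MS.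
  apply/not_existsP => h; move: rk; apply/negP; rewrite -leqNgt.
  apply: (@leq_trans (face_rank w (k |: A))).
    apply: mxrankS; apply/sumsmx_subP => i iB; rewrite genmxE.
    by case: (boolP (w i <= _)%MS) => // /negP hi; case: (h i); split=> //; apply/negP.
  rewrite /face_rank big_setU1 //= addnC.
  by rewrite (leq_trans (mxrank_adds_leqif _ _)) // leq_add2r genmxE rank_leq_row.
have [e0 [h0 hm0]] := separating_functional hm.
pose e := - (Num.sg (dotv (w m) e0)) *: e0.
have h i : i \in k |: A -> dotv (w i) e = 0.
  by move=> /h0 ei; rewrite dotvZr ei mulr0.
have me : dotv (w m) e < 0.
  by rewrite dotvZr mulNr -normrEsg oppr_lt0 normr_gt0.
have [|t [h1 [l lB l0]]] := @exists_ratio_min w B c e hc.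
  by rewrite -eA; apply: contraTneq AB => ->; rewrite properxx.
rewrite -eA in h1 lB.
have cpos i : i \in B -> i \notin A -> 0 < dotv (w i) c by apply: nonneg_face.
have mA : m \notin A.
  by apply: contraTN me => mA; rewrite h ?inE ?mA ?orbT // ltxx.
have t0 : t < 0.
  have := h1 m; rewrite inE mA mB => /(_ isT).
  rewrite dotvBr dotvZr subr_ge0 => h2.
  by rewrite -(pmulr_llt0 _ (cpos m mB mA)) (le_lt_trans h2).
have onA i : i \in A -> dotv (w i) (e - t *: c) = 0.
  by move=> iA; rewrite dotvBr dotvZr (zero_face eA iA) h ?mulr0 ?subr0 // inE iA orbT.
have hf : nonneg_on w B (e - t *: c).
  move=> i iB; case: (boolP (i \in A)) => iA; first by rewrite onA.
  by apply: h1; rewrite inE iA.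
move: lB; rewrite inE => /andP[lA lB].
exists (zeros w B (e - t *: c)); split.
- exact: face_trans hB (zeros_in hf).
- apply/properP; split; last by exists l => //; rewrite inE lB l0 eqxx.
  by apply/fintype.subsetP => i iA; rewrite inE onA // eqxx (fintype.subsetP sAB).
- apply/properP; split; first exact: zeros_sub.
  exists k => //; rewrite inE kB /= dotvBr dotvZr h ?inE ?eqxx // sub0r oppr_eq0.
  by rewrite mulf_eq0 negb_or lt_eqF // gt_eqF // cpos.
Qed.

End ConeLattice.

(** * Weyl's theorem, convex hulls and polar pairs *)

Lemma seq_max (R : realDomainType) (x : R) (s : seq R) :
  exists2 t, t \in x :: s & forall y, y \in x :: s -> y <= t.
Proof.
elim: s x => [|z s IH] x.
  by exists x; rewrite ?mem_head // => y; rewrite inE => /eqP ->.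
have [t ts ht] := IH z; case: (leP x t) => xt.
  by exists t => [|y]; rewrite inE ?ts ?orbT // => /orP[/eqP ->|/ht].
exists x => [|y]; first exact: mem_head.
by rewrite inE => /orP[/eqP ->//|/ht yt]; apply: le_trans yt (ltW xt).
Qed.

Section Weyl.
Context {R : realType} {n : nat}.
Implicit Types (s : seq 'rV[R]_n) (x y v : 'rV[R]_n).

(** The conical hull, with one coefficient peeled off at a time, which is the form that elimination
    consumes. *)
Fixpoint cone s x : Prop :=
  if s is v :: s' then exists2 t : R, 0 <= t & cone s' (x - t *: v) else x = 0.

(* Fourier-Motzkin elimination of the coefficient of the first generator. *)
Lemma Weyl s : exists u : seq 'rV[R]_n,
  forall x, cone s x <-> forall y, y \in u -> 0 <= dotv x y.
Proof.
elim: s => [|v s [u hu]].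
  exists ([seq delta_mx 0 i | i <- enum 'I_n] ++ [seq - delta_mx 0 i | i <- enum 'I_n]).
  move=> x; split => [-> y _|h]; first by rewrite dotv0l.
  apply/rowP => i; rewrite mxE; apply/eqP; rewrite eq_le -!(dotv_delta x) andbC.
  rewrite h ?mem_cat ?map_f ?mem_enum // -oppr_ge0 -dotvNr h //.
  by rewrite mem_cat (map_f (fun i => - delta_mx 0 i)) ?orbT ?mem_enum.
pose comb (p : 'rV[R]_n * 'rV[R]_n) := dotv v p.1 *: p.2 - dotv v p.2 *: p.1.
pose up := [seq y <- u | 0 < dotv v y].
pose un := [seq y <- u | dotv v y < 0].
exists ([seq y <- u | 0 <= dotv v y] ++ [seq comb (y1, y2) | y1 <- up, y2 <- un]).
move=> x; split => [[t t0 /hu h] y|h].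
  have h' z : z \in u -> t * dotv v z <= dotv x z.
    by move/h; rewrite dotvBl dotvZl; lra.
  rewrite mem_cat mem_filter => /orP[/andP[vy /h' yu]|].
    by rewrite (le_trans _ yu) // mulr_ge0.
  case/allpairsP => -[y1 y2] /= []; rewrite !mem_filter => /andP[p1 /h' h1].
  move=> /andP[p2 /h' h2] ->; rewrite /comb /= dotvBr !dotvZr; nra.
(* The constraints in [un], together with [0 <= t], bound [t] from below, and the largest of these
   bounds is chosen. The constraints positive on [v] bound [t] from above; they are met thanks to
   the combinations [comb]. *)
have [t tin ht] := seq_max 0 [seq dotv x y / dotv v y | y <- un].
have t0 : 0 <= t by apply: ht; apply: mem_head.
exists t => //; apply/hu => y yu; rewrite dotvBl dotvZl subr_ge0.
have hnn z : z \in u -> 0 <= dotv v z -> 0 <= dotv x z.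
  by move=> zu vz; apply: h; rewrite mem_cat mem_filter vz zu.
case: (ltgtP 0 (dotv v y)) => vy; last by rewrite -vy mulr0 hnn // -vy.
  rewrite -ler_pdivlMr //; move: tin; rewrite inE => /orP[/eqP ->|/mapP[z]].
    by rewrite divr_ge0 ?hnn // ltW.
  rewrite mem_filter => /andP[vz zu] ->.
  have := h (comb (y, z)); rewrite mem_cat (allpairs_f (fun a b => comb (a, b))) ?orbT ?mem_filter ?vy ?vz //.
  move=> /(_ isT); rewrite /comb /= dotvBr !dotvZr => hc.
  rewrite ler_pdivlMr // mulrAC ler_ndivrMr //; lra.
rewrite mulrC -ler_ndivrMl // mulrC; apply: ht; rewrite inE.
by apply/orP; right; apply: (map_f (fun y => dotv x y / dotv v y)); rewrite mem_filter vy.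
Qed.
Lemma cone_sum (I : eqType) (v : I -> 'rV[R]_n) (s : seq I) x : uniq s ->
  cone [seq v i | i <- s] x <->
  exists2 c : I -> R, (forall i, 0 <= c i) & x = \sum_(i <- s) c i *: v i.
Proof.
elim: s x => [|k s IH] x /=.
  split => [->|[c _ ->]]; last by rewrite big_nil.
  by exists (fun=> 0) => //; rewrite big_nil.
case/andP => ks us; split => [[t t0 /(IH _ us)[c c0 e]]|[c c0 ->]].
  exists (fun i => if i == k then t else c i) => [i|]; first by case: ifP.
  rewrite big_cons eqxx -[LHS](subrK (t *: v k)) e addrC; congr (_ + _).
  rewrite !big_seq; apply: eq_bigr => i si; case: eqP => // ik.
  by move: ks; rewrite -ik si.
exists (c k) => //; apply/IH => //; exists c => //.
by rewrite big_cons addrAC subrr add0r.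
Qed.

End Weyl.

Section Hull.
Context {R : realType} {d : nat}.
Implicit Types (x y a : 'rV[R]_d) (b : R).

Definition hull (I : finType) (v : I -> 'rV[R]_d) (A : {set I}) x : Prop :=
  exists c : I -> R, [/\ forall i, 0 <= c i, \sum_(i in A) c i = 1 &
    x = \sum_(i in A) c i *: v i].

(** Homogenization: affine functionals on points become linear functionals on lifted points, so the
    results on cones apply to polytopes. *)
Definition lift1 x : 'rV[R]_(d + 1) := row_mx x (const_mx 1).

Definition affine_form a b : 'rV[R]_(d + 1) := row_mx a (const_mx b).

Lemma dotv_affine a b x (y : R) :
  dotv (affine_form a b) (affine_form x y) = dotv a x + b * y.
Proof.
rewrite /dotv big_split_ord /= big_ord1 !row_mxEr !mxE; congr (_ + _).
by apply: eq_bigr => i _; rewrite !row_mxEl.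
Qed.

Lemma dotv_lift1 x a b : dotv (lift1 x) (affine_form a b) = dotv x a + b.
Proof. by rewrite [lift1 x]/(affine_form x 1) dotv_affine mul1r. Qed.

Lemma affine_formP (c : 'rV[R]_(d + 1)) : exists a b, c = affine_form a b.
Proof.
exists (lsubmx c), (rsubmx c 0 0); rewrite -[LHS]hsubmxK; congr row_mx.
by apply/rowP => i; rewrite (ord1 i) [RHS]mxE.
Qed.

Section Family.
Context {I : finType}.
Implicit Types (v : I -> 'rV[R]_d) (A B : {set I}).

Lemma hull_dotv v A x a b : hull v A x -> (forall i, i \in A -> dotv (v i) a <= b) ->
  dotv x a <= b.
Proof.
case=> c [c0 c1 ->] h; rewrite dotv_suml -[b]mul1r -c1 mulr_suml.
by apply: ler_sum => i iA; rewrite dotvZl ler_wpM2l // h.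
Qed.

Lemma hull_mem v A i : i \in A -> hull v A (v i).
Proof.
move=> iA; exists (fun k => (k == i)%:R); split.
- by move=> k; rewrite ler0n.
- by rewrite (bigD1 i) //= eqxx big1 ?addr0 // => k /andP[_ /negbTE ->].
- rewrite (bigD1 i) //= eqxx scale1r big1 ?addr0 // => k /andP[_ /negbTE ->].
  by rewrite scale0r.
Qed.

Lemma hull_sub v A B x : A \subset B -> hull v A x -> hull v B x.
Proof.
move=> /fintype.subsetP s [c [c0 c1 ->]].
have e (V : nmodType) (F : I -> V) :
    \sum_(i in A) F i = \sum_(i in B) (if i \in A then F i else 0).
  rewrite -big_mkcondr /=; apply: eq_bigl => i.
  by case iA: (i \in A); rewrite ?andbF // s.
exists (fun i => if i \in A then c i else 0); split => [i||].
- by case: ifP.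
- by rewrite -c1 e.
- by rewrite e; apply: eq_bigr => i _; case: ifP; rewrite ?scale0r.
Qed.

Lemma lift1_sum v A (c : I -> R) x :
  lift1 x = \sum_(i in A) c i *: lift1 (v i) <->
  \sum_(i in A) c i = 1 /\ x = \sum_(i in A) c i *: v i.
Proof.
have e : \sum_(i in A) c i *: lift1 (v i) =
    row_mx (\sum_(i in A) c i *: v i) (const_mx (\sum_(i in A) c i)).
  apply/rowP => k; rewrite -[k]splitK; case: (split k) => j /=.
    by rewrite row_mxEl !summxE; apply: eq_bigr => i _; rewrite mxE [RHS]mxE /lift1 row_mxEl.
  rewrite row_mxEr !summxE mxE; apply: eq_bigr => i _.
  by rewrite mxE /lift1 row_mxEr mxE mulr1.
rewrite e; split => [/eq_row_mx[-> /rowP/(_ 0)]|[-> ->]//].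
by rewrite !mxE => <-.
Qed.

Lemma hull_Weyl v A : exists ys : seq 'rV[R]_(d + 1),
  forall x, hull v A x <-> forall y : 'rV_(d + 1), y \in ys -> 0 <= dotv (lift1 x) y.
Proof.
have [ys hys] := Weyl [seq lift1 (v i) | i <- enum A]; exists ys => x.
rewrite -hys (cone_sum (fun i => lift1 (v i)) _ (enum_uniq A)).
split=> [[c [c0 c1 cx]]|[c c0]]; rewrite ?big_enum /=.
  by exists c => //; rewrite big_enum; apply/lift1_sum.
by case/lift1_sum => c1 cx; exists c.
Qed.

Lemma hull_separation v A x : ~ hull v A x ->
  exists a b, (forall i, i \in A -> 0 <= dotv (v i) a + b) /\ dotv x a + b < 0.
Proof.
move=> hx; have [u hc] := hull_Weyl v A.
have [y yu] : exists2 y : 'rV_(d + 1), y \in u & dotv (lift1 x) y < 0.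
  apply: contrapT => h; apply: hx; apply/hc => y yu.
  by rewrite leNgt; apply/negP => hy; apply: h; exists y.
have [a [b ey]] := affine_formP y; rewrite {y}ey in yu *; rewrite dotv_lift1 => xab.
exists a, b; split => // i iA; rewrite -dotv_lift1.
by apply: (iffLR (hc _)) yu; apply: hull_mem.
Qed.

End Family.

Definition in_coords (S : {set 'I_d}) x := forall k, k \notin S -> x 0 k = 0.

Definition coord_proj (S : {set 'I_d}) x : 'rV[R]_d :=
  \row_k (if k \in S then x 0 k else 0).

Lemma coord_projE S x k : coord_proj S x 0 k = if k \in S then x 0 k else 0.
Proof. by rewrite mxE. Qed.

Lemma coord_proj_in S x : in_coords S (coord_proj S x).
Proof. by move=> k /negbTE kS; rewrite mxE kS. Qed.

Lemma coord_proj_id S x : in_coords S x -> coord_proj S x = x.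
Proof. by move=> h; apply/rowP => k; rewrite mxE; case: ifPn => // /h. Qed.

Lemma coord_projC S x y : dotv (coord_proj S x) y = dotv x (coord_proj S y).
Proof.
by apply: eq_bigr => k _; rewrite !mxE; case: ifP; rewrite ?mul0r ?mulr0.
Qed.

Lemma dotv_in_coords S x y : in_coords S x -> dotv x (coord_proj S y) = dotv x y.
Proof. by move=> h; rewrite -coord_projC coord_proj_id. Qed.

Lemma in_coords_setT x : in_coords setT x.
Proof. by move=> k; rewrite inE. Qed.

Lemma in_coordsZ S x c : in_coords S x -> in_coords S (c *: x).
Proof. by move=> h k /h; rewrite mxE => ->; rewrite mulr0. Qed.

Lemma dotv_ge0_eq0 x : dotv x x <= 0 -> x = 0.
Proof.
move=> h; apply/rowP => k; rewrite mxE; apply/eqP; rewrite -sqrf_eq0 eq_le sqr_ge0 andbT.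
apply: le_trans h; rewrite /dotv (bigD1 k) //= expr2 lerDl.
by apply: sumr_ge0 => i _; rewrite -expr2 sqr_ge0.
Qed.

Lemma hull_ray0 (I : finType) (v : I -> 'rV[R]_d) (A : {set I}) x :
  (forall t, 0 <= t -> hull v A (t *: x)) -> x = 0.
Proof.
move=> h; apply: dotv_ge0_eq0; rewrite leNgt; apply/negP => x0.
pose M := \sum_(i in A) `|dotv (v i) x|.
have M0 : 0 <= M by apply: sumr_ge0.
have hM i : i \in A -> dotv (v i) x <= M.
  move=> iA; rewrite (le_trans (ler_norm _)) // /M (bigD1 i) //= lerDl.
  by apply: sumr_ge0.
have t0 : 0 <= (M + 1) / dotv x x by rewrite divr_ge0 ?addr_ge0 // ltW.
have := hull_dotv (h _ t0) hM.
by rewrite dotvZl divfK ?gt_eqF //; lra.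
Qed.

Section PolarPair.
Context {I J : finType}.
Implicit Types (v : I -> 'rV[R]_d) (u : J -> 'rV[R]_d) (S : {set 'I_d}).

(** Two polytopes of R^S, polar to each other and both given by generators. The definition is
    symmetric, so that whatever is proved for one side transfers to the other. *)
Definition polar_pair S v (A : {set I}) u (B : {set J}) : Prop :=
  [/\ forall i, i \in A -> in_coords S (v i), forall j, j \in B -> in_coords S (u j),
      forall i j, i \in A -> j \in B -> dotv (v i) (u j) <= 1,
      forall x, in_coords S x -> (forall j, j \in B -> dotv x (u j) <= 1) -> hull v A x
    & forall y, in_coords S y -> (forall i, i \in A -> dotv (v i) y <= 1) -> hull u B y].

(** Bipolar argument. A functional [a] with constant [b] separating [y] from the hull of [u] has
    [b >= 0], as 0 is in that hull. If [b > 0] then [- a / b] lies in the hull of [v] and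
    contradicts the inequalities on [y]; if [b = 0] then [- a] spans a ray in that hull, so it
    vanishes on [S]. *)
Lemma polar_of_halfspaces S v (A : {set I}) u (B : {set J}) :
  (forall i, i \in A -> in_coords S (v i)) -> (forall j, j \in B -> in_coords S (u j)) ->
  hull u B 0 ->
  (forall x, in_coords S x -> (forall j, j \in B -> dotv x (u j) <= 1) -> hull v A x) ->
  forall y, in_coords S y -> (forall i, i \in A -> dotv (v i) y <= 1) -> hull u B y.
Proof.
move=> hv hu u0 hx y hy vy; apply: contrapT => /hull_separation[a [b [ub yb]]].
pose a' := - coord_proj S a.
have ia' : in_coords S a' by move=> k kS; rewrite mxE coord_proj_in // oppr0.
have ua' j : j \in B -> dotv a' (u j) = - dotv (u j) a.
  by move=> jB; rewrite dotvNl dotvC (dotv_in_coords a (hu j jB)).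
have ya' : dotv a' y = - dotv y a by rewrite dotvNl dotvC (dotv_in_coords a hy).
have : 0 <= b.
  have := @hull_dotv _ u B 0 (- a) b u0.
  by rewrite dotv0l; apply => j jB; rewrite dotvNr -subr_ge0 opprK addrC ub.
rewrite le_eqVlt => /orP[/eqP b0|b0].
  have a0 : a' = 0.
    apply: (@hull_ray0 _ v A) => t t0; apply: hx => [|j jB]; first exact: in_coordsZ.
    rewrite dotvZl ua' // (le_trans _ ler01) // mulrN oppr_le0 mulr_ge0 //.
    by have := ub j jB; rewrite -b0 addr0.
  by move: yb; rewrite -b0 addr0 -oppr_gt0 -ya' a0 dotv0l ltxx.
have hxa : hull v A (b^-1 *: a').
  apply: hx => [|j jB]; first exact: in_coordsZ.
  by rewrite dotvZl ua' // mulrC ler_pdivrMr // mul1r -subr_ge0 opprK addrC ub.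
have := hull_dotv hxa vy; rewrite dotvZl ya' mulrC ler_pdivrMr // mul1r.
by move: yb; lra.
Qed.

End PolarPair.

Lemma polar_pair_sym (I J : finType) S (v : I -> 'rV[R]_d) (A : {set I})
    (u : J -> 'rV[R]_d) (B : {set J}) :
  polar_pair S v A u B -> polar_pair S u B v A.
Proof.
case=> hv hu vu hx hy; split => //.
- by move=> j i jB iA; rewrite dotvC vu.
- by move=> y yS h; apply: hy => // i iA; rewrite dotvC h.
- by move=> x xS h; apply: hx => // j jB; rewrite dotvC h.
Qed.

Lemma polar_pair_exists (I : finType) S (v : I -> 'rV[R]_d) (A : {set I}) :
  A != set0 -> (forall i, i \in A -> in_coords S (v i)) ->
  (forall a, (forall i, i \in A -> 0 <= dotv (v i) a) -> forall k, k \in S -> a 0 k = 0) ->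
  exists m (u : 'I_m -> 'rV[R]_d), polar_pair S v A u setT.
Proof.
move=> /set0Pn[i0 i0A] hv hZ; have [ys hc] := hull_Weyl v A.
pose nrm (z : 'rV[R]_(d + 1)) : 'rV[R]_d := - (rsubmx z 0 0)^-1 *: coord_proj S (lsubmx z).
(* A constraint [<x, a> + b >= 0] with [b > 0] reads [<x, - a / b> <= 1]. The vector 0 is put in
   front so that the family is nonempty and its hull contains the origin. *)
pose us : seq 'rV[R]_d :=
  0 :: [seq nrm z | z <- [seq z : 'rV_(d + 1) <- ys | 0 < rsubmx z 0 0]].
have nrmE a b : nrm (affine_form a b) = - b^-1 *: coord_proj S a.
  by rewrite /nrm /affine_form row_mxKl row_mxKr mxE.
have usP z : z \in us -> z = 0 \/
    exists a b, [/\ affine_form a b \in ys, 0 < b & z = - b^-1 *: coord_proj S a].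
  rewrite inE => /orP[/eqP ->|/mapP[y]]; [by left|rewrite mem_filter => /andP[yp yin] ->].
  right; have [a [b ey]] := affine_formP y; rewrite {y}ey in yp yin *; exists a, b.
  by move: yp; rewrite nrmE /affine_form row_mxKr mxE.
have ge1 a b : affine_form a b \in ys -> forall i, i \in A -> 0 <= dotv (v i) a + b.
  move=> ay i iA; rewrite -dotv_lift1; move: ay; apply: (iffLR (hc _)).
  exact: hull_mem.
exists (size us), (fun j => us`_j).
have us_in (j : 'I_(size us)) : us`_j \in us by apply: mem_nth.
have hu (j : 'I_(size us)) : j \in [set: 'I_(size us)] -> in_coords S us`_j.
  move=> _; have [->|[a [b [_ _ ->]]]] := usP _ (us_in j); first by move=> k _; rewrite mxE.
  by apply: in_coordsZ; apply: coord_proj_in.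
have hx x : in_coords S x ->
    (forall j : 'I_(size us), j \in setT -> dotv x us`_j <= 1) -> hull v A x.
  move=> xS hxu; apply/hc => y; have [a [b ->]] := affine_formP y => ay.
  (* Constraints with [b <= 0] were dropped from [us]: there [a] vanishes on [S] by the spanning
     hypothesis, so [b < 0] is impossible and [b = 0] says nothing. *)
  rewrite dotv_lift1; have gA := ge1 a b ay; case: (ltgtP b 0) => b0.
  - have : forall k, k \in S -> a 0 k = 0.
      by apply: hZ => i iA; have := gA i iA; lra.
    move=> aS; have := gA i0 i0A; rewrite -(dotv_in_coords a (hv i0 i0A)).
    suff -> : coord_proj S a = 0 by rewrite dotv0r; lra.
    by apply/rowP => k; rewrite !mxE; case: ifP => // /aS.
  - have ius : - b^-1 *: coord_proj S a \in us.
      rewrite -nrmE inE map_f ?orbT // mem_filter ay andbT.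
      by rewrite /affine_form row_mxKr mxE.
    have ius' : (index (- b^-1 *: coord_proj S a) us < size us)%N by rewrite index_mem.
    have := hxu (Ordinal ius') (in_setT _); rewrite /= nth_index //.
    rewrite dotvZr (dotv_in_coords a xS) mulNr mulrC -mulNr ler_pdivrMr // mul1r.
    by move=> h; rewrite -(opprK (dotv x a)) addrC subr_ge0.
  - have : forall k, k \in S -> a 0 k = 0.
      by apply: hZ => i iA; have := gA i iA; rewrite b0 addr0.
    move=> aS; rewrite b0 addr0 -(dotv_in_coords a xS).
    suff -> : coord_proj S a = 0 by rewrite dotv0r.
    by apply/rowP => k; rewrite !mxE; case: ifP => // /aS.
split => //.
- move=> i j iA _; have [->|[a [b [ay b0 ->]]]] := usP _ (us_in j).
    by rewrite dotv0r ler01.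
  rewrite dotvZr (dotv_in_coords a (hv i iA)) mulNr mulrC -mulNr ler_pdivrMr // mul1r.
  by have := ge1 a b ay i iA; lra.
- apply: polar_of_halfspaces hx => //.
  by rewrite -[0]/(us`_(Ordinal (ltn0Sn _ : (0 < size us)%N))); apply: hull_mem; rewrite inE.
Qed.

End Hull.

(** * Flags through a given face *)

Section Chains.
Context {I : finType}.
Implicit Types (L : {set {set I}}) (A B T : {set I}).

Definition chains L n : {set {ffun 'I_n -> {set I}}} :=
  [set F : {ffun 'I_n -> {set I}} | [forall i, F i \in L] &&
     [forall i : 'I_n, forall j : 'I_n, (i < j)%N ==> (F i \proper F j)]].

Lemma chainsP L n (F : {ffun 'I_n -> {set I}}) :
  reflect ((forall i, F i \in L) /\ forall i j : 'I_n, (i < j)%N -> F i \proper F j)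
    (F \in chains L n).
Proof.
rewrite inE; apply: (iffP andP) => -[h1 h2]; split; [exact/forallP| |exact/forallP|].
  by move=> i j; have /forallP/(_ j)/implyP := forallP h2 i.
by apply/forallP => i; apply/forallP => j; apply/implyP; apply: h2.
Qed.

Lemma nat_chain L n (F : nat -> {set I}) :
  (forall i, (i < n)%N -> F i \in L) ->
  (forall i, (i.+1 < n)%N -> F i \proper F i.+1) ->
  [ffun j : 'I_n => F j] \in chains L n.
Proof.
move=> h1 h2; apply/chainsP; split => [i|i j]; rewrite !ffunE; first exact: h1.
case: j => j jn /=; elim: j jn => // j IH jn; rewrite ltnS leq_eqVlt.
case/orP => [/eqP e|ij]; first by move: jn; rewrite -e => /h2.
apply: proper_trans (h2 _ jn); apply: IH => //; exact: ltnW.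
Qed.

Lemma chain_sub L n (F : {ffun 'I_n.+1 -> {set I}}) (i j : nat) : F \in chains L n.+1 ->
  (i <= j)%N -> (j <= n)%N -> F (inord i) \subset F (inord j).
Proof.
move=> /chainsP[_ h]; rewrite leq_eqVlt => /orP[/eqP -> //|ij] jn.
by apply/proper_sub/h; rewrite !inordK // ltnS ?(leq_trans (ltnW ij)).
Qed.

Lemma chain_proper L n (F : {ffun 'I_n.+1 -> {set I}}) (i j : nat) : F \in chains L n.+1 ->
  (i < j)%N -> (j <= n)%N -> F (inord i) \proper F (inord j).
Proof.
move=> /chainsP[_ h] ij jn.
by apply: h; rewrite !inordK // ltnS (leq_trans (ltnW ij)).
Qed.

Lemma chain_in L n (F : {ffun 'I_n.+1 -> {set I}}) (i : nat) : F \in chains L n.+1 ->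
  F (inord i) \in L.
Proof. by case/chainsP. Qed.

End Chains.

Lemma discrete_ivt (f : nat -> nat) N : f 0%N = 0%N ->
  (forall k, (k < N)%N -> (f k.+1 <= (f k).+1)%N) ->
  forall a, (a <= f N)%N -> exists2 k, (k <= N)%N & f k = a.
Proof.
move=> f0; elim: N => [_ a|N IH h a].
  by rewrite f0 leqn0 => /eqP ->; exists 0%N.
case: (leqP a (f N)) => [aN _|aN aN1].
  by have [k kN <-] := IH (fun k kN => h k (ltnW kN)) a aN; exists k => //; apply: ltnW.
by exists N.+1 => //; apply/eqP; rewrite eqn_leq aN1 (leq_trans (h N _)).
Qed.

Section CountBelow.
Context {n : nat}.
Implicit Type W : {set 'I_n}.

Definition count_below W k := #|[set x in W | (x < k)%N]|.

Lemma count_below0 W : count_below W 0 = 0%N.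
Proof. by apply: eq_card0 => x; rewrite !inE andbF. Qed.

Lemma count_belowS W (k : nat) (kn : (k < n)%N) :
  count_below W k.+1 = ((Ordinal kn \in W) + count_below W k)%N.
Proof.
rewrite /count_below.
rewrite (cardsD1 (Ordinal kn)) !inE ltnSn andbT; congr (_ + _)%N.
apply: eq_card => x; rewrite !inE ltnS leq_eqVlt -val_eqE /=.
by case: ltngtP; rewrite ?andbF ?andbT.
Qed.

Lemma count_below_le W k : (count_below W k <= #|W|)%N.
Proof. by apply: subset_leq_card; apply/fintype.subsetP => x; rewrite inE => /andP[]. Qed.

Lemma count_below_ivt W a : (a <= #|W|)%N -> exists2 k, (k <= n)%N & count_below W k = a.
Proof.
have full : count_below W n = #|W| by apply: eq_card => x; rewrite !inE ltn_ord andbT.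
rewrite -full; apply: discrete_ivt => [|k kn]; first exact: count_below0.
by rewrite (count_belowS _ kn); case: (_ \in _); rewrite ?leqnSn.
Qed.

Lemma count_below_full W : count_below W n = #|W|.
Proof. by apply: eq_card => x; rewrite !inE ltn_ord andbT. Qed.

End CountBelow.

(** * Shuffling a flag below a face with a flag above it *)

Section Shuffle.
Context {R : realType} {n : nat} {I : finType}.
Variables (w : I -> 'rV[R]_n) (X T : {set I}) (m r : nat).
Local Notation L := (face_lattice w X).
Local Notation rk := (face_rank w).
Hypothesis TL : T \in L.
Hypothesis rkT : (rk T <= m.+1)%N.
Hypothesis rkX : (rk X <= (m + r).+2)%N.

Definition faces_above : {set {set I}} := [set Y in L | T \subset Y].

Lemma sub_rank_eq (A B : {set I}) : A \in L -> B \in L -> A \subset B -> (rk B <= rk A)%N -> A = B.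
Proof.
move=> hA hB s h; apply/eqP; rewrite eqEproper s; apply/negP => p.
by move: h; rewrite leqNgt (face_rank_proper hA (face_sub hB) p).
Qed.

Lemma chain_rank_ge k (L' : {set {set I}}) (F : {ffun 'I_k.+1 -> {set I}}) i j :
  L' \subset L -> F \in chains L' k.+1 -> (i <= j)%N -> (j <= k)%N ->
  (rk (F (inord i)) + (j - i) <= rk (F (inord j)))%N.
Proof.
move=> /fintype.subsetP s hF; elim: j => [|j IH]; first by rewrite leqn0 => /eqP -> _; rewrite addn0.
rewrite leq_eqVlt => /orP[/eqP ->|]; first by rewrite subnn addn0.
rewrite ltnS => ij jk; rewrite subSn // addnS.
apply: leq_ltn_trans (IH ij (ltnW jk)) _.
by apply: (@face_rank_proper _ _ _ w X); rewrite ?(face_sub (s _ (chain_in _ hF))) ?s ?(chain_in _ hF) // (chain_proper hF).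
Qed.

(** The default [B] is never returned when [A], [B], [C] are nested faces, by [face_flip]. *)
Definition flip (A B C : {set I}) : {set I} :=
  odflt B [pick B' | [&& B' \in L, A \proper B', B' \proper C & B' != B]].

Lemma flipP (A B C : {set I}) : A \in L -> B \in L -> C \in L -> A \proper B -> B \proper C ->
  [/\ flip A B C \in L, A \proper flip A B C, flip A B C \proper C & flip A B C != B].
Proof.
move=> hA hB hC AB BC; rewrite /flip; case: pickP => [B' /and4P[]//|h].
have [B' [h1 h2 h3 h4]] := face_flip hA hB hC AB BC.
by have := h B'; rewrite h1 h2 h3 h4.
Qed.

(** Filling one square of the grid. If [y'] contained [A1], then so would [y :&: y'], which would
    exceed [x] and by rank be equal to both [y] and [y']. A face [Y] above [T] and [y'] contains
    [x], hence [B0] and [y]; so [Y :&: z] exceeds [y] and by rank is [z], which gives [B1]. *)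
Lemma grid_cell (x y z y' A0 A1 B0 B1 : {set I}) :
  x \in L -> y \in L -> z \in L -> y' \in L -> A0 \in L -> A1 \in L ->
  A0 \proper A1 -> A1 \subset T -> rk A1 = (rk A0).+1 ->
  rk y = (rk x).+1 -> rk z = (rk x).+2 ->
  x :&: T = A0 -> y :&: T = A1 -> z :&: T = A1 -> y \subset B0 -> z \subset B1 ->
  (forall Y, Y \in L -> T \subset Y -> x \subset Y -> B0 \subset Y) ->
  (forall Y, Y \in L -> T \subset Y -> z \subset Y -> B1 \subset Y) ->
  x \proper y -> y \proper z -> x \proper y' -> y' \proper z -> y' != y ->
  [/\ rk y' = (rk x).+1, y' :&: T = A0, y' \subset B1 &
    forall Y, Y \in L -> T \subset Y -> y' \subset Y -> B1 \subset Y].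
Proof.
move=> xL yL zL y'L A0L A1L A01 A1T rA ry rz xT yT zT yB zB xU zU xy yz xy' y'z ne.
have rxy' := face_rank_proper xL (face_sub y'L) xy'.
have ry'z := face_rank_proper y'L (face_sub zL) y'z.
have ry' : rk y' = (rk x).+1 by apply/eqP; rewrite eqn_leq rxy' andbT -ltnS -rz.
have nA : ~~ (A1 \subset y').
  apply/negP => s; have sy : A1 \subset y by rewrite -yT subsetIl.
  have capL : y :&: y' \in L by apply: face_cap.
  have xyy : x \proper y :&: y'.
    rewrite properE subsetI (proper_sub xy) (proper_sub xy') /=; apply/negP => s2.
    have s3 : A1 \subset x by apply: subset_trans s2; rewrite subsetI sy s.
    have : A1 \subset A0 by rewrite -xT subsetI s3.
    by apply/negP; case/properP: A01 => _ [k kA1 kA0]; apply/subsetPn; exists k.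
  have rcap := face_rank_proper xL (face_sub capL) xyy.
  have e1 : y :&: y' = y by apply: sub_rank_eq; rewrite ?subsetIl // ry.
  have e2 : y :&: y' = y' by apply: sub_rank_eq; rewrite ?subsetIr // ry'.
  by move: ne; rewrite -{1}e2 e1 eqxx.
have y'T : y' :&: T \subset A1 by rewrite -zT setSI // proper_sub.
split => //.
- have s1 : A0 \subset y' :&: T by rewrite -xT setSI // proper_sub.
  apply/esym; apply: sub_rank_eq => //; first exact: face_cap.
  have p : y' :&: T \proper A1.
    rewrite properE y'T; apply: contra nA => /subset_trans; apply; exact: subsetIl.
  by rewrite -ltnS -rA; apply: (face_rank_proper (face_cap y'L TL) (face_sub A1L)).
- by apply: subset_trans zB; apply: proper_sub.
- move=> Y YL TY y'Y; apply: zU => //.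
  have xY : x \subset Y by apply: subset_trans y'Y; apply: proper_sub.
  have yY : y \subset Y by apply: subset_trans yB _; apply: xU.
  have YzL : Y :&: z \in L by apply: face_cap.
  have p : y \proper Y :&: z.
    rewrite properEneq subsetI yY (proper_sub yz) !andbT.
    apply: contraNneq ne => e; apply/eqP; apply: sub_rank_eq; rewrite ?ry ?ry' //.
    by rewrite e subsetI y'Y proper_sub.
  have rYz := face_rank_proper yL (face_sub YzL) p.
  have e : Y :&: z = z by apply: sub_rank_eq; rewrite ?subsetIr // rz -ry.
  by rewrite -e subsetIl.
Qed.

Section Grid.
Variables (A : nat -> {set I}) (B : nat -> {set I}).
Hypothesis A_in : forall a, (a <= m.+1)%N -> A a \in L.
Hypothesis A_proper : forall a, (a <= m)%N -> A a \proper A a.+1.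
Hypothesis A_rank : forall a, (a <= m.+1)%N -> rk (A a) = a.
Hypothesis A_last : A m.+1 = T.
Hypothesis B_in : forall b, (b <= r.+1)%N -> B b \in L.
Hypothesis B_proper : forall b, (b <= r)%N -> B b \proper B b.+1.
Hypothesis B_rank : forall b, (b <= r.+1)%N -> rk (B b) = (m.+1 + b)%N.
Hypothesis B_first : B 0%N = T.

(** The face [grid k b] is meant to meet [T] in [A (m.+1 - k)] and to have join [B b] with [T]. The
    row [k = 0] is [B], the column [b = 0] is [A] read downwards from [T], and any other face is
    obtained by a flip across a square. *)
Fixpoint grid k : nat -> {set I} :=
  if k is k'.+1 then
    fix row b := if b is b'.+1 then flip (row b') (grid k' b') (grid k' b)
                 else A (m - k')
  else B.

Lemma grid0 k : (k <= m)%N -> grid k 0 = A (m.+1 - k).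
Proof. by case: k => [|k] km /=; rewrite ?B_first ?A_last. Qed.

Lemma gridS k b : grid k.+1 b.+1 = flip (grid k.+1 b) (grid k b) (grid k b.+1).
Proof. by []. Qed.

Lemma A_sub a : (a <= m.+1)%N -> A a \subset T.
Proof.
move=> am; rewrite -A_last; have [e am'] : exists e, (a + e = m.+1)%N by exists (m.+1 - a)%N; lia.
elim: e a am am' => [|e IH] a am; first by rewrite addn0 => ->.
move=> ae; apply: subset_trans (IH a.+1 _ _); [|lia|lia].
by apply/proper_sub/A_proper; lia.
Qed.

Lemma B_sup b : (b <= r.+1)%N -> T \subset B b.
Proof.
elim: b => [|b IH] br; first by rewrite B_first.
by apply: subset_trans (IH (ltnW br)) _; apply/proper_sub/B_proper.
Qed.

Definition grid_inv k b := [/\ grid k b \in L, rk (grid k b) = (m.+1 - k + b)%N,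
  grid k b :&: T = A (m.+1 - k), grid k b \subset B b &
  forall Y, Y \in L -> T \subset Y -> grid k b \subset Y -> B b \subset Y].

Lemma grid_step k b : (k < m)%N -> (b < r)%N ->
  grid_inv k b -> grid_inv k b.+1 -> grid_inv k.+1 b ->
  grid k b \proper grid k b.+1 -> grid k.+1 b \proper grid k b ->
  [/\ grid_inv k.+1 b.+1, grid k.+1 b \proper grid k.+1 b.+1
    & grid k.+1 b.+1 \proper grid k b.+1].
Proof.
move=> km br [yL ry yT yB yU] [zL rz zT zB zU] [xL rx xT xB xU] yz xy.
have [y'L xy' y'z ne] := flipP xL yL zL xy yz.
have Ek : (m.+1 - k = (m.+1 - k.+1).+1)%N by clear -km; lia.
have l1 : (m.+1 - k.+1 <= m)%N by clear -km; lia.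
have l2 : (m.+1 - k <= m.+1)%N by clear; lia.
have A0L := A_in (leqW l1); have A1L := A_in l2.
have A01 : A (m.+1 - k.+1) \proper A (m.+1 - k) by rewrite Ek; apply: A_proper.
have [] := grid_cell xL yL zL y'L A0L A1L A01 (A_sub l2) _ _ _ xT yT zT yB zB xU zU xy yz
  xy' y'z ne.
- by rewrite (A_rank l2) (A_rank (leqW l1)).
- by rewrite ry rx Ek addSn.
- by rewrite rz rx Ek addSn addnS.
move=> ry' y'T y'B y'U; rewrite gridS; split => //; split => //.
by rewrite ry' rx addnS.
Qed.

Definition row_inv k := forall b, (b <= r)%N ->
  grid_inv k b /\ ((b < r)%N -> grid k b \proper grid k b.+1).

Lemma grid_row0 : row_inv 0.
Proof.
move=> b br; split => [|b'r]; last by apply: B_proper; apply: ltnW.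
have br' : (b <= r.+1)%N by apply: leqW.
split; rewrite ?subn0 //=; [exact: B_in|exact: B_rank|rewrite A_last].
by apply/setIidPr; apply: B_sup.
Qed.

Lemma grid_rowS k : (k < m)%N -> row_inv k ->
  row_inv k.+1 /\ forall b, (b <= r)%N -> grid k.+1 b \proper grid k b.
Proof.
move=> km hk.
have Ek : (m.+1 - k = (m.+1 - k.+1).+1)%N by clear -km; lia.
have l1 : (m.+1 - k.+1 <= m)%N by clear -km; lia.
have col b : (b <= r)%N -> [/\ grid_inv k.+1 b, grid k.+1 b \proper grid k b &
    (0 < b)%N -> grid k.+1 b.-1 \proper grid k.+1 b].
  elim: b => [_|b IH br].
    split => //; last by rewrite !grid0 ?(ltnW km) // Ek; apply: A_proper.
    rewrite /grid_inv grid0 //; split; rewrite ?addn0.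
    - exact: A_in (leqW l1).
    - exact: A_rank (leqW l1).
    - by apply/setIidPl; apply: A_sub (leqW l1).
    - by rewrite B_first; apply: A_sub (leqW l1).
    - by move=> Y _ TY _; rewrite B_first.
  have [i1 i2 _] := IH (ltnW br); have [h1 h2] := hk b (ltnW br); have [h3 _] := hk b.+1 br.
  by have [] := grid_step km br h1 h3 i1 (h2 br) i2; split.
split=> b br; last by case: (col b br).
by split => [|br']; [case: (col b br)|case: (col b.+1 br') => _ _; apply].
Qed.

Lemma grid_rows k : (k <= m)%N -> row_inv k.
Proof.
elim: k => [_|k IH km]; first exact: grid_row0.
by have [] := grid_rowS km (IH (ltnW km)).
Qed.

Lemma gridP k b : (k <= m)%N -> (b <= r)%N -> grid_inv k b.
Proof. by move=> km br; case: (grid_rows km br). Qed.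

Lemma grid_up k b : (k <= m)%N -> (b < r)%N -> grid k b \proper grid k b.+1.
Proof. by move=> km br; case: (grid_rows km (ltnW br)) => _; apply. Qed.

Lemma grid_right k b : (k < m)%N -> (b <= r)%N -> grid k.+1 b \proper grid k b.
Proof. by move=> km br; have [_] := grid_rowS km (grid_rows (ltnW km)); apply. Qed.

(* A word W records which steps move in the direction of T. *)
Definition grid_path (W : {set 'I_(m + r)}) (k : nat) : {set I} :=
  grid (m - count_below W k) (count_below (~: W) k).

(** The path only supplies the [m + r + 1] faces from [A 1] to [B r]; the bottom [A 0] and the top
    [X] are put in by hand, which shifts the index by one. *)
Definition grid_flag (W : {set 'I_(m + r)}) (j : nat) : {set I} :=
  if j is k.+1 then if k == (m + r).+1 then X else grid_path W k else A 0.

Section Word.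
Variable W : {set 'I_(m + r)}.
Hypothesis W_card : #|W| = m.

Lemma cardC_word : #|~: W| = r.
Proof. by have := cardsC W; rewrite W_card card_ord => /addnI. Qed.

Lemma count_word k : (count_below W k <= m)%N /\ (count_below (~: W) k <= r)%N.
Proof.
have := count_below_le W k; have := count_below_le (~: W) k.
by rewrite W_card cardC_word.
Qed.

Lemma grid_path_inv k : grid_inv (m - count_below W k) (count_below (~: W) k).
Proof. by apply: gridP; [apply: leq_subr|case: (count_word k)]. Qed.

Lemma grid_path_meet k : grid_path W k :&: T = A (count_below W k).+1.
Proof.
have [_ _ -> _ _] := grid_path_inv k; have [h _] := count_word k.
by congr A; clear -h; lia.
Qed.

Lemma grid_path_step k : (k < m + r)%N -> grid_path W k \proper grid_path W k.+1.
Proof.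
move=> kmr; have [h1 h2] := count_word k.+1; rewrite /grid_path.
move: h1 h2; rewrite !(count_belowS _ kmr) inE; case: (_ \in W) => /= h1 h2.
  have -> : (m - count_below W k = (m - (1 + count_below W k)).+1)%N by clear -h1; lia.
  by apply: grid_right => //; clear -h1; lia.
by apply: grid_up; [apply: leq_subr|].
Qed.

Lemma grid_path0 : grid_path W 0 = A 1.
Proof. by rewrite /grid_path !count_below0 subn0 grid0 // subSnn. Qed.

Lemma grid_path_end : grid_path W (m + r) = B r.
Proof. by rewrite /grid_path !count_below_full W_card cardC_word subnn. Qed.

Lemma grid_flag_chain : B r.+1 = X -> [ffun j : 'I_(m + r).+3 => grid_flag W j] \in chains L (m + r).+3.
Proof.
move=> BX; apply: nat_chain => [[|k] kmr|[|k] kmr] /=.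
- exact: A_in.
- case: ifP => _; first exact: face_top.
  by case: (grid_path_inv k).
- by rewrite grid_path0; apply: A_proper.
- rewrite !ltnS in kmr.
  rewrite (ltn_eqF (kmr : (k < (m + r).+1)%N)) eqSS; case: eqP => [->|/eqP ne].
    by rewrite grid_path_end -BX; apply: B_proper.
  by apply: grid_path_step; rewrite ltn_neqAle ne.
Qed.

End Word.
End Grid.
(** Position 1 of a flag is its vertex and position [m + r + 1] its facet. *)
Definition flags_through : {set {ffun 'I_(m + r).+3 -> {set I}}} :=
  [set F in chains L (m + r).+3 |
    (F (inord 1) \subset T) && (T \subset F (inord (m + r).+1))].

(** A strict chain of [m + 2] faces under the bound [m + 1] on the rank of [T] cannot skip a rank,
    so it is a flag of [T]. *)
Lemma lower_chain (F : {ffun 'I_m.+2 -> {set I}}) : F \in chains (face_lattice w T) m.+2 ->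
  [/\ forall a, (a <= m.+1)%N -> F (inord a) \in L,
      forall a, (a <= m)%N -> F (inord a) \proper F (inord a.+1),
      forall a, (a <= m.+1)%N -> rk (F (inord a)) = a & F (inord m.+1) = T].
Proof.
move=> hF; have sL : face_lattice w T \subset L.
  by apply/fintype.subsetP => A; apply: face_trans.
have inL a : F (inord a) \in L by apply: face_trans (chain_in a hF).
have subT a : F (inord a) \subset T by apply: face_sub (chain_in a hF).
have rF a : (a <= m.+1)%N -> rk (F (inord a)) = a.
  move=> am; have h1 := chain_rank_ge sL hF (leq0n a) am.
  have h2 := chain_rank_ge sL hF am (leqnn _).
  have h3 := leq_trans (face_rank_sub w (subT m.+1)) rkT.
  by clear -am h1 h2 h3; lia.
split => // [a am|]; first by apply: (chain_proper hF).
by apply: sub_rank_eq; rewrite ?rF.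
Qed.

Lemma upper_chain (F : {ffun 'I_r.+2 -> {set I}}) : rk T = m.+1 ->
  F \in chains faces_above r.+2 ->
  [/\ forall b, (b <= r.+1)%N -> F (inord b) \in L,
      forall b, (b <= r)%N -> F (inord b) \proper F (inord b.+1),
      forall b, (b <= r.+1)%N -> rk (F (inord b)) = (m.+1 + b)%N
    & F (inord 0) = T /\ F (inord r.+1) = X].
Proof.
move=> rT hF; have sL : faces_above \subset L by apply/fintype.subsetP => A; rewrite inE => /andP[].
have inA b : (F (inord b) \in L) && (T \subset F (inord b)).
  by have := chain_in b hF; rewrite inE.
have inL b : F (inord b) \in L by case/andP: (inA b).
have supT b : T \subset F (inord b) by case/andP: (inA b).
have rF b : (b <= r.+1)%N -> rk (F (inord b)) = (m.+1 + b)%N.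
  move=> br; have h1 := chain_rank_ge sL hF (leq0n b) br.
  have h2 := chain_rank_ge sL hF br (leqnn _).
  have h3 := face_rank_sub w (supT 0%N).
  have h4 := leq_trans (face_rank_sub w (face_sub (inL r.+1))) rkX.
  by rewrite rT in h3; clear -br h1 h2 h3 h4; lia.
split => // [b br|]; first by apply: (chain_proper hF).
split; first by apply/esym/sub_rank_eq; rewrite ?rF ?rT ?addn0.
apply: sub_rank_eq; rewrite ?rF ?face_top // ?(face_sub (inL _)) //.
by rewrite addnS addSn.
Qed.

Local Notation data := ({ffun 'I_m.+2 -> {set I}} * {ffun 'I_r.+2 -> {set I}} *
    {set 'I_(m + r)})%type.
Implicit Type p : data.

Definition shuffle_flag p : {ffun 'I_(m + r).+3 -> {set I}} :=
  [ffun j : 'I_(m + r).+3 => grid_flag (fun a => p.1.1 (inord a)) (fun b => p.1.2 (inord b)) p.2 j].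

Definition shuffles := setX (setX (chains (face_lattice w T) m.+2) (chains faces_above r.+2))
  [set W : {set 'I_(m + r)} | #|W| == m].

Lemma shufflesP p : reflect [/\ p.1.1 \in chains (face_lattice w T) m.+2,
  p.1.2 \in chains faces_above r.+2 & #|p.2| = m] (p \in shuffles).
Proof.
case: p => [[A B] W]; rewrite /shuffles !in_setX inE -andbA.
by apply: (iffP and3P) => -[h1 h2 /eqP h3].
Qed.

Lemma shuffle_flagE p k : (k <= m + r)%N -> shuffle_flag p (inord k.+1) =
  grid_path (fun a => p.1.1 (inord a)) (fun b => p.1.2 (inord b)) p.2 k.
Proof.
move=> kmr; rewrite ffunE inordK ?ltnS; last exact: leqW.
by rewrite /= (ltn_eqF (kmr : (k < (m + r).+1)%N)).
Qed.

Lemma shuffle_flag0 p : shuffle_flag p (inord 0) = p.1.1 (inord 0).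
Proof. by rewrite ffunE inordK. Qed.

(* Each flag produced from (A, B, W) meets T in the members of A and joins T in
   the members of B, so that it determines A, B and W. *)
Lemma shuffle_spec p : p \in shuffles ->
  [/\ shuffle_flag p \in flags_through,
    forall k, (k <= m + r)%N ->
      shuffle_flag p (inord k.+1) :&: T = p.1.1 (inord (count_below p.2 k).+1),
    forall k, (k <= m + r)%N ->
      shuffle_flag p (inord k.+1) \subset p.1.2 (inord (count_below (~: p.2) k)) &
    forall k, (k <= m + r)%N -> forall Y, Y \in L -> T \subset Y ->
      shuffle_flag p (inord k.+1) \subset Y -> p.1.2 (inord (count_below (~: p.2) k)) \subset Y].
Proof.
case: p => [[A B] W] /shufflesP[/= hA hB hW].
have [A1 A2 A3 A4] := lower_chain hA.
have rT : rk T = m.+1 by rewrite -{1}A4 A3.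
have [B1 B2 B3 [B4 B5]] := upper_chain rT hB.
have inv := grid_path_inv A1 A2 A3 A4 B1 B2 B3 B4 hW.
split=> [|k kmr|k kmr|k kmr].
- rewrite inE; apply/andP; split.
    exact: (grid_flag_chain A1 A2 A3 A4 B1 B2 B3 B4 hW B5).
  rewrite !ffunE !inordK // /= ltn_eqF // (grid_path0 A4 B4).
  by rewrite (grid_path_end _ _ hW) (A_sub A2 A4) // (B_sup B2 B4) // leqnSn.
- by rewrite shuffle_flagE //= (grid_path_meet A1 A2 A3 A4 B1 B2 B3 B4 hW).
- by rewrite shuffle_flagE //=; case: (inv k).
- by rewrite shuffle_flagE //=; case: (inv k).
Qed.

Lemma shuffle_upper_in p : p \in shuffles ->
  forall b, (b <= r.+1)%N -> p.1.2 (inord b) \in L /\ T \subset p.1.2 (inord b).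
Proof.
case: p => [[A B] W] /shufflesP[/= hA hB hW] b _.
by apply/andP; have := chain_in b hB; rewrite inE.
Qed.

Lemma shuffle_word p k (kn : (k < m + r)%N) : p \in shuffles ->
  (Ordinal kn \in p.2) = (shuffle_flag p (inord k.+1) :&: T != shuffle_flag p (inord k.+2) :&: T).
Proof.
move=> hp; have [_ h _ _] := shuffle_spec hp; rewrite !h ?(ltnW kn) // (count_belowS _ kn).
case: (p) hp => [[A B] W] /shufflesP[/= hA _ hW].
case kW: (_ \in W) => /=; last by rewrite eqxx.
have := count_below_le W k.+1; rewrite hW (count_belowS _ kn) kW => h1.
have := chain_proper hA (ltnSn _) (h1 : ((true + count_below W k).+1 <= m.+1)%N).
by rewrite properEneq => /andP[].
Qed.

Lemma shuffle_flag_inj : {in shuffles &, injective shuffle_flag}.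
Proof.
move=> p q hp hq e.
have eW : p.2 = q.2.
  by apply/setP => -[k kn]; rewrite !shuffle_word // e.
have [_ mp lp up] := shuffle_spec hp; have [_ mq lq uq] := shuffle_spec hq.
case/shufflesP: (hp) => pA pB pW; case/shufflesP: (hq) => qA qB qW.
have [_ _ _ A4] := lower_chain pA; have [_ _ _ A4'] := lower_chain qA.
have rT : rk T = m.+1 by have [_ _ A3 <-] := lower_chain pA; rewrite A3.
have [_ _ _ [_ B5]] := upper_chain rT pB; have [_ _ _ [_ B5']] := upper_chain rT qB.
have eA : p.1.1 = q.1.1.
  apply/ffunP => a; rewrite -(inord_val a); case: (nat_of_ord a) (ltn_ord a) => [|b] bm.
    by rewrite -!shuffle_flag0 e.
  rewrite !ltnS in bm.
  have [|k kmr <-] := @count_below_ivt _ p.2 b; first by rewrite pW.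
  by rewrite -mp // eW -mq // e.
have eB : p.1.2 = q.1.2.
  apply/ffunP => a; rewrite -(inord_val a); move: (nat_of_ord a) (ltn_ord a) => b bm.
  move: (bm); rewrite ltnS leq_eqVlt => /orP[/eqP ->|]; first by rewrite B5 B5'.
  rewrite ltnS => br.
  have [|k kmr ek] := @count_below_ivt _ (~: p.2) b; first by rewrite cardC_word.
  have pU := shuffle_upper_in hp; have qU := shuffle_upper_in hq.
  have [pL pT] := pU b (leqW br); have [qL qT] := qU b (leqW br).
  have ek' : count_below (~: q.2) k = b by rewrite -eW.
  apply/eqP; rewrite eqEsubset; apply/andP; split.
    by rewrite -{1}ek; apply: up => //; have := lq k kmr; rewrite ek' -e.
  by rewrite -{1}ek'; apply: uq => //; have := lp k kmr; rewrite ek e.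
by case: (p) (q) eA eB eW => [[? ?] ?] [[? ?] ?] /= -> -> ->.
Qed.

Lemma card_shuffles : #|shuffles| =
  (#|chains (face_lattice w T) m.+2| * #|chains faces_above r.+2| * 'C(m + r, m))%N.
Proof. by rewrite /shuffles !cardsX card_draws card_ord. Qed.

Lemma shuffle_bound :
  (#|chains (face_lattice w T) m.+2| * #|chains faces_above r.+2| * 'C(m + r, m)
    <= #|flags_through|)%N.
Proof.
rewrite -card_shuffles -(card_in_imset shuffle_flag_inj); apply: subset_leq_card.
by apply/fintype.subsetP => F /imsetP[p hp ->]; case: (shuffle_spec hp).
Qed.

(** With equality every flag through [T] is a shuffle, and a step of a shuffle that does not move in
    [T] moves in the chain above [T]. The face [Y] is the member of that chain reached before the
    step. *)
Lemma shuffle_equality : #|flags_through| =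
  (#|chains (face_lattice w T) m.+2| * #|chains faces_above r.+2| * 'C(m + r, m))%N ->
  forall F, F \in flags_through -> forall k, (0 < k)%N -> (k <= m + r)%N ->
  F (inord k) :&: T = F (inord k.+1) :&: T ->
  exists Y, [/\ Y \in L, T \subset Y, F (inord k) \subset Y & ~~ (F (inord k.+1) \subset Y)].
Proof.
rewrite -card_shuffles -(card_in_imset shuffle_flag_inj) => e F hF [//|k] _ kmr eT.
have : F \in shuffle_flag @: shuffles.
  suff -> : shuffle_flag @: shuffles = flags_through by [].
  apply/eqP; rewrite eqEcard e leqnn andbT.
  by apply/fintype.subsetP => F' /imsetP[p hp ->]; case: (shuffle_spec hp).
case/imsetP => p hp eF; rewrite {F hF}eF in eT *.
have [_ _ l u] := shuffle_spec hp.
have := shuffle_word kmr hp; rewrite eT eqxx => /negbT kW.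
case/shufflesP: (hp) => _ pB pW.
have br : (count_below (~: p.2) k < r)%N.
  have := count_below_le (~: p.2) k.+1.
  by rewrite (cardC_word pW) (count_belowS _ kmr) inE kW.
have [L1 T1] := shuffle_upper_in hp (leqW (ltnW br)).
exists (p.1.2 (inord (count_below (~: p.2) k))); split=> //; first exact: l (ltnW kmr).
apply/negP => s; have := u _ kmr _ L1 T1 s.
rewrite (count_belowS _ kmr) inE kW => s2.
have := chain_proper pB (ltnSn _) (ltnW (br : (_.+1 <= _)%N)).
by rewrite properE s2 andbF.
Qed.

End Shuffle.

(** * Ranks along flags, and refinement of chains of faces to flags *)

Section Saturation.
Context {R : realType} {n : nat} {I : finType}.
Variables (w : I -> 'rV[R]_n) (X : {set I}).
Local Notation L := (face_lattice w X).
Local Notation rk := (face_rank w).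
Local Notation prop := (fun A B : {set I} => A \proper B).
Implicit Types (A B : {set I}) (c s : seq {set I}).

Lemma flag_rank N (F : {ffun 'I_N.+2 -> {set I}}) : (rk X <= N.+1)%N ->
  F \in chains L N.+2 -> forall j, (j <= N.+1)%N -> rk (F (inord j)) = j.
Proof.
move=> rX hF j jN; have h1 := chain_rank_ge (subxx L) hF (leq0n j) jN.
have h2 := chain_rank_ge (subxx L) hF jN (leqnn _).
have h3 := leq_trans (face_rank_sub w (face_sub (chain_in N.+1 hF))) rX.
by clear -jN h1 h2 h3; lia.
Qed.

Lemma flag_top N (F : {ffun 'I_N.+2 -> {set I}}) : (rk X <= N.+1)%N ->
  F \in chains L N.+2 -> F (inord N.+1) = X.
Proof.
move=> rX hF; have inL := chain_in N.+1 hF; apply: (sub_rank_eq inL (face_top w X)).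
  exact: face_sub inL.
by rewrite (flag_rank rX hF).
Qed.

Lemma flag_bottom N (F : {ffun 'I_N.+2 -> {set I}}) : (rk X <= N.+1)%N -> set0 \in L ->
  F \in chains L N.+2 -> F (inord 0) = set0.
Proof.
move=> rX L0 hF; apply/esym/(sub_rank_eq L0 (chain_in 0 hF)); first exact: sub0set.
by rewrite (flag_rank rX hF).
Qed.

Lemma full_rank N : chains L N.+2 != set0 -> (N.+1 <= rk X)%N.
Proof.
case/set0Pn => F hF; have h := chain_rank_ge (subxx L) hF (leq0n N.+1) (leqnn _).
rewrite subn0 in h; apply: leq_trans (face_rank_sub w (face_sub (chain_in N.+1 hF))).
exact: leq_trans (leq_addl _ _) h.
Qed.

Lemma saturate A B : A \in L -> B \in L -> A \subset B ->
  exists s, [/\ path prop A s, last A s = B, all (mem L) s & size s = (rk B - rk A)%N].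
Proof.
have [k] := ubnP (rk B - rk A); elim: k A B => // k IH A B hk hA hB sAB.
have [e|nAB] := eqVneq A B; first by exists [::]; rewrite e subnn.
have AB : A \proper B by rewrite properEneq nAB.
have rAB := face_rank_proper hA (face_sub hB) AB.
case: (ltnP (rk A + 1) (rk B)) => [r2|r1]; last first.
  exists [:: B]; rewrite /= AB hB; split=> //.
  by clear -rAB r1; rewrite /=; lia.
have [C [hC AC CB]] := face_between hA hB AB r2.
have rAC := face_rank_proper hA (face_sub hC) AC.
have rCB := face_rank_proper hC (face_sub hB) CB.
have [|s1 [p1 l1 a1 z1]] := IH A C _ hA hC (proper_sub AC); first by clear -hk rAC rCB; lia.
have [|s2 [p2 l2 a2 z2]] := IH C B _ hC hB (proper_sub CB); first by clear -hk rAC rCB; lia.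
exists (s1 ++ s2); rewrite cat_path p1 l1 p2 last_cat l1 l2 all_cat a1 a2 size_cat z1 z2.
by split => //; clear -rAC rCB; lia.
Qed.

Lemma path_rank_le c A : path prop A c -> (rk A <= rk (last A c))%N.
Proof.
elim: c A => //= C c IH A /andP[AC /IH h].
by apply: leq_trans h; apply: face_rank_sub; apply: proper_sub.
Qed.

Lemma chain_extend c A : path prop A c -> all (mem L) (A :: c) ->
  exists s, [/\ path prop A s, last A s = last A c, all (mem L) s,
    size s = (rk (last A c) - rk A)%N & {subset c <= s}].
Proof.
elim: c A => [|B c IH] A /=; first by exists [::]; rewrite subnn.
case/andP => AB pc /and3P[hA hB hc].
have [s1 [p1 l1 a1 z1]] := saturate hA hB (proper_sub AB).
have [|s2 [p2 l2 a2 z2 sub]] := IH B pc; first by rewrite /= hB.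
have rAB := face_rank_proper hA (face_sub hB) AB.
have rl := path_rank_le pc.
exists (s1 ++ s2); rewrite cat_path p1 l1 p2 last_cat l1 l2 all_cat a1 a2 size_cat z1 z2.
split => //; first by clear -rAB rl; lia.
move=> Y; rewrite inE mem_cat => /orP[/eqP ->|/sub ->]; last by rewrite orbT.
have := mem_last A s1; rewrite l1 inE => /orP[/eqP e|->//].
by move: AB; rewrite e properxx.
Qed.

(** Gaps in the chain are filled by [face_between]. This produces the flags with prescribed members
    on which strictness and the equality case depend. *)
Lemma flag_of_chain N c : rk X = N.+1 -> set0 \in L -> path prop set0 c ->
  all (mem L) c -> exists2 F, F \in chains L N.+2 &
  forall Y, Y \in c -> exists2 j, (j <= N.+1)%N & F (inord j) = Y.
Proof.
move=> rX L0 pc hc.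
have lastL : last set0 c \in L.
  by have := mem_last set0 c; rewrite inE => /orP[/eqP ->//|]; apply: (allP hc).
have [|s1 [p1 l1 a1 z1 sub]] := chain_extend pc; first by rewrite /= L0.
have [s2 [p2 l2 a2 z2]] := saturate lastL (face_top w X) (face_sub lastL).
have rl : (rk (last set0 c) <= rk X)%N := face_rank_sub w (face_sub lastL).
have sz : size (s1 ++ s2) = N.+1.
  by rewrite size_cat z1 z2 rX face_rank0; rewrite rX in rl; clear -rl; lia.
have ps : path prop set0 (s1 ++ s2) by rewrite cat_path p1 l1.
have as' : all (mem L) (set0 :: s1 ++ s2) by rewrite /= L0 all_cat a1.
exists [ffun j : 'I_N.+2 => nth set0 (set0 :: s1 ++ s2) j].
  apply: (nat_chain (F := nth set0 (set0 :: s1 ++ s2))) => i iN.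
    by apply: (allP as'); apply: mem_nth; rewrite /= sz.
  by have /(pathP set0) h := ps; apply: (h i); rewrite sz.
move=> Y /sub Ys.
have iY : (index Y (set0 :: s1 ++ s2) <= N.+1)%N.
  by rewrite -sz -ltnS -[(size _).+1]/(size (set0 :: s1 ++ s2)) index_mem inE mem_cat Ys orbT.
exists (index Y (set0 :: s1 ++ s2)) => //.
by rewrite ffunE inordK // nth_index // inE mem_cat Ys orbT.
Qed.

(** Choose [Z] of largest rank among the faces that contain [C] and avoid [k]. If [Z] were not a
    facet, a flip above it would give two distinct faces one rank higher; both contain [k], so their
    meet exceeds [Z] and by rank equals both. *)
Lemma coatom_avoiding N (C : {set I}) k : rk X = N.+1 -> set0 \in L -> C \in L ->
  C != set0 -> k \in X -> k \notin C ->
  exists Z, [/\ Z \in L, rk Z = N, C \subset Z & k \notin Z].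
Proof.
move=> rX L0 CL C0 kX kC; pose P := [pred Z : {set I} | [&& Z \in L, C \subset Z & k \notin Z]].
have PC : P C by rewrite /= CL subxx.
case: (@arg_maxnP _ C P (fun Z => rk Z) PC) => Z /and3P[ZL CZ kZ] hmax.
have Z0 : set0 \proper Z by rewrite proper0; apply: contra C0 => /eqP e; rewrite -subset0 -e.
have ZX : Z \proper X.
  by apply/properP; split; [apply: face_sub ZL|exists k].
have rZ := face_rank_proper ZL (subxx X) ZX; rewrite rX ltnS in rZ.
exists Z; split=> //; apply/eqP; rewrite eqn_leq rZ leqNgt; apply/negP => lt.
have [||Phi hP /(_ Z (mem_head _ _))[a aN ea]] := flag_of_chain rX L0 (c := [:: Z]).
- by rewrite /= Z0.
- by rewrite /= ZL.
have rX' : (rk X <= N.+1)%N by rewrite rX.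
have ra := flag_rank rX' hP aN; rewrite ea in ra.
have a2 : (a.+2 <= N.+1)%N by rewrite ltnS -ra.
have in_k Y : Y \in L -> Z \proper Y -> k \in Y.
  move=> YL ZY; apply: contraT => kY; have := face_rank_proper ZL (face_sub YL) ZY.
  have h : (rk Y <= rk Z)%N by apply: hmax; rewrite /= YL kY (subset_trans CZ (proper_sub ZY)).
  by rewrite ltnNge h.
have p1 : Z \proper Phi (inord a.+1) by rewrite -ea (chain_proper hP) // ltnW.
have p2 := chain_proper hP (ltnSn a.+1) a2.
have L1 := chain_in a.+1 hP; have L2 := chain_in a.+2 hP.
have [Y [YL ZY Y2 ne]] := face_flip ZL L1 L2 p1 p2.
have r1 := flag_rank rX' hP (ltnW a2); have r2 := flag_rank rX' hP a2.
have rZY := face_rank_proper ZL (face_sub YL) ZY.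
have rY2 := face_rank_proper YL (face_sub L2) Y2.
have capL := face_cap YL L1.
have pc : Z \proper Y :&: Phi (inord a.+1).
  apply/properP; split; first by rewrite subsetI !proper_sub.
  by exists k => //; rewrite inE !in_k.
have rc := face_rank_proper ZL (face_sub capL) pc.
rewrite ra in rc; rewrite r2 ltnS in rY2.
have e1 := sub_rank_eq capL YL (subsetIl _ _) (leq_trans rY2 rc).
have e2 : Y :&: Phi (inord a.+1) = Phi (inord a.+1).
  by apply: (sub_rank_eq capL L1 (subsetIr _ _)); rewrite r1.
by move: ne; rewrite -{1}e1 e2 eqxx.
Qed.

End Saturation.

(** * Polarity and faces *)

Section ChainMaps.
Context {I J : finType}.
Implicit Types (L : {set {set I}}) (M : {set {set J}}).

Lemma chains_antitone L M (g : {set I} -> {set J}) n :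
  (forall F, F \in L -> g F \in M) -> {in L &, injective g} ->
  (forall F G, F \in L -> G \in L -> F \subset G -> g G \subset g F) ->
  (#|chains L n| <= #|chains M n|)%N.
Proof.
move=> gM gi ga; pose f (F : {ffun 'I_n -> {set I}}) := [ffun j => g (F (rev_ord j))].
have fi : {in chains L n &, injective f}.
  move=> F G /chainsP[hF _] /chainsP[hG _] /ffunP e; apply/ffunP => j; apply: gi => //.
  by have := e (rev_ord j); rewrite !ffunE rev_ordK.
rewrite -(card_in_imset fi); apply/subset_leq_card/fintype.subsetP => G /imsetP[F hF ->].
have /chainsP[h1 h2] := hF; apply/chainsP; split=> [j|i j ij]; rewrite !ffunE; first exact: gM.
have p : F (rev_ord j) \proper F (rev_ord i).
  by apply: h2; rewrite /= ltn_sub2l // (leq_ltn_trans _ (ltn_ord j)).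
rewrite properEneq ga ?(proper_sub p) // andbT.
by apply: contraTneq p => /gi -> //; rewrite properxx.
Qed.

End ChainMaps.

Section PointFaces.
Context {R : realType} {d : nat}.
Implicit Types (x y p : 'rV[R]_d) (b : R).

Section Family.
Context {I : finType}.
Implicit Types (v : I -> 'rV[R]_d) (A F : {set I}).

Definition pface v A := face_lattice (fun i => lift1 (v i)) A.

Lemma pfaceP v A F : reflect
  (exists y b, (forall i, i \in A -> dotv (v i) y <= b) /\
     F = [set i in A | dotv (v i) y == b]) (F \in pface v A).
Proof.
apply: (iffP (face_latticeP _ _ _)) => [[c hc ->]|[y [b [h ->]]]].
  have [a [b e]] := affine_formP c; rewrite {c}e in hc *.
  exists (- a), b; split => [i /hc|].
    by rewrite dotv_lift1 dotvNr; lra.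
  by apply/setP => i; rewrite !inE dotv_lift1 dotvNr eqr_oppLR addr_eq0.
exists (affine_form (- y) b) => [i /h|].
  by rewrite dotv_lift1 dotvNr; lra.
by apply/setP => i; rewrite !inE dotv_lift1 dotvNr addrC subr_eq0 eq_sym.
Qed.

Lemma pface_exposed v A y b : (forall i, i \in A -> dotv (v i) y <= b) ->
  [set i in A | dotv (v i) y == b] \in pface v A.
Proof. by move=> h; apply/pfaceP; exists y, b. Qed.

Lemma pface_set0 v A : set0 \in pface v A.
Proof.
apply/pfaceP; exists 0, 1; split => [i _|]; first by rewrite dotv0r ler01.
by apply/setP => i; rewrite !inE dotv0r eq_sym oner_eq0 andbF.
Qed.

Lemma pface_translate v p A : pface (fun i => v i - p) A = pface v A.
Proof.
apply/setP => F; apply/pfaceP/pfaceP => -[y [b [h ->]]].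
  exists y, (b + dotv p y); split => [i /h|]; first by rewrite dotvBl; lra.
  by apply/setP => i; rewrite !inE dotvBl subr_eq.
exists y, (b - dotv p y); split => [i /h|]; first by rewrite dotvBl; lra.
by apply/setP => i; rewrite !inE dotvBl (inj_eq (addIr _)).
Qed.

End Family.

Section Galois.
Context {I J : finType}.
Implicit Types (v : I -> 'rV[R]_d) (u : J -> 'rV[R]_d) (S : {set 'I_d}).

Definition dual_face v (A : {set I}) u (G : {set J}) : {set I} :=
  [set i in A | [forall j in G, dotv (v i) (u j) == 1]].

Lemma dual_faceP v (A : {set I}) u (G : {set J}) i :
  reflect (i \in A /\ forall j, j \in G -> dotv (v i) (u j) = 1) (i \in dual_face v A u G).
Proof.
rewrite inE; apply: (iffP andP) => -[h1 h2]; split => //.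
  by move=> j jG; apply/eqP; apply: (forall_inP h2).
by apply/forall_inP => j /h2 ->.
Qed.

Lemma dual_face_anti v (A : {set I}) u (G H : {set J}) : G \subset H ->
  dual_face v A u H \subset dual_face v A u G.
Proof.
move=> /fintype.subsetP s; apply/fintype.subsetP => i /dual_faceP[iA h].
by apply/dual_faceP; split => // j /s; apply: h.
Qed.

(** The sum of the inequalities in [G] exposes it: a sum of nonnegative slacks vanishes only if each
    of them does. *)
Lemma dual_face_in v (A : {set I}) u (G : {set J}) :
  (forall i j, i \in A -> j \in G -> dotv (v i) (u j) <= 1) -> dual_face v A u G \in pface v A.
Proof.
move=> h; apply/pfaceP; exists (\sum_(j in G) u j), (\sum_(j in G) 1).
split=> [i iA|]; first by rewrite dotv_sumr; apply: ler_sum => j; apply: h.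
apply/setP => i; rewrite !inE; case iA: (i \in A) => //=.
rewrite dotv_sumr -subr_eq0 -oppr_eq0 opprB -sumrB psumr_eq0; last first.
  by move=> j jG; rewrite subr_ge0 h.
apply/forall_inP/allP => [h1 j _|h1 j jG].
  by apply/implyP => /h1 /eqP ->; rewrite subrr.
by have := h1 j (mem_index_enum _); rewrite jG /= subr_eq0 eq_sym.
Qed.

(** The level [b] of an exposing functional is nonnegative because 0 is in the hull. If [b > 0],
    rescaling to level 1 gives a point of the polar; if [b = 0], boundedness of the polar makes the
    functional vanish on [S], and the face is everything. *)
Lemma polar_face S v A u B F : polar_pair S v A u B -> F \in pface u B -> F != B ->
  exists2 x, hull v A x & F = [set j in B | dotv x (u j) == 1].
Proof.
case=> hv hu vu hx hy /pfaceP[a [b [ub ->]]] ne; pose a' := coord_proj S a.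
have ua' j : j \in B -> dotv (u j) a' = dotv (u j) a.
  by move=> jB; rewrite (dotv_in_coords a (hu j jB)).
have u0 : hull u B 0.
  by apply: hy => [k|i _]; rewrite ?mxE // dotv0r ler01.
have : 0 <= b by rewrite -(dotv0l a); apply: hull_dotv u0 _ => j /ub.
rewrite le_eqVlt => /orP[/eqP b0|b0].
  have a0 : a' = 0.
    apply: (@hull_ray0 _ _ _ v A) => t t0; apply: hx => [|j jB].
      by apply/in_coordsZ/coord_proj_in.
    rewrite dotvZl dotvC ua' // (le_trans _ ler01) // mulr_ge0_le0 //.
    by have := ub j jB; rewrite -b0.
  case/eqP: ne; apply/setP => j; rewrite inE; case jB: (j \in B) => //=.
  by rewrite -ua' // a0 dotv0r b0 eqxx.
exists (b^-1 *: a').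
  apply: hx => [|j jB]; first by apply/in_coordsZ/coord_proj_in.
  by rewrite dotvZl dotvC ua' // mulrC ler_pdivrMr // mul1r ub.
apply/setP => j; rewrite !inE; case jB: (j \in B) => //=.
rewrite dotvZl (dotvC a') ua' //; apply/eqP/eqP => [->|/(congr1 ( *%R b))].
  by rewrite mulVf ?gt_eqF.
by rewrite mulrA mulfV ?gt_eqF // mul1r mulr1.
Qed.

Lemma hull_tight v (A : {set I}) (c : I -> R) y : (forall i, 0 <= c i) ->
  \sum_(i in A) c i = 1 -> (forall i, i \in A -> dotv (v i) y <= 1) ->
  dotv (\sum_(i in A) c i *: v i) y = 1 <->
  forall i, i \in A -> c i != 0 -> dotv (v i) y = 1.
Proof.
move=> c0 c1 h; rewrite dotv_suml; split => [e i iA ci|e]; last first.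
  rewrite -[RHS]c1; apply: eq_bigr => i iA; rewrite dotvZl.
  by have [->|/(e i iA) ->] := eqVneq (c i) 0; rewrite ?mul0r ?mulr1.
have : \sum_(i in A) c i * (1 - dotv (v i) y) == 0.
  have -> : \sum_(i in A) c i * (1 - dotv (v i) y) =
      \sum_(i in A) c i - \sum_(i in A) dotv (c i *: v i) y.
    by rewrite -sumrB; apply: eq_bigr => k _; rewrite dotvZl mulrBr mulr1.
  by rewrite c1 e subrr.
rewrite psumr_eq0 => [|k kA]; last by rewrite mulr_ge0 // subr_ge0 h.
move/allP/(_ i (mem_index_enum _)); rewrite iA /= mulf_eq0 (negbTE ci) subr_eq0.
by move/eqP.
Qed.

End Galois.

Section GaloisConnection.
Context {I J : finType}.
Variables (S : {set 'I_d}) (v : I -> 'rV[R]_d) (A : {set I}) (u : J -> 'rV[R]_d) (B : {set J}).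
Hypothesis puv : polar_pair S v A u B.

Lemma hull0_polar : hull u B 0.
Proof. by case: puv => _ _ _ _; apply=> [k|i _]; rewrite ?mxE // dotv0r ler01. Qed.

Lemma dual_face_full : dual_face v A u B = set0.
Proof.
apply/setP => i; rewrite [RHS]inE; apply/negP => /dual_faceP[iA h].
suff : (0 : R) <= -1 by rewrite oppr_ge0 ler10.
rewrite -(dotv0l (- v i)); apply: hull_dotv hull0_polar _ => j jB.
by rewrite dotvNr dotvC h.
Qed.

(** Write the point exposing [F] as a convex combination of the [v i]. By complementary slackness,
    tightness at this point is tightness at all [v i] of positive weight, and these belong to the
    dual face. *)
Lemma dual_faceK F : F \in pface u B -> dual_face u B v (dual_face v A u F) = F.
Proof.
move=> hF; case: (puv) => hv hu vu hx hy.
have [->|ne] := eqVneq F B.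
  rewrite dual_face_full; apply/setP => j; rewrite inE.
  by case: (j \in B) => //=; apply/forall_inP => i; rewrite inE.
have [x [c [c0 c1 ->]] eF] := polar_face puv hF ne.
have tight j : j \in B -> (dotv (\sum_(i in A) c i *: v i) (u j) = 1 <->
    forall i, i \in A -> c i != 0 -> dotv (v i) (u j) = 1).
  by move=> jB; apply: hull_tight => // i iA; apply: vu.
apply/setP => j; apply/dual_faceP/idP => [[jB h]|jF].
  rewrite eF inE jB /=; apply/eqP/tight => // i iA ci; rewrite dotvC h //.
  apply/dual_faceP; split=> // k; rewrite eF inE => /andP[kB /eqP /(tight k kB)]; exact.
split; first by move: jF; rewrite eF inE => /andP[].
by move=> i /dual_faceP[iA h]; rewrite dotvC h.
Qed.

Lemma dual_face_inP (G : {set J}) : G \subset B -> dual_face v A u G \in pface v A.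
Proof.
case: puv => _ _ vu _ _ /fintype.subsetP s; apply: dual_face_in => i j iA /s; exact: vu.
Qed.

Lemma dual_face_inj : {in pface u B &, injective (dual_face v A u)}.
Proof. by move=> F G hF hG e; rewrite -[F]dual_faceK // e dual_faceK. Qed.

Lemma card_chains_dual n : (#|chains (pface u B) n| <= #|chains (pface v A) n|)%N.
Proof.
apply: (chains_antitone (g := dual_face v A u)) => [F hF||F G _ _].
- by apply: dual_face_inP; apply: face_sub hF.
- exact: dual_face_inj.
- exact: dual_face_anti.
Qed.

(** Only a lower bound for the flags above a face is wanted later, so an order-reversing injection
    is enough. *)
Lemma card_chains_dual_above G n : G \in pface u B ->
  (#|chains (pface u G) n| <=
   #|chains (faces_above (fun i => lift1 (v i)) A (dual_face v A u G)) n|)%N.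
Proof.
move=> hG; apply: (chains_antitone (g := dual_face v A u)) => [F hF||F H _ _].
- rewrite inE dual_face_inP ?dual_face_anti ?(face_sub hF) //.
  exact: subset_trans (face_sub hF) (face_sub hG).
- by move=> F H hF hH; apply: dual_face_inj; apply: face_trans hG _.
- exact: dual_face_anti.
Qed.

End GaloisConnection.

Lemma card_chains_polar (I J : finType) S (v : I -> 'rV[R]_d) (A : {set I})
    (u : J -> 'rV[R]_d) (B : {set J}) n : polar_pair S v A u B ->
  #|chains (pface u B) n| = #|chains (pface v A) n|.
Proof.
move=> h; apply/eqP; rewrite eqn_leq (card_chains_dual h) (card_chains_dual (polar_pair_sym h)) //.
Qed.

End PointFaces.

(** * Locally anti-blocking configurations *)

Lemma face_rank_card (R : realType) n (I : finType) (w : I -> 'rV[R]_n) (A : {set I}) :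
  (face_rank w A <= #|A|)%N.
Proof.
rewrite /face_rank -sum1_card; elim/big_ind2: _ => [|U m V p hU hV|i _].
- by rewrite mxrank0.
- exact: leq_trans (mxrank_adds_leqif _ _) (leq_add hU hV).
- by rewrite genmxE rank_leq_row.
Qed.

Lemma rank_in_coords (R : realType) d (I : finType) (v : I -> 'rV[R]_d) (A : {set I})
    (S : {set 'I_d}) p : (forall k, k \in A -> in_coords S (v k - p)) ->
  (face_rank (fun k => lift1 (v k)) A <= #|S|.+1)%N.
Proof.
move=> h; pose e (o : option 'I_d) : 'rV[R]_(d + 1) :=
  if o is Some j then affine_form (delta_mx 0 j) 0 else affine_form p 1.
have nS : None \notin Some @: S by apply/negP => /imsetP[].
have <- : #|None |: Some @: S| = #|S|.+1 by rewrite cardsU1 nS card_imset //; apply: Some_inj.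
apply: leq_trans (face_rank_card e _); apply: mxrankS.
apply/sumsmx_subP => k kA; rewrite genmxE.
have -> : lift1 (v k) = e None + \sum_(j in S) (v k - p) 0 j *: e (Some j).
  apply: dotv_eq => c; have [a [b ->]] := affine_formP c; rewrite dotvC dotv_lift1.
  rewrite dotvDr dotv_affine mulr1 addrAC; congr (_ + _).
  rewrite dotv_sumr -{1}(subrK p (v k)) dotvDl addrC [dotv p a]dotvC; congr (_ + _).
  rewrite {1}/dotv [RHS]big_mkcond /=; apply: eq_bigr => j _.
  case: ifPn => jS; last by rewrite (h k kA j jS) mul0r.
  by rewrite dotvZr dotv_affine mulr0 addr0 dotv_delta.
apply: addmx_sub; first by apply: span_member; rewrite setU11.
apply: summx_sub => j jS; apply: scalemx_sub; apply: span_member.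
by rewrite inE imset_f ?orbT.
Qed.

Lemma exists_small (R : realType) (J : finType) (f g : J -> R) : (forall j, 0 < f j) ->
  exists2 t, 0 < t & forall j, t * g j <= f j.
Proof.
move=> f0; pose N := 1 + \sum_j `|g j| / f j.
have s0 : 0 <= \sum_j `|g j| / f j by apply: sumr_ge0 => j _; rewrite divr_ge0 // ltW.
have N0 : 0 < N by rewrite /N; lra.
exists N^-1 => [|j]; first by rewrite invr_gt0.
rewrite mulrC ler_pdivrMr // mulrC -ler_pdivrMr //.
apply: le_trans (_ : `|g j| / f j <= N); first by rewrite ler_pM2r ?invr_gt0 // ler_norm.
rewrite /N (bigD1 j) //= ; have : 0 <= \sum_(k | k != j) `|g k| / f k.
  by apply: sumr_ge0 => k _; rewrite divr_ge0 // ltW.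
by lra.
Qed.

Section LabDatum.
Context {R : realType} {d : nat}.
Implicit Types (S K : {set 'I_d}).

Lemma rowB (x y : 'rV[R]_d) j : (x - y) 0 j = x 0 j - y 0 j.
Proof. by rewrite !mxE. Qed.

Section Defs.
Context {I : finType}.
Implicit Types (v : I -> 'rV[R]_d) (A : {set I}) (i j : 'I_d) (s : bool).

(* Finite point configurations that are closed under coordinate projections:
   their convex hulls are the proper locally anti-blocking polytopes in R^S. *)
Definition lab S v A : Prop :=
  [/\ A != set0, forall k, k \in A -> in_coords S (v k),
      forall K k, k \in A -> exists2 k', k' \in A & v k' = coord_proj K (v k)
    & forall i, i \in S -> (exists2 k, k \in A & 0 < v k 0 i) /\
                           (exists2 k, k \in A & v k 0 i < 0)].

(** A direction is a pair [(i, s)], where [s = true] stands for the negative half-axis. For [i] in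
    [S] a [lab] has points of both signs, so the initial value 0 does not affect the maximum. *)
Definition tip v A i s : R := \big[Num.max/0]_(k in A) ((-1) ^+ s * v k 0 i).

Definition top v A i s : {set I} := [set k in A | (-1) ^+ s * v k 0 i == tip v A i s].

Definition pole v A i s : 'rV[R]_d := ((-1) ^+ s * tip v A i s) *: delta_mx 0 i.

Definition two_sided v A i s : Prop := forall j, j != i ->
  (exists2 k, k \in top v A i s & 0 < v k 0 j) <->
  (exists2 k, k \in top v A i s & v k 0 j < 0).

Definition spread v A i s : {set 'I_d} :=
  [set j | (j != i) && [exists k in top v A i s, v k 0 j != 0]].

(** Projections to the axis [i] give points on both sides of the origin, which bounds [a 0 i] from
    both sides. This is the spanning condition under which a polar family is available. *)
Lemma lab_nonneg_orth S v A a : lab S v A ->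
  (forall k, k \in A -> 0 <= dotv (v k) a) -> forall i, i \in S -> a 0 i = 0.
Proof.
case=> _ _ proj pos ha i iS; have [[k kA kp] [l lA ln]] := pos i iS.
have single m : m \in A -> 0 <= v m 0 i * a 0 i.
  case/(proj [set i]) => m' /ha h e; move: h; rewrite e coord_projC.
  rewrite {1}/dotv (bigD1 i) //= mxE inE eqxx big1 ?addr0 // => j /negbTE ji.
  by rewrite mxE inE ji mulr0.
apply/eqP; rewrite eq_le -(pmulr_rge0 _ kp) single // andbT.
by rewrite -(nmulr_rge0 _ ln) single.
Qed.

Section Top.
Variables (S : {set 'I_d}) (v : I -> 'rV[R]_d) (A : {set I}) (i : 'I_d) (s : bool).
Hypotheses (lv : lab S v A) (iS : i \in S).

Lemma tip_ge k : k \in A -> (-1) ^+ s * v k 0 i <= tip v A i s.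
Proof. by move=> kA; apply: (le_bigmax_cond _ (fun k => (-1) ^+ s * v k 0 i)). Qed.

Lemma tip_gt0 : 0 < tip v A i s.
Proof.
have [_ _ _ /(_ i iS)[[k kA kp] [l lA ln]]] := lv.
case: s (@tip_ge) => h; [have := h l lA|have := h k kA]; apply: lt_le_trans.
  by rewrite expr1 mulN1r oppr_gt0.
by rewrite expr0 mul1r.
Qed.

Lemma top_attained : exists2 k, k \in A & (-1) ^+ s * v k 0 i = tip v A i s.
Proof.
have [/set0Pn[k0 k0A] _ _ _] := lv.
case: (@arg_maxP _ R I k0 (mem A) (fun k => (-1) ^+ s * v k 0 i) k0A) => m mA hm.
exists m => //; apply: le_anti; rewrite tip_ge //=.
have [h|h] := leP 0 ((-1) ^+ s * v m 0 i); first by apply: bigmax_le.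
have := tip_gt0; rewrite ltNge; case/negP.
by apply: bigmax_le => // k /hm /le_trans; apply; apply: ltW.
Qed.

Lemma top_sub : top v A i s \subset A.
Proof. by apply/fintype.subsetP => k; rewrite inE => /andP[]. Qed.

Lemma topP k : k \in top v A i s <-> k \in A /\ v k 0 i = (-1) ^+ s * tip v A i s.
Proof.
rewrite inE; split => [/andP[kA /eqP <-]|[kA ->]]; first by rewrite signrMK.
by rewrite kA signrMK eqxx.
Qed.

Lemma poleE j : pole v A i s 0 j = (if j == i then (-1) ^+ s * tip v A i s else 0).
Proof. by rewrite !mxE eqxx /= eq_sym; case: eqP; rewrite ?mulr1 ?mulr0. Qed.

Lemma top_proj K k : k \in top v A i s -> i \in K ->
  exists2 k', k' \in top v A i s & v k' = coord_proj K (v k).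
Proof.
move=> /topP[kA ki] iK; have [_ _ /(_ K k kA)[k' k'A e] _] := lv.
by exists k' => //; apply/topP; rewrite e coord_projE iK.
Qed.

Lemma pole_top : exists2 k, k \in top v A i s & v k = pole v A i s.
Proof.
have [k0 k0A e0] := top_attained.
have k0T : k0 \in top v A i s by rewrite inE k0A e0 eqxx.
have [k kT e] := top_proj k0T (set11 i); exists k => //; rewrite e.
apply/rowP => j; rewrite coord_projE poleE inE; case: eqP => // ->.
by have [_ ->] := (topP k0).1 k0T.
Qed.

Lemma top_face : top v A i s \in pface v A.
Proof.
have e k : dotv (v k) ((-1) ^+ s *: delta_mx 0 i) = (-1) ^+ s * v k 0 i.
  by rewrite dotvZr dotv_delta.
suff -> : top v A i s =
    [set k in A | dotv (v k) ((-1) ^+ s *: delta_mx 0 i) == tip v A i s].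
  by apply: pface_exposed => k kA; rewrite e tip_ge.
by apply/setP => k; rewrite !inE e.
Qed.

Lemma spread_sub : spread v A i s \subset S :\ i.
Proof.
apply/fintype.subsetP => j; rewrite !inE => /andP[->] /exists_inP[k kT kj] /=.
apply: contraNT kj => jS; have [_ h _ _] := lv.
by rewrite (h k _ j jS) ?eqxx // (fintype.subsetP top_sub).
Qed.

(** Projections that keep coordinate [i] stay inside [T], so the translate by the pole is closed
    under projections; two-sidedness supplies both signs in each coordinate in which [T] has
    extent. *)
Lemma lab_top : two_sided v A i s ->
  lab (spread v A i s) (fun k => v k - pole v A i s) (top v A i s).
Proof.
move=> ts; have [p0 p0T ep] := pole_top; split.
- by apply/set0Pn; exists p0.
- move=> k kT j; rewrite !inE negb_and negbK rowB poleE.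
  have [_ ki] := (topP k).1 kT.
  case: eqP => [->|_] /=; first by rewrite ki subrr.
  rewrite negb_exists_in => /forall_inP/(_ k kT); rewrite negbK => /eqP ->.
  by rewrite subr0.
- move=> K k kT; have [k' k'T e] := top_proj kT (setU11 i K); exists k' => //.
  rewrite e; apply/rowP => j; rewrite rowB poleE !coord_projE !inE.
  rewrite rowB poleE; have [_ ki] := (topP k).1 kT.
  by case: eqP => [->|_] /=; rewrite ?ki ?subrr ?subr0 //; case: ifP.
- move=> j; rewrite inE => /andP[ji /exists_inP[k kT kj]].
  have e l : (v l - pole v A i s) 0 j = v l 0 j.
    by rewrite rowB poleE (negbTE ji) subr0.
  have : 0 < v k 0 j \/ v k 0 j < 0 by apply/orP; rewrite orbC -neq_lt.
  have [h1 h2] := ts j ji; case=> h.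
    have [l lT hl] := h1 (ex_intro2 _ _ k kT h).
    by split; [exists k|exists l] => //; rewrite e.
  have [l lT hl] := h2 (ex_intro2 _ _ k kT h).
  by split; [exists l|exists k] => //; rewrite e.
Qed.

Section Tight.
Variable y : 'rV[R]_d.
Hypotheses (vy : forall k, k \in A -> dotv (v k) y <= 1) (py : dotv (pole v A i s) y = 1).

(** Keeping only the coordinates [i] and [l] of a point of [T], validity of [y] gives a product that
    is at most 0. As coordinate [l] takes both signs on [T] or vanishes there, the product is 0. *)
Lemma top_orth k l : two_sided v A i s -> k \in top v A i s -> l != i -> v k 0 l * y 0 l = 0.
Proof.
move=> ts kT li.
have le0 m : m \in top v A i s -> v m 0 l * y 0 l <= 0.
  move=> mT; have [m' m'T e] := top_proj mT (setU11 i [set l]).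
  have := vy (fintype.subsetP top_sub _ m'T).
  rewrite e /dotv (bigD1 i) //= (bigD1 l) //= big1 => [|p /andP[pi pl]]; last first.
    by rewrite coord_projE !inE (negbTE pi) (negbTE pl) mul0r.
  rewrite !coord_projE !inE !eqxx orbT addr0 /=; have [_ ->] := (topP m).1 mT.
  move: py; rewrite /pole dotvZl [dotv (delta_mx _ _) _]dotvC dotv_delta => ->.
  by rewrite gerDl.
have [->|nz] := eqVneq (v k 0 l) 0; first by rewrite mul0r.
have [h1 h2] := ts l li; suff -> : y 0 l = 0 by rewrite mulr0.
have [k1 T1 p1] : exists2 m, m \in top v A i s & 0 < v m 0 l.
  by move: nz; rewrite neq_lt => /orP[h|h]; [apply: h2|]; exists k.
have [k2 T2 p2] := h1 (ex_intro2 _ _ k1 T1 p1).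
apply/le_anti; rewrite -(pmulr_rle0 _ p1) le0 //=.
by rewrite -(nmulr_rle0 _ p2) le0.
Qed.

(** So a face of the polytope through the pole contains all of [T]. *)
Lemma top_tight k : two_sided v A i s -> k \in top v A i s -> dotv (v k) y = 1.
Proof.
move=> ts kT; rewrite /dotv (bigD1 i) //= big1 => [|l li]; last exact: top_orth.
have [_ ->] := (topP k).1 kT; move: py.
by rewrite /pole dotvZl [dotv (delta_mx _ _) _]dotvC dotv_delta addr0.
Qed.

End Tight.

(* Deleting coordinate l keeps the configuration below the hyperplane. *)
Lemma polar_prod_ge0 y k l : (forall k, k \in A -> dotv (v k) y <= 1) -> k \in A ->
  dotv (v k) y = 1 -> 0 <= v k 0 l * y 0 l.
Proof.
move=> vy kA ky; have [_ _ proj _] := lv.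
have [k' k'A e] := proj [set~ l] k kA; have := vy k' k'A.
rewrite e -ky {1}/dotv (bigD1 l) //= coord_projE !inE eqxx mul0r add0r.
rewrite {1}/dotv [X in _ <= X](bigD1 l) //= => h.
rewrite -(lerD2r (\sum_(m < d | m != l) v k 0 m * y 0 m)) add0r; apply: le_trans h.
by apply: ler_sum => m ml; rewrite coord_projE !inE ml.
Qed.

End Top.
End Defs.

Section DualTop.
Context {I J : finType}.
Variables (S : {set 'I_d}) (v : I -> 'rV[R]_d) (A : {set I}) (u : J -> 'rV[R]_d) (B : {set J}).
Hypotheses (lv : lab S v A) (lu : lab S u B) (puv : polar_pair S v A u B).
Variables (i : 'I_d) (s : bool).
Hypothesis (iS : i \in S).

(** Projection to an axis and section by it coincide, so this is polarity of segments. *)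
Lemma tip_polar : tip u B i s = (tip v A i s)^-1.
Proof.
have b0 := tip_gt0 s lv iS; have [hv hu vu hx hy] := puv.
apply/le_anti/andP; split.
  have [j jB <-] := top_attained s lu iS.
  have [k kT e] := pole_top s lv iS; have kA := fintype.subsetP (top_sub v A i s) _ kT.
  have := vu k j kA jB; rewrite e /pole dotvZl dotvC dotv_delta.
  by rewrite -[X in _ -> _ <= X]mul1r ler_pdivlMr // mulrAC mulrC mulrA.
have hp : hull u B ((-1) ^+ s * (tip v A i s)^-1 *: delta_mx 0 i).
  apply: hy => [j jS|k kA].
    by rewrite !mxE eqxx /=; case: eqP jS => [->|_ _]; rewrite ?iS // mulr0.
  by rewrite dotvZr dotv_delta mulrAC ler_pdivrMr // mul1r tip_ge.
have := hull_dotv (a := (-1) ^+ s *: delta_mx 0 i) (b := tip u B i s) hp.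
rewrite dotvZl dotvZr dotv_delta mxE !eqxx mulr1 mulrAC -expr2 sqrr_sign mul1r.
by apply=> j jB; rewrite dotvZr dotv_delta tip_ge.
Qed.

Lemma pole_polar : dotv (pole v A i s) (pole u B i s) = 1.
Proof.
rewrite /pole dotvZl dotvZr dotv_delta mxE !eqxx mulr1 tip_polar mulrACA -expr2 sqrr_sign.
by rewrite mul1r mulfV ?gt_eqF ?(tip_gt0 s lv).
Qed.

Lemma pole_top_polar j : j \in top u B i s -> dotv (pole v A i s) (u j) = 1.
Proof.
move=> jT; have [_ uj] := (topP u B i s j).1 jT.
rewrite -pole_polar [pole v A i s]/pole !dotvZl !(dotvC (delta_mx _ _)) !dotv_delta uj.
by rewrite poleE eqxx.
Qed.

Lemma dual_top_orth : two_sided v A i s -> forall k j l, k \in top v A i s ->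
  j \in top u B i s -> l != i -> v k 0 l * u j 0 l = 0.
Proof.
move=> ts k j l kT jT; have [_ _ vu _ _] := puv; apply: (top_orth lv) kT => //.
  by move=> m mA; apply: vu mA (fintype.subsetP (top_sub u B i s) _ jT).
exact: pole_top_polar.
Qed.

(* If no facet through the pole leaned in direction l, the pole could be moved
   a little in that direction without leaving the hull. *)
Lemma dual_top_both l t : l \in S -> l != i -> l \notin spread v A i s ->
  exists2 j, j \in top u B i s & 0 < (-1) ^+ t * u j 0 l.
Proof.
move=> lS li lsp; have [hv hu vu hx hy] := puv; apply: contrapT => no.
have b0 := tip_gt0 s lv iS.
have le0 j : j \in top u B i s -> (-1) ^+ t * u j 0 l <= 0.
  by move=> jT; rewrite leNgt; apply/negP => h; apply: no; exists j.
have slack j : j \in B -> j \notin top u B i s -> 0 < 1 - dotv (pole v A i s) (u j).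
  move=> jB jT; have [k kT e] := pole_top s lv iS; rewrite -e subr_gt0.
  rewrite lt_neqAle vu ?(fintype.subsetP (top_sub v A i s)) // andbT.
  apply: contra jT => /eqP; rewrite e /pole dotvZl dotvC dotv_delta => h.
  rewrite inE jB tip_polar /=; apply/eqP/(mulIf (lt0r_neq0 b0)).
  by rewrite mulVf ?gt_eqF // mulrAC.
pose f j := if (j \in B) && (j \notin top u B i s) then 1 - dotv (pole v A i s) (u j) else 1.
have f0 j : 0 < f j by rewrite /f; case: ifP => // /andP[]; apply: slack.
have [eps e0 he] := exists_small (fun j => (-1) ^+ t * u j 0 l) f0.
pose x := pole v A i s + (eps * (-1) ^+ t) *: delta_mx 0 l.
have xl : x 0 l = eps * (-1) ^+ t.
  by rewrite mxE poleE (negbTE li) add0r !mxE !eqxx mulr1.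
have hp : hull v A x.
  apply: hx => [m mS|j jB].
    have mi : m != i by apply: contraNneq mS => ->.
    have ml : m != l by apply: contraNneq mS => ->.
    by rewrite mxE poleE (negbTE mi) !mxE (negbTE ml) andbF mulr0 addr0.
  rewrite /x dotvDl [dotv (_ *: delta_mx 0 l) _]dotvZl [dotv (delta_mx _ l) _]dotvC dotv_delta -mulrA.
  have := he j; rewrite /f jB /=; case: ifPn => jT; first by rewrite lerBrDl.
  move: jT; rewrite negbK => jT _.
  rewrite (pole_top_polar jT).
  by rewrite gerDl mulr_ge0_le0 ?le0 // ltW.
case: hp => c [c0 c1 ex].
have : \sum_(k in A) c k * (tip v A i s - (-1) ^+ s * v k 0 i) == 0.
  have -> : \sum_(k in A) c k * (tip v A i s - (-1) ^+ s * v k 0 i) =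
      (\sum_(k in A) c k) * tip v A i s - (-1) ^+ s * (\sum_(k in A) c k *: v k) 0 i.
    rewrite mulr_suml summxE mulr_sumr -sumrB; apply: eq_bigr => k _.
    by rewrite mulrBr mxE mulrCA.
  rewrite c1 -ex mul1r mxE poleE eqxx !mxE [i == l]eq_sym (negbTE li) andbF mulr0 addr0.
  by rewrite signrMK subrr.
rewrite psumr_eq0 => [/allP h|k kA]; last by rewrite mulr_ge0 // subr_ge0 tip_ge.
have : x 0 l = 0.
  rewrite ex summxE big1 // => k kA; rewrite mxE.
  have := h k (mem_index_enum _); rewrite kA /= mulf_eq0 subr_eq0.
  case/orP => [/eqP ->|/eqP e]; first by rewrite mul0r.
  have kT : k \in top v A i s by rewrite inE kA -e eqxx.
  move: lsp; rewrite inE li /= negb_exists_in => /forall_inP/(_ k kT).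
  by rewrite negbK => /eqP ->; rewrite mulr0.
by rewrite xl => /eqP; rewrite mulf_eq0 signr_eq0 orbF gt_eqF.
Qed.

(** Where [T] has extent, the dual face has none by [dual_top_orth]; in the other coordinates the
    dual face has points on both sides by [dual_top_both]. Hence the two spreads partition [S :\ i],
    and the two dimensions add up to [#|S| - 1]. *)
Lemma spread_dual : two_sided v A i s ->
  spread u B i s = S :\ i :\: spread v A i s /\ two_sided u B i s.
Proof.
move=> ts; have [hv hu vu hx hy] := puv.
have zero l j : l \in spread v A i s -> j \in top u B i s -> u j 0 l = 0.
  rewrite inE => /andP[li /exists_inP[k kT kl]] jT.
  have /eqP := dual_top_orth ts kT jT li.
  by rewrite mulf_eq0 (negbTE kl) => /eqP.
have out l j : l \notin S -> j \in top u B i s -> u j 0 l = 0.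
  by move=> lS jT; apply: hu lS; apply: (fintype.subsetP (top_sub u B i s)).
have both l : l \in S -> l != i -> l \notin spread v A i s ->
    (exists2 j, j \in top u B i s & 0 < u j 0 l) /\
    (exists2 j, j \in top u B i s & u j 0 l < 0).
  move=> lS li lsp; split.
    by have [j jT] := dual_top_both false lS li lsp; rewrite mul1r; exists j.
  have [j jT] := dual_top_both true lS li lsp.
  by rewrite expr1 mulN1r oppr_gt0; exists j.
split.
  apply/setP => l; rewrite [RHS]inE in_setD1 inE andbC.
  case: (eqVneq l i) => [_|li] /=; first by rewrite !andbF.
  rewrite andbT; case: (boolP (l \in S)) => lS; last first.
    by rewrite andbF; apply/negbTE/exists_inPn => j jT; rewrite out // eqxx.
  rewrite andbT; case: (boolP (l \in spread v A i s)) => lsp /=.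
    by apply/negbTE/exists_inPn => j jT; rewrite zero // eqxx.
  have [[j jT uj] _] := both l lS li lsp.
  by apply/exists_inP; exists j; rewrite // gt_eqF.
move=> l li; case: (boolP (l \in S)) => lS; last first.
  by split=> -[j jT]; rewrite out // ltxx.
case: (boolP (l \in spread v A i s)) => lsp.
  by split=> -[j jT]; rewrite zero // ltxx.
by have [h1 h2] := both l lS li lsp; split.
Qed.

Lemma dual_face_top : two_sided v A i s -> dual_face v A u (top u B i s) = top v A i s.
Proof.
move=> ts; apply/setP => k; apply/dual_faceP/idP => [[kA h]|kT].
  have [j jT e] := pole_top s lu iS; have := h j jT.
  rewrite e /pole dotvZr dotv_delta tip_polar => hk; rewrite inE kA /=; apply/eqP.
  have b0 := tip_gt0 s lv iS.
  apply: (mulfI (_ : (tip v A i s)^-1 != 0)); first by rewrite invr_eq0 gt_eqF.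
  by rewrite mulVf ?gt_eqF // mulrCA mulrA.
split=> [|j jT]; first exact: (fintype.subsetP (top_sub v A i s)).
have [_ _ vu _ _] := puv; apply: (top_tight lv) kT => //; last exact: pole_top_polar.
by move=> m mA; apply: vu mA (fintype.subsetP (top_sub u B i s) _ jT).
Qed.

End DualTop.

End LabDatum.

(** * Two-sided configurations *)

(** Through the second half, equality in the count forces each flag to belong to one of the
    directions. *)
Lemma disjoint_card_sum (K T : finType) (P : {set K}) (f : K -> {set T}) (D : {set T}) :
  (forall p, p \in P -> f p \subset D) ->
  (forall p q x, p \in P -> q \in P -> x \in f p -> x \in f q -> p = q) ->
  (\sum_(p in P) #|f p| <= #|D|)%N /\
  ((\sum_(p in P) #|f p|)%N = #|D| -> forall x, x \in D -> exists2 p, p \in P & x \in f p).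
Proof.
move=> sub dis; pose U := [set x | [exists p in P, x \in f p]].
have e : (\sum_(p in P) #|f p|)%N = #|U|.
  transitivity (\sum_(p in P) \sum_(x in U) (x \in f p))%N.
    apply: eq_bigr => p pP; rewrite -sum1_card [RHS]big_mkcond [LHS]big_mkcond /=.
    apply: eq_bigr => x _; rewrite inE; case: (boolP (x \in f p)) => xp; last by case: ifP.
    by case: exists_inP => // -[]; exists p.
  rewrite exchange_big -sum1_card /=; apply: eq_bigr => x; rewrite inE => /exists_inP[p pP xp].
  rewrite (bigD1 p) //= xp big1 ?addn0 // => q /andP[qP qp].
  by case xq: (x \in f q) => //; move: qp; rewrite (dis q p x) ?eqxx.
have sUD : U \subset D.
  by apply/fintype.subsetP => x; rewrite inE => /exists_inP[p /sub/fintype.subsetP]; apply.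
rewrite e; split; first exact: subset_leq_card.
move=> eU x; have -> : D = U by apply/eqP; rewrite eq_sym eqEcard sUD eU leqnn.
by rewrite inE => /exists_inP.
Qed.

Section LabBound.
Context {R : realType} {d : nat}.
Implicit Types (S K : {set 'I_d}).

(** Coordinate projections are self-adjoint, so projecting a polar generator yields an inequality
    that is still valid on a family closed under projections. Adjoining all projections therefore
    does not change the hull. If a sign were missing in coordinate [k], a half-axis would be a ray
    in the hull of [v]. *)
Lemma lab_dual (I : finType) S (v : I -> 'rV[R]_d) (A : {set I}) : lab S v A ->
  exists (J : finType) (u : J -> 'rV[R]_d), lab S u setT /\ polar_pair S v A u setT.
Proof.
move=> lv; have [A0 hv proj pos] := lv.
have [m [u0 [_ hu0 vu0 hx0 hy0]]] := polar_pair_exists A0 hv (fun a => lab_nonneg_orth lv).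
have [j0 _] : exists j : 'I_m, j \in setT.
  have [c [_ c1 _]] : hull u0 setT 0.
    by apply: hy0 => [k|i _]; rewrite ?mxE // dotv0r ler01.
  apply: contrapT => no; move: c1; rewrite big1 => [/eqP|j jT]; first by rewrite eq_sym oner_eq0.
  by case: no; exists j.
pose u (p : 'I_m * {set 'I_d}) := coord_proj p.2 (u0 p.1).
have hu p : p \in [set: 'I_m * {set 'I_d}] -> in_coords S (u p).
  by move=> _ k kS; rewrite coord_projE hu0 ?if_same.
have vu i p : i \in A -> p \in [set: 'I_m * {set 'I_d}] -> dotv (v i) (u p) <= 1.
  move=> iA _; rewrite /u -coord_projC; have [i' i'A <-] := proj p.2 i iA.
  by apply: vu0.
have hx x : in_coords S x -> (forall p, p \in [set: 'I_m * {set 'I_d}] -> dotv x (u p) <= 1) ->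
    hull v A x.
  move=> xS h; apply: hx0 => // j _; have := h (j, setT) (in_setT _).
  by rewrite /u /= dotv_in_coords //; apply: in_coords_setT.
have puv : polar_pair S v A u setT.
  split => //; apply: polar_of_halfspaces hx => //.
  have -> : 0 = u (j0, set0) by apply/rowP => k; rewrite coord_projE inE mxE.
  exact: hull_mem.
exists ('I_m * {set 'I_d})%type, u; split => //; split.
- by apply/set0Pn; exists (j0, setT).
- exact: hu.
- move=> K [j L] _; exists (j, K :&: L) => //; apply/rowP => k.
  by rewrite /u !coord_projE inE /=; case: (k \in K).
- have ray (t : R) k : k \in S -> (forall p, t * u p 0 k <= 0) -> t = 0.
    move=> kS h; have : t *: (delta_mx 0 k : 'rV[R]_d) = 0.
      apply: (@hull_ray0 _ _ _ v A) => s s0; apply: hx => [l lS|p _].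
        by rewrite !mxE; have -> : l == k = false by [apply: contraNF lS => /eqP ->]; rewrite andbF !mulr0.
      rewrite dotvZl dotvZl dotvC dotv_delta (le_trans _ ler01) //.
      by rewrite mulr_ge0_le0.
    by move/rowP/(_ k); rewrite !mxE !eqxx mulr1.
  move=> k kS; split; apply: contrapT => no.
    suff /eqP : (1 : R) = 0 by rewrite oner_eq0.
    apply: (ray _ k kS) => p.
    by rewrite mul1r leNgt; apply/negP => h; apply: no; exists p.
  suff /eqP : (-1 : R) = 0 by rewrite oppr_eq0 oner_eq0.
  apply: (ray _ k kS) => p.
  by rewrite mulN1r oppr_le0 leNgt; apply/negP => h; apply: no; exists p.
Qed.

Definition through {I : finType} (v : I -> 'rV[R]_d) (A T : {set I}) N :
    {set {ffun 'I_N.+3 -> {set I}}} :=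
  [set F in chains (pface v A) N.+3 | (F (inord 1) \subset T) && (T \subset F (inord N.+1))].

Lemma throughP {I : finType} (v : I -> 'rV[R]_d) (A T : {set I}) N
    (F : {ffun 'I_N.+3 -> {set I}}) :
  reflect [/\ F \in chains (pface v A) N.+3, F (inord 1) \subset T & T \subset F (inord N.+1)]
    (F \in through v A T N).
Proof.
rewrite /through [_ \in [set _ in _ | _]]inE.
by apply: and3P.
Qed.

(** What the equality case retains from being a shuffle: a step that keeps the meet with [T]
    enlarges the join with [T], and [Y] separates the two joins. *)
Definition grid_like {I : finType} (v : I -> 'rV[R]_d) (A T : {set I}) N
    (F : {ffun 'I_N.+3 -> {set I}}) : Prop :=
  forall k, (0 < k)%N -> (k <= N)%N -> F (inord k) :&: T = F (inord k.+1) :&: T ->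
  exists Y, [/\ Y \in pface v A, T \subset Y, F (inord k) \subset Y
    & ~~ (F (inord k.+1) \subset Y)].

Definition flag_bound n := forall (I : finType) (v : I -> 'rV[R]_d) (A : {set I}) S,
  #|S| = n -> lab S v A -> (2 ^ n * n`! <= #|chains (pface v A) n.+2|)%N.

Section TwoSidedStep.
Context {I J : finType}.
Variables (S : {set 'I_d}) (v : I -> 'rV[R]_d) (A : {set I}) (u : J -> 'rV[R]_d).
Variable N : nat.
Hypotheses (lv : lab S v A) (lu : lab S u setT) (puv : polar_pair S v A u setT).
Hypotheses (cardS : #|S| = N.+1) (IH : forall n, (n <= N)%N -> flag_bound n).
Hypothesis (ts : forall i s, i \in S -> two_sided v A i s).

Lemma rank_A : (face_rank (fun k => lift1 (v k)) A <= N.+2)%N.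
Proof.
rewrite -cardS; apply: (rank_in_coords (p := 0)) => k kA; rewrite subr0.
by case: lv => _ h _ _; apply: h.
Qed.

Lemma class_bound i s : i \in S ->
  (2 ^ N * N`! <= #|through v A (top v A i s) N|)%N /\
  (#|through v A (top v A i s) N| = 2 ^ N * N`! -> forall F,
   F \in through v A (top v A i s) N -> grid_like v A (top v A i s) F)%N.
Proof.
move=> iS; have tsi := ts s iS.
have [spu tsu] := spread_dual lv lu puv iS tsi.
set T := top v A i s; pose m := #|spread v A i s|; pose r := #|spread u setT i s|.
have EN : N = (m + r)%N.
  apply/eqP; rewrite -eqSS -cardS (cardsD1 i S) iS add1n eqSS.
  have ss : spread v A i s \subset S :\ i by apply: spread_sub.
  by rewrite /r spu (cardsD (S :\ i)) (setIidPr ss) subnKC // subset_leq_card.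
have rT : (face_rank (fun k => lift1 (v k)) T <= m.+1)%N.
  apply: (rank_in_coords (p := pole v A i s)) => k kT.
  by case: (lab_top lv iS tsi) => _ h _ _; apply: h.
have hA : (2 ^ m * m`! <= #|chains (pface v T) m.+2|)%N.
  rewrite -(pface_translate v (pole v A i s)).
  by apply: (IH (n := m)) (lab_top lv iS tsi); rewrite // EN leq_addr.
(* Flags above [T] correspond to flags of the dual top face, which is a [lab] in [r] coordinates
   once its pole is moved to the origin. *)
have hB : (2 ^ r * r`! <=
    #|chains (faces_above (fun k => lift1 (v k)) A T) r.+2|)%N.
  have tu : top u setT i s \in pface u setT by apply: top_face.
  have := card_chains_dual_above puv r.+2 tu.
  rewrite (dual_face_top lv lu puv iS tsi); apply: leq_trans.
  rewrite -(pface_translate u (pole u setT i s)).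
  by apply: (IH (n := r)) (lab_top lu iS tsu); rewrite // EN leq_addl.
have TL : T \in face_lattice (fun k => lift1 (v k)) A by apply: top_face.
have rA : (face_rank (fun k => lift1 (v k)) A <= (m + r).+2)%N by rewrite -EN rank_A.
(* With [N = m + r] the product of [2 ^ m * m!], [2 ^ r * r!] and the binomial coefficient is
   exactly [2 ^ N * N!], whatever the dimension of [T]. *)
have arith : (2 ^ N * N`! <= #|chains (pface v T) m.+2| *
    #|chains (faces_above (fun k => lift1 (v k)) A T) r.+2| * 'C(m + r, m))%N.
  apply: leq_trans (leq_mul (leq_mul hA hB) (leqnn _)).
  rewrite EN -(bin_fact (leq_addr r m)) addKn expnD.
  by apply/eq_leq; move: (2 ^ m)%N (2 ^ r)%N m`! r`! 'C(_, _) => a b c e f; clear; ring.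
have b := shuffle_bound TL rT rA; rewrite -/(through v A T (m + r)) in b.
have g := shuffle_equality TL rT rA; rewrite -/(through v A T (m + r)) in g.
clearbody m r; subst N; split=> [|e F hF k k0 kN eT]; first exact: leq_trans arith b.
have e2 : #|through v A T (m + r)| = (#|chains (pface v T) m.+2| *
    #|chains (faces_above (fun k => lift1 (v k)) A T) r.+2| * 'C(m + r, m))%N.
  by apply/eqP; rewrite eqn_leq b andbT e.
exact: g e2 F hF k k0 kN eT.
Qed.

Lemma class_inj i s i' s' F : i \in S -> i' \in S -> F \in through v A (top v A i s) N ->
  F \in through v A (top v A i' s') N -> (i, s) = (i', s').
Proof.
move=> iS i'S /throughP[hF T1 T2] /throughP[_ T1' T2'].
have [_ _ proj _] := lv; have [hv hu vu hx hy] := puv.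
have [k kF] : exists k, k \in F (inord 1).
  have := chain_proper hF (ltn0Sn 0) isT; case/properP => _ [k kF _]; by exists k.
have nA : F (inord N.+1) != A.
  have p := chain_proper hF (ltnSn N.+1) (leqnn _).
  apply: contraTneq p => ->; rewrite properE negb_and negbK.
  by rewrite (face_sub (chain_in N.+2 hF)) orbT.
have [y hy1 ey] := polar_face (polar_pair_sym puv) (chain_in N.+1 hF) nA.
have kA : k \in A := fintype.subsetP (top_sub v A i s) _ (fintype.subsetP T1 _ kF).
have vy l : l \in A -> dotv (v l) y <= 1.
  by move=> lA; rewrite dotvC; apply: hull_dotv hy1 _ => j jB; rewrite dotvC vu.
have ky : dotv (v k) y = 1.
  have : k \in F (inord N.+1) by apply: (fintype.subsetP T2); apply: (fintype.subsetP T1).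
  by rewrite ey inE dotvC => /andP[_ /eqP].
have nn l := polar_prod_ge0 lv l vy kA ky.
have one j t : j \in S -> F (inord 1) \subset top v A j t ->
    top v A j t \subset F (inord N.+1) -> v k 0 j * y 0 j = 1.
  move=> jS s1 s2; have [p pT ep] := pole_top t lv jS.
  have [_ ->] := (topP v A j t k).1 (fintype.subsetP s1 _ kF).
  have := fintype.subsetP s2 _ pT; rewrite ey inE ep => /andP[_ /eqP].
  by rewrite /pole dotvZr dotv_delta.
have [ei|ne] := eqVneq i i'.
  subst i'; congr (_, _).
  have [_ e1] := (topP v A i s k).1 (fintype.subsetP T1 _ kF).
  have [_ e2] := (topP v A i s' k).1 (fintype.subsetP T1' _ kF).
  have := tip_gt0 s lv iS; have := tip_gt0 s' lv iS; move: e1; rewrite e2.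
  by case: (s) (s') => -[] //=; rewrite ?expr0 ?expr1 ?mulN1r ?mul1r; lra.
have h1 := one i s iS T1 T2; have h2 := one i' s' i'S T1' T2'.
have : dotv (v k) y >= 1 + 1.
  rewrite /dotv (bigD1 i) //= (bigD1 i') ?(eq_sym i') //= h1 h2 addrA lerDl.
  by apply: sumr_ge0 => l _.
by rewrite ky gerDl ler10.
Qed.

Definition directions : {set 'I_d * bool} := setX S setT.

Lemma two_sided_step :
  (2 ^ N.+1 * N.+1`! <= #|chains (pface v A) N.+3|)%N /\
  (#|chains (pface v A) N.+3| = 2 ^ N.+1 * N.+1`! ->
   (forall F, F \in chains (pface v A) N.+3 ->
      exists i s, i \in S /\ F \in through v A (top v A i s) N) /\
   (forall i s, i \in S -> forall F, F \in through v A (top v A i s) N ->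
      grid_like v A (top v A i s) F))%N.
Proof.
pose f (p : 'I_d * bool) := through v A (top v A p.1 p.2) N.
have inS p : p \in directions -> p.1 \in S by case: p => i s; rewrite in_setX => /andP[].
have [] := @disjoint_card_sum _ _ directions f (chains (pface v A) N.+3).
- by move=> p _; apply/fintype.subsetP => F /throughP[].
- by move=> [i s] [i' s'] F /inS iS /inS i'S; apply: class_inj.
move=> le eq.
(* There are [2 * (N + 1)] directions, each contributing at least [2 ^ N * N!] flags. *)
have tot : (2 ^ N.+1 * N.+1`! = \sum_(p in directions) 2 ^ N * N`!)%N.
  rewrite sum_nat_const /directions cardsX cardsT card_bool cardS expnS factS; ring.
have le1 : (2 ^ N.+1 * N.+1`! <= \sum_(p in directions) #|f p|)%N.
  by rewrite tot; apply: leq_sum => p /inS iS; case: (class_bound p.2 iS).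
split; first exact: leq_trans le1 le.
move=> e; have es : (\sum_(p in directions) #|f p|)%N = #|chains (pface v A) N.+3|.
  by apply/eqP; rewrite eqn_leq le e.
split=> [F /(eq es)[[i s] /inS iS hF]|i s iS F hF]; first by exists i, s.
have [b g] := class_bound s iS; apply: g hF; apply/eqP; rewrite eqn_leq b andbT.
have pD : (i, s) \in directions by rewrite in_setX iS inE.
rewrite leqNgt; apply/negP => lt; have : (2 ^ N.+1 * N.+1`! < \sum_(p in directions) #|f p|)%N.
  rewrite tot (bigD1 (i, s)) //= [X in (_ < X)%N](bigD1 (i, s)) //= -addSn.
  by apply: leq_add => //; apply: leq_sum => p /andP[/inS pS _]; case: (class_bound p.2 pS).
by rewrite es e ltnn.
Qed.

End TwoSidedStep.

End LabBound.

(** * Symmetrization in one coordinate *)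

Section Symmetrization.
Context {R : realType} {d : nat}.
Implicit Types (x y : 'rV[R]_d) (j l : 'I_d) (s : bool).

Definition refl j x : 'rV[R]_d := x - (2 * x 0 j) *: delta_mx 0 j.

Lemma reflE j x l : refl j x 0 l = if l == j then - x 0 l else x 0 l.
Proof.
rewrite /refl rowB !mxE eqxx /=; case: eqP => [->|_]; last by rewrite mulr0 subr0.
by rewrite mulr1; ring.
Qed.

Lemma dotv_refl j x y : dotv (refl j x) y = dotv x y - 2 * (x 0 j * y 0 j).
Proof. by rewrite /refl dotvBl dotvZl [dotv (delta_mx _ _) _]dotvC dotv_delta mulrA. Qed.

Lemma reflK j x : refl j (refl j x) = x.
Proof. by apply/rowP => l; rewrite !reflE; case: eqP => // _; rewrite opprK. Qed.

Lemma refl_proj j x K : refl j (coord_proj K x) = coord_proj K (refl j x).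
Proof.
by apply/rowP => l; rewrite !(reflE, coord_projE); case: ifP; case: ifP; rewrite ?oppr0.
Qed.

Lemma reflC j l x : refl j (refl l x) = refl l (refl j x).
Proof. by apply/rowP => m; rewrite !reflE; case: ifP; case: ifP. Qed.

Section Half.
Context {I : finType}.
Variables (S : {set 'I_d}) (v : I -> 'rV[R]_d) (A : {set I}) (j : 'I_d) (s : bool).
Hypotheses (lv : lab S v A) (jS : j \in S).
Local Notation sg := ((-1) ^+ s : R).

Fact vsym_key : unit. Proof. exact: tt. Qed.

(* Locked: otherwise rewriting identifies v k with vsym (k, false). *)
Definition vsym (p : I * bool) : 'rV[R]_d :=
  locked_with vsym_key (if p.2 then refl j (v p.1) else v p.1).

Lemma vsymE p : vsym p = if p.2 then refl j (v p.1) else v p.1.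
Proof. by rewrite /vsym unlock. Qed.

(** The half on the side [s] of [x_j = 0] together with its mirror image; the flag [true] marks
    reflected copies, and points with [x_j = 0] occur twice. *)
Definition Asym : {set I * bool} := [set p | (p.1 \in A) && (0 <= sg * v p.1 0 j)].

Definition strict k := 0 < sg * v k 0 j.

Lemma Asym_strict k : k \in A -> strict k -> forall b, (k, b) \in Asym.
Proof. by move=> kA /ltW h b; rewrite inE kA. Qed.

Lemma Asym_zero k : k \in A -> v k 0 j = 0 -> forall b, (k, b) \in Asym.
Proof. by move=> kA h b; rewrite inE kA /= h mulr0 lexx. Qed.

Lemma flatten_index k : k \in A ->
  exists k', [/\ k' \in A, v k' = coord_proj [set~ j] (v k) & v k' 0 j = 0].
Proof.
move=> kA; have [_ _ proj _] := lv; have [k' k'A e] := proj [set~ j] k kA.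
by exists k'; split => //; rewrite e coord_projE !inE eqxx.
Qed.

Lemma dotv_flatten x y : dotv (coord_proj [set~ j] x) y = dotv x y - x 0 j * y 0 j.
Proof.
rewrite {1}/dotv {1}/dotv (bigD1 j) //= [X in _ = X - _](bigD1 j) //=.
rewrite coord_projE !inE eqxx mul0r add0r addrAC subrr add0r.
by apply: eq_bigr => l lj; rewrite coord_projE !inE lj.
Qed.

Lemma exists_strict : exists2 k, k \in A & strict k.
Proof.
have [_ _ _ /(_ j jS)[[k kA kp] [l lA ln]]] := lv; rewrite /strict.
by case: s; [exists l|exists k] => //; rewrite ?expr1 ?mulN1r ?oppr_gt0 ?expr0 ?mul1r.
Qed.

(** Reflections commute with projections. For [l != j] both signs are witnessed by projections to
    the axis [l], which lie in [x_j = 0] and therefore in the half that is kept. *)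
Lemma lab_sym : lab S vsym Asym.
Proof.
have [_ hv proj pos] := lv; have [k0 k0A k0s] := exists_strict; split.
- by apply/set0Pn; exists (k0, false); apply: Asym_strict.
- move=> [k b]; rewrite inE /= => /andP[kA _] l lS; rewrite vsymE /=.
  have e : v k 0 l = 0 by apply: hv.
  by case: b; rewrite ?reflE e ?oppr0 ?if_same.
- move=> K [k b]; rewrite inE /= => /andP[kA ks]; have [k' k'A e] := proj K k kA.
  exists (k', b); last by rewrite !vsymE /=; case: b; rewrite e ?refl_proj.
  by rewrite inE k'A /= e coord_projE; case: ifP => // _; rewrite mulr0.
- move=> l lS; have [->|lj] := eqVneq l j.
    have k0f := Asym_strict k0A k0s; move: k0s; rewrite /strict.
    have e1 : vsym (k0, true) 0 j = - v k0 0 j by rewrite vsymE reflE eqxx.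
    case: s k0f => k0f; rewrite ?expr1 ?mulN1r ?expr0 ?mul1r => h.
      split; [exists (k0, true)|exists (k0, false)]; rewrite ?k0f ?e1 // ?vsymE.
      by rewrite -oppr_gt0.
    split; [exists (k0, false)|exists (k0, true)]; rewrite ?k0f ?e1 ?vsymE //.
    by rewrite oppr_lt0.
  have single k : k \in A -> exists2 k', (k', false) \in Asym & v k' 0 l = v k 0 l.
    move=> kA; have [k' k'A e] := proj [set l] k kA; exists k'.
      by apply: Asym_zero => //; rewrite e coord_projE inE eq_sym (negbTE lj).
    by rewrite e coord_projE inE eqxx.
  have [[k kA kp] [m mA mn]] := pos l lS.
  have [k' k'A ek] := single k kA; have [m' m'A em] := single m mA.
  by split; [exists (k', false)|exists (m', false)]; rewrite ?vsymE //= ?ek ?em.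
Qed.

(* The face C contains a segment in direction e_j. *)
Definition dir (C : {set I * bool}) : bool :=
  [exists k, [&& strict k, (k, false) \in C & (k, true) \in C]].

(** Without a segment in direction [e_j], the face may not have points strictly on the mirrored
    side. *)
Definition upper (C : {set I * bool}) : bool :=
  dir C || [forall k, strict k ==> ((k, true) \notin C)].

Definition has_strict (C : {set I * bool}) : bool :=
  [exists k, strict k && ((k, false) \in C)].

Definition slice (C : {set I * bool}) : {set I} := [set k | (k, false) \in C].

(* The face of the original configuration that agrees with C on the half
   sg * x_j >= 0; it crosses x_j = 0 exactly if C contains direction e_j. *)
Definition fold (C : {set I * bool}) : {set I} := slice C :|:
  (if dir C then [set k in A | (sg * v k 0 j < 0) &&
     [exists k' in slice C, v k' == coord_proj [set~ j] (v k)]] else set0).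

Lemma Asym_in C k b : C \in pface vsym Asym -> (k, b) \in C -> k \in A /\ 0 <= sg * v k 0 j.
Proof. by move=> /face_sub/fintype.subsetP s0 /s0; rewrite inE => /andP[]. Qed.

Lemma dotv_vsym k b y : dotv (vsym (k, b)) y = dotv (v k) y - (if b then 2 else 0) * (v k 0 j * y 0 j).
Proof. by case: b; rewrite vsymE /= ?dotv_refl // mul0r subr0. Qed.

Lemma sg_mul a b : (sg * a) * (sg * b) = a * b.
Proof. by rewrite mulrACA -expr2 sqrr_sign mul1r. Qed.

Section Exposed.
Variables (C : {set I * bool}) (y : 'rV[R]_d) (b : R).
Hypothesis hy : forall p, p \in Asym -> dotv (vsym p) y <= b.
Hypothesis eC : C = [set p in Asym | dotv (vsym p) y == b].

Lemma inC p : (p \in C) = (p \in Asym) && (dotv (vsym p) y == b).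
Proof. by rewrite eC inE. Qed.

Lemma C_face : C \in pface vsym Asym.
Proof. by rewrite eC; apply: pface_exposed. Qed.

(** Comparing [k] and [m] with their own mirror images, which also belong to the configuration,
    gives opposite signs for [y 0 j]. *)
Lemma both_orth k m : strict k -> strict m -> (k, false) \in C -> (m, true) \in C ->
  y 0 j = 0.
Proof.
move=> ks ms; rewrite !inC => /andP[kA /eqP ek] /andP[mA /eqP em].
have [kA' mA'] : k \in A /\ m \in A by move: kA mA; rewrite !inE => /andP[-> _] /andP[-> _].
have := hy (Asym_strict kA' ks true); have := hy (Asym_strict mA' ms false).
move: ek em; rewrite !dotv_vsym !mul0r !subr0 => ek em h1 h2.
have h3 : v k 0 j * y 0 j >= 0 by lra.
have h4 : v m 0 j * y 0 j <= 0 by lra.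
move: (ks) (ms) h3 h4; rewrite /strict -!(sg_mul (v _ 0 j)) => ks' ms'.
rewrite pmulr_rge0 // pmulr_rle0 // => h3 h4.
have /eqP : sg * y 0 j = 0 by apply/le_anti; rewrite h3 h4.
by rewrite mulf_eq0 signr_eq0 => /eqP.
Qed.

Lemma dir_orth : dir C -> y 0 j = 0.
Proof. by move/existsP => [k /and3P[ks k1 k2]]; apply: (both_orth ks ks k1 k2). Qed.

Lemma both_dir k m : strict k -> strict m -> (k, false) \in C -> (m, true) \in C -> dir C.
Proof.
move=> ks ms k1 m1; have y0 := both_orth ks ms k1 m1.
apply/existsP; exists k; rewrite ks k1 /=; have [kA _] := Asym_in C_face k1.
move: k1; rewrite !inC => /andP[_ /eqP <-].
by rewrite (Asym_strict kA ks) andTb !dotv_vsym y0 !mulr0 eqxx.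
Qed.

Lemma nodir_sign k : ~~ dir C -> strict k -> (k, false) \in C -> 0 < sg * y 0 j.
Proof.
move=> nd ks k1; have [kA _] := Asym_in C_face k1.
have k2 : (k, true) \notin C.
  by apply: contra nd => k2; apply/existsP; exists k; rewrite ks k1.
have : dotv (vsym (k, true)) y < b.
  rewrite lt_neqAle hy ?Asym_strict // andbT; apply: contra k2 => e.
  by rewrite inC Asym_strict.
move: k1; rewrite inC => /andP[_ /eqP]; rewrite !dotv_vsym mul0r subr0 => e1 h.
have : 0 < v k 0 j * y 0 j by lra.
by rewrite -sg_mul pmulr_rgt0.
Qed.

Lemma slice_zero k : v k 0 j = 0 -> ((k, true) \in C) = ((k, false) \in C).
Proof. by move=> h; rewrite !inC !inE /= !dotv_vsym h !mul0r !mulr0. Qed.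

Lemma nonstrict_zero k t : (k, t) \in C -> ~~ strict k -> v k 0 j = 0.
Proof.
move=> /(Asym_in C_face)[_ h]; rewrite /strict -leNgt => h2.
have /eqP : sg * v k 0 j = 0 by apply/le_anti; rewrite h h2.
by rewrite mulf_eq0 signr_eq0 => /eqP.
Qed.

Lemma flatten_slice k k' : y 0 j = 0 -> k' \in A -> v k' = coord_proj [set~ j] (v k) ->
  (k' \in slice C) = (dotv (v k) y == b).
Proof.
move=> y0 k'A e; have z : v k' 0 j = 0 by rewrite e coord_projE !inE eqxx.
by rewrite inE inC Asym_zero //= dotv_vsym mul0r subr0 e dotv_flatten y0 mulr0 subr0.
Qed.

Lemma fold_nodir : ~~ dir C -> fold C = slice C.
Proof. by rewrite /fold => /negbTE ->; rewrite setU0. Qed.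

(** As [y] ignores coordinate [j], a point of [A] has the same value as its projection to [x_j = 0],
    which lies in the half that is kept. So [y] is valid on all of [A]. *)
Lemma fold_dir_face : dir C -> fold C \in pface v A.
Proof.
move=> dC; have y0 := dir_orth dC.
have val k : k \in A -> dotv (v k) y <= b.
  move=> kA; have [k' [k'A e z]] := flatten_index kA.
  have := hy (Asym_zero k'A z false).
  by rewrite dotv_vsym mul0r subr0 e dotv_flatten y0 mulr0 subr0.
suff -> : fold C = [set k in A | dotv (v k) y == b] by apply: pface_exposed.
apply/setP => k; rewrite /fold dC !inE; case: (boolP (k \in A)) => kA /=; last first.
  by rewrite orbF; apply/negbTE; apply: contra kA => /(Asym_in C_face)[].
have [k' [k'A e z]] := flatten_index kA.
have ex : [exists k' in slice C, v k' == coord_proj [set~ j] (v k)] = (dotv (v k) y == b).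
  apply/exists_inP/idP => [[m mC /eqP em]|h]; last first.
    by exists k'; [rewrite (flatten_slice y0 k'A e)|rewrite e].
  have [mA _] : m \in A /\ 0 <= sg * v m 0 j by apply: (Asym_in C_face); move: mC; rewrite inE; apply.
  by rewrite -(flatten_slice y0 mA em).
rewrite ex inC inE kA /= dotv_vsym mul0r subr0.
by case: (ltrP (sg * v k 0 j) 0) => //=; rewrite ?andbF ?orbF // => _; rewrite orbF.
Qed.

(** Here [y] increases towards the kept side, so points on the discarded side have strictly smaller
    value than their projections to [x_j = 0]: [y] stays valid and no discarded point is tight. *)
Lemma fold_strict_face : ~~ dir C -> has_strict C -> fold C \in pface v A.
Proof.
move=> nd /existsP[k0 /andP[ks k0C]]; have ys := nodir_sign nd ks k0C.
have neg k : k \in A -> sg * v k 0 j < 0 -> dotv (v k) y < b.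
  move=> kA kn; have [k' [k'A e z]] := flatten_index kA.
  have := hy (Asym_zero k'A z false); rewrite dotv_vsym mul0r subr0 e dotv_flatten.
  have : v k 0 j * y 0 j < 0 by rewrite -sg_mul nmulr_rlt0.
  by lra.
have val k : k \in A -> dotv (v k) y <= b.
  move=> kA; case: (ltrP (sg * v k 0 j) 0) => h; first by apply/ltW/neg.
  have kin : (k, false) \in Asym by rewrite inE kA.
  by have := hy kin; rewrite dotv_vsym mul0r subr0.
rewrite fold_nodir //.
suff -> : slice C = [set k in A | dotv (v k) y == b] by apply: pface_exposed.
apply/setP => k; rewrite !inE inC inE dotv_vsym mul0r subr0 /=.
case: (boolP (k \in A)) => kA //=; case: (ltrP (sg * v k 0 j) 0) => h //=.
by rewrite lt_eqF // neg.
Qed.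

(** Reads [dir] off the folded face alone: a segment in direction [e_j] shows as a strict point
    together with its projection. *)
Definition dir' (F : {set I}) : bool :=
  [exists k in F, strict k && [exists k' in F, v k' == coord_proj [set~ j] (v k)]].

Lemma slice_sub_fold : slice C \subset fold C.
Proof. exact: subsetUl. Qed.

Lemma dir'_fold : dir' (fold C) = dir C.
Proof.
apply/exists_inP/idP => [[k kF /andP[ks /exists_inP[k' k'F /eqP e]]]|dC].
  apply: contraT => nd; move: kF k'F; rewrite fold_nodir // !inE => kC.
  have := nodir_sign nd ks kC; move: kC; rewrite !inC => /andP[_ /eqP h1] ys /andP[_ /eqP].
  move: h1; rewrite !dotv_vsym !mul0r !subr0 e dotv_flatten => h1 h2.
  have : 0 < v k 0 j * y 0 j by rewrite -sg_mul pmulr_rgt0.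
  by lra.
have y0 := dir_orth dC; case/existsP: (dC) => k /and3P[ks k1 _].
exists k; first by apply: (fintype.subsetP slice_sub_fold); rewrite inE.
rewrite ks /=; have [kA _] := Asym_in C_face k1.
have [k' [k'A e z]] := flatten_index kA; apply/exists_inP; exists k'; last by rewrite e.
apply: (fintype.subsetP slice_sub_fold); rewrite (flatten_slice y0 k'A e).
by move: k1; rewrite inC dotv_vsym mul0r subr0 => /andP[].
Qed.

Lemma slice_fold : slice C = fold C :&: [set k | 0 <= sg * v k 0 j].
Proof.
apply/setP => k; rewrite inE [RHS]inE inE; apply/idP/andP => [kC|[]].
  split; last by have [_] := Asym_in C_face kC.
  by apply: (fintype.subsetP slice_sub_fold); rewrite inE.
rewrite /fold inE => /orP[|]; first by rewrite inE.
by case: ifP => _; rewrite inE // => /andP[_ /andP[h _]]; rewrite leNgt h.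
Qed.

Lemma upper_lower_slice k : upper C -> k \in A ->
  ((k, true) \in C) = ((k, false) \in C) && (strict k ==> dir C).
Proof.
move=> uC kA; case: (boolP (strict k)) => ks /=; last first.
  rewrite andbT; apply/idP/idP => h; have z := nonstrict_zero h ks.
    by rewrite -slice_zero.
  by rewrite slice_zero.
case: (boolP (dir C)) => dC; last first.
  rewrite andbF; move: uC; rewrite /upper (negbTE dC) /= => /forallP/(_ k).
  by rewrite ks => /negbTE.
by rewrite andbT !inC !Asym_strict // !dotv_vsym (dir_orth dC) !mulr0.
Qed.

End Exposed.
Local Notation Ls := (pface vsym Asym).
Implicit Types (C : {set I * bool}).

Lemma dir_sub (C C' : {set I * bool}) : C \subset C' -> dir C -> dir C'.
Proof.
move=> /fintype.subsetP h /existsP[k /and3P[k1 k2 k3]].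
by apply/existsP; exists k; rewrite k1 !h.
Qed.

Lemma fold_sub (C C' : {set I * bool}) : C \subset C' -> fold C \subset fold C'.
Proof.
move=> h; have sl : slice C \subset slice C'.
  by apply/fintype.subsetP => k; rewrite !inE; apply: (fintype.subsetP h).
apply/fintype.subsetP => k; rewrite /fold !in_setU => /orP[kC|].
  by rewrite (fintype.subsetP sl).
case: ifP => dC; rewrite !inE // => /and3P[kA ks /exists_inP[k' k'C e]].
rewrite (dir_sub h dC) inE kA ks /=; apply/orP; right; apply/exists_inP.
by exists k' => //; apply: (fintype.subsetP sl).
Qed.

Lemma fold_inj (C C' : {set I * bool}) : C \in Ls -> C' \in Ls -> upper C -> upper C' -> fold C = fold C' -> C = C'.
Proof.
move=> hC hC' uC uC' e.
have /pfaceP[y [b [hy eC]]] := hC; have /pfaceP[y' [b' [hy' eC']]] := hC'.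
have dd : dir C = dir C' by rewrite -(dir'_fold hy eC) e (dir'_fold hy' eC').
have ss : slice C = slice C' by rewrite (slice_fold hy eC) e -(slice_fold hy' eC').
have sl k : ((k, false) \in C) = ((k, false) \in C') by move/setP/(_ k): ss; rewrite !inE.
apply/setP => -[k []] //; case: (boolP (k \in A)) => kA.
  by rewrite (upper_lower_slice hy eC uC kA) (upper_lower_slice hy' eC' uC' kA) sl dd.
by apply/idP/idP => /(Asym_in _)[] //; rewrite (negbTE kA).
Qed.

Variable N : nat.
Hypothesis cardS : #|S| = N.

Lemma rank_Asym : (face_rank (fun p => lift1 (vsym p)) Asym <= N.+1)%N.
Proof.
rewrite -cardS; apply: (rank_in_coords (p := 0)) => k kA; rewrite subr0.
by case: lab_sym => _ h _ _; apply: h.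
Qed.

Definition upper_flags : {set {ffun 'I_N.+2 -> {set I * bool}}} :=
  [set F in chains Ls N.+2 | [forall i, upper (F i)] && [exists i, ~~ dir (F i) && has_strict (F i)]].

Lemma upper_flagsP (F : {ffun 'I_N.+2 -> {set I * bool}}) : reflect [/\ F \in chains Ls N.+2, forall i, upper (F i)
  & exists i, ~~ dir (F i) /\ has_strict (F i)] (F \in upper_flags).
Proof.
rewrite /upper_flags [_ \in [set _ in _ | _]]inE; apply: (iffP and3P) => -[h1 h2 h3]; split => //.
- exact/forallP.
- by case/existsP: h3 => i /andP[]; exists i.
- exact/forallP.
- by case: h3 => i [a b]; apply/existsP; exists i; rewrite a.
Qed.

Definition fold_flag (F : {ffun 'I_N.+2 -> {set I * bool}}) : {ffun 'I_N.+2 -> {set I}} :=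
  [ffun i => fold (F i)].

Lemma fold_flag_in F : F \in upper_flags -> fold_flag F \in chains (pface v A) N.+2.
Proof.
case/upper_flagsP => hF uF [i0 [nd0 hs0]]; have /chainsP[inF prF] := hF.
have face i : fold (F i) \in pface v A.
  have /pfaceP[y [b [hy eC]]] := inF i.
  case: (boolP (dir (F i))) => di; first exact: (fold_dir_face hy eC).
  case: (boolP (has_strict (F i))) => hs; first exact: (fold_strict_face hy eC).
  (* The remaining case is a face inside [x_j = 0], whose functional need not be valid on the
     discarded side. It is contained in the member [F i0], whose fold lies in the kept half, and it
     is exposed there. *)
  have /pfaceP[y0 [b0 [hy0 eC0]]] := inF i0.
  have f0 := fold_strict_face hy0 eC0 nd0 hs0.
  apply: (face_trans f0).
  have sub : F i \subset F i0.
    case: (ltngtP i i0) => [h|h|/ord_inj -> //]; first exact/proper_sub/prF.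
    have /fintype.subsetP h' := proper_sub (prF _ _ h).
    case/existsP: hs0 => k /andP[k1 /h' k2]; case/negP: hs.
    by apply/existsP; exists k; rewrite k1.
  rewrite -/(pface v (fold (F i0))); apply/pfaceP; exists y, b; split => [k|].
    rewrite (fold_nodir nd0) inE => k0; have [kA kn] := Asym_in (inF i0) k0.
    have := hy (k, false); rewrite inE kA kn => /(_ isT).
    by rewrite dotv_vsym mul0r subr0.
  rewrite !fold_nodir //; apply/setP => k; rewrite !inE.
  apply/idP/andP => [ki|[k0]].
    rewrite (fintype.subsetP sub) //; split => //.
    by move: ki; rewrite eC inE dotv_vsym mul0r subr0 => /andP[].
  have [kA kn] := Asym_in (inF i0) k0.
  by rewrite eC inE dotv_vsym mul0r subr0 inE kA kn.
apply/chainsP; split => [i|i j' ij]; rewrite !ffunE; first exact: face.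
rewrite properEneq fold_sub ?andbT; last exact/proper_sub/prF.
apply: contraTneq (prF _ _ ij) => /(fold_inj (inF _) (inF _) (uF _) (uF _)) ->.
by rewrite properxx.
Qed.

Lemma fold_flag_inj : {in upper_flags &, injective fold_flag}.
Proof.
move=> F G /upper_flagsP[/chainsP[hF _] uF _] /upper_flagsP[/chainsP[hG _] uG _] /ffunP e.
by apply/ffunP => i; have := e i; rewrite !ffunE; apply: fold_inj.
Qed.

Definition mirror (C : {set I * bool}) : {set I * bool} := [set p | (p.1, ~~ p.2) \in C].

Lemma mirrorK C : mirror (mirror C) = C.
Proof. by apply/setP => -[k b]; rewrite !inE /= negbK. Qed.

Lemma dotv_reflr x y : dotv (refl j x) y = dotv x (refl j y).
Proof. by rewrite dotv_refl [RHS]dotvC dotv_refl dotvC mulrC [y 0 j * _]mulrC mulrC. Qed.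

Lemma mirror_face C : C \in Ls -> mirror C \in Ls.
Proof.
case/pfaceP => y [b [hy eC]]; apply/pfaceP; exists (refl j y), b.
have e k t : dotv (vsym (k, t)) (refl j y) = dotv (vsym (k, ~~ t)) y.
  by rewrite -dotv_reflr !vsymE; case: t; rewrite /= ?reflK.
split=> [[k t]|]; first by rewrite e inE /= => h; apply: hy; rewrite inE.
by apply/setP => -[k t]; rewrite [LHS]inE eC !inE /= e.
Qed.

Lemma mirror_sub (C C' : {set I * bool}) : C \subset C' -> mirror C \subset mirror C'.
Proof. by move/fintype.subsetP => h; apply/fintype.subsetP => p; rewrite !inE; apply: h. Qed.

Lemma mirror_dir C : dir (mirror C) = dir C.
Proof. by apply: eq_existsb => k; rewrite !inE /= [X in _ && X]andbC. Qed.

Definition mirror_flag (F : {ffun 'I_N.+2 -> {set I * bool}}) := [ffun i => mirror (F i)].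

Lemma mirror_flagK : involutive mirror_flag.
Proof. by move=> F; apply/ffunP => i; rewrite !ffunE mirrorK. Qed.

Lemma mirror_flag_in F : F \in chains Ls N.+2 -> mirror_flag F \in chains Ls N.+2.
Proof.
move=> /chainsP[h1 h2]; apply/chainsP; split=> [i|i j' ij]; rewrite !ffunE; first exact: mirror_face.
have := h2 _ _ ij; rewrite !properE => /andP[h3 h4]; rewrite mirror_sub //=.
by apply: contra h4 => /mirror_sub; rewrite !mirrorK.
Qed.

(** Let [G] be the first member of the flag containing the direction [e_j] and [E] the one before
    it. If [E] were inside [x_j = 0], the projection of a strict point of [G] would be independent
    of [E] and still in [x_j = 0], so the rank would rise by two from [E] to [G]. *)
Lemma exists_nodir_strict F : F \in chains Ls N.+2 ->
  exists i, ~~ dir (F i) /\ exists k t, strict k /\ (k, t) \in F i.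
Proof.
move=> hF; have L0 : set0 \in Ls by apply: pface_set0.
have topF := flag_top rank_Asym hF; have botF := flag_bottom rank_Asym L0 hF.
have ex : exists i, (i <= N.+1)%N && dir (F (inord i)).
  exists N.+1; rewrite leqnn topF; have [k kA ks] := exists_strict.
  by apply/existsP; exists k; rewrite ks !Asym_strict.
case: (ex_minnP ex) => -[|i] /andP[iN di] min.
  by move: di; rewrite botF => /existsP[k]; rewrite !inE /= andbF.
have nd : ~~ dir (F (inord i)).
  by apply/negP => h; have := min i; rewrite (ltnW iN) h ltnn => /(_ isT).
exists (inord i); split=> //; apply: contrapT => no.
set E := F (inord i) in nd no; set G := F (inord i.+1) in di.
have EL : E \in Ls by apply: chain_in hF. have GL : G \in Ls by apply: chain_in hF.
have EG : E \subset G by apply: chain_sub hF _ _.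
have /pfaceP[y [b [hy eE]]] := EL; have /pfaceP[z [c [hz eG]]] := GL.
have z0 := dir_orth hz eG di; case/existsP: (di) => k /and3P[ks k1 k2].
have [kA _] := Asym_in GL k1; have [k' [k'A e k'0]] := flatten_index kA.
have k'G : (k', false) \in G.
  have := flatten_slice eG z0 k'A e; rewrite inE => ->.
  by move: k1; rewrite eG inE dotv_vsym mul0r subr0 => /andP[].
have zeroE p : p \in E -> v p.1 0 j = 0.
  case: p => m t mE; apply: (nonstrict_zero hy eE mE); apply/negP => ms.
  by apply: no; exists m, t.
pose y' := coord_proj [set~ j] y.
have dy' m t : dotv (vsym (m, t)) y' = dotv (v m) y - v m 0 j * y 0 j.
  by rewrite dotv_vsym -coord_projC dotv_flatten coord_projE !inE eqxx mulr0 mulr0 subr0.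
have ltk : dotv (vsym (k', false)) y' < b.
  rewrite dy' k'0 mul0r subr0 e dotv_flatten.
  have h1 := hy _ (Asym_strict kA ks false); have h2 := hy _ (Asym_strict kA ks true).
  have n1 : (k, false) \notin E by apply/negP => h; apply: no; exists k, false.
  have : dotv (vsym (k, false)) y < b.
    rewrite lt_neqAle h1 andbT; apply: contra n1 => h; rewrite eE inE h andbT.
    exact: Asym_strict.
  by move: h1 h2; rewrite !dotv_vsym; lra.
have yE p : p \in E -> dotv (vsym p) y' = b.
  case: p => m t mE; have m0 := zeroE _ mE; rewrite dy' /= m0 mul0r subr0.
  by move: mE; rewrite eE inE dotv_vsym m0 mul0r mulr0 subr0 => /andP[_ /eqP].
pose w p := lift1 (vsym p).
have r1 : (face_rank w E < face_rank w ((k', false) |: E))%N.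
  apply: (@face_rank_lt _ _ _ w E _ (affine_form y' (- b)) (k', false)).
  - exact: subsetUr.
  - by move=> p /yE h; rewrite dotv_lift1 h subrr.
  - exact: setU11.
  - by rewrite dotv_lift1 subr_eq0 lt_eqF.
have r2 : (face_rank w ((k', false) |: E) < face_rank w G)%N.
  apply: (@face_rank_lt _ _ _ w _ _ (affine_form (delta_mx 0 j) 0) (k, false)) => //.
  - by rewrite subUset sub1set k'G.
  - move=> [m t]; rewrite in_setU1 dotv_lift1 dotv_delta addr0 => h.
    have m0 : v m 0 j = 0 by case/orP: h => [/eqP[-> _]|/zeroE].
    by rewrite vsymE; case: t {h} => /=; rewrite ?reflE ?eqxx m0 ?oppr0.
  - rewrite dotv_lift1 dotv_delta addr0 vsymE /=; move: ks; rewrite /strict.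
    by case: eqP => // ->; rewrite mulr0 ltxx.
have := flag_rank rank_Asym hF iN; have := flag_rank rank_Asym hF (ltnW iN).
by rewrite -/E -/G -/w => e1 e2; move: r1 r2; rewrite e1 e2; clear; lia.
Qed.

(** Some member without direction [e_j] has a strict point, up to mirroring on the kept side. If
    another such member were strict on the mirrored side, the larger of the two would have strict
    points on both sides and so contain the direction [e_j]. *)
Lemma upper_or_mirror F : F \in chains Ls N.+2 ->
  (F \in upper_flags) || (mirror_flag F \in upper_flags).
Proof.
move=> hF; have [i [nd [k [t [ks kF]]]]] := exists_nodir_strict hF.
wlog tf : F hF i t nd kF / t = false => [H|].
  case: t kF => kF; last exact: (H F hF i false).
  have := H _ (mirror_flag_in hF) i false; rewrite mirror_flagK orbC; apply => //.
    by rewrite ffunE mirror_dir.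
  by rewrite ffunE inE.
rewrite {t}tf in kF; apply/orP; left; apply/upper_flagsP; split => //; last first.
  by exists i; split=> //; apply/existsP; exists k; rewrite ks.
have /chainsP[inF prF] := hF => l; rewrite /upper; case: (boolP (dir (F l))) => //= dl.
apply/forallP => m; apply/implyP => ms; apply/negP => mF.
have use p : ~~ dir (F p) -> (k, false) \in F p -> (m, true) \in F p -> False.
  move=> nd' k' m'; have /pfaceP[y [b [hy eC]]] := inF p.
  by move/negP: nd'; apply; apply: (both_dir hy eC ks ms).
case: (ltngtP i l) => [h|h|/ord_inj e].
- by apply: (use l) => //; apply: (fintype.subsetP (proper_sub (prF _ _ h))).
- by apply: (use i) => //; apply: (fintype.subsetP (proper_sub (prF _ _ h))).
- by apply: (use i) => //; rewrite e.
Qed.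

Lemma card_sym_flags : (#|chains Ls N.+2| <= 2 * #|upper_flags|)%N.
Proof.
have s1 : chains Ls N.+2 \subset upper_flags :|: mirror_flag @^-1: upper_flags.
  by apply/fintype.subsetP => F /upper_or_mirror; rewrite !inE.
apply: leq_trans (subset_leq_card s1) _; apply: leq_trans (leq_card_setU _ _) _.
by rewrite mul2n -addnn leq_add2l on_card_preimset //; exists mirror_flag => F _; apply: mirror_flagK.
Qed.

Lemma fold_flag_strict F : F \in upper_flags -> exists i,
  [/\ exists2 k, k \in fold_flag F i & strict k, forall k, k \in fold_flag F i -> 0 <= sg * v k 0 j
    & ~~ dir' (fold_flag F i)].
Proof.
case/upper_flagsP => /chainsP[inF _] _ [i [nd hs]]; exists i; rewrite ffunE.
have /pfaceP[y [b [hy eC]]] := inF i; rewrite (dir'_fold hy eC) fold_nodir //; split => //.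
  by case/existsP: hs => k /andP[k1 k2]; exists k; rewrite // inE.
by move=> k; rewrite inE => /(Asym_in (inF i))[].
Qed.

Lemma fold_flag_neg F (l : 'I_N.+2) k : k \in fold_flag F l -> sg * v k 0 j < 0 -> F \in upper_flags ->
  exists2 m, m \in fold_flag F l & strict m.
Proof.
move=> kF kn /upper_flagsP[/chainsP[inF _] _ _]; move: kF; rewrite ffunE.
case: (boolP (dir (F l))) => dl.
  case/existsP: dl => m /and3P[ms m1 _] _; exists m => //.
  by apply: (fintype.subsetP (slice_sub_fold _)); rewrite inE.
rewrite fold_nodir // inE => /(Asym_in (inF l))[_]; by rewrite leNgt kn.
Qed.

End Half.

(** * Comparing a configuration with its two symmetrizations *)

Section TwoHalves.
Context {I : finType}.
Variables (S : {set 'I_d}) (v : I -> 'rV[R]_d) (A : {set I}) (j : 'I_d) (N : nat).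
Hypotheses (lv : lab S v A) (jS : j \in S) (cardS : #|S| = N).
Local Notation D := (chains (pface v A) N.+2).
Local Notation img s := ([set fold_flag v A j s F | F in upper_flags v A j s N]).

Lemma signr_negb s (x : R) : (-1) ^+ (~~ s) * x = - ((-1) ^+ s * x).
Proof. by case: s; rewrite /= ?expr0 ?expr1 ?mulN1r ?mul1r ?opprK. Qed.

(** A flag folded from the side [s] has a member in the closed half [s] with a strict point. Were it
    folded from the other side too, [fold_flag_neg] would put a point of that other side into the
    same member. *)
Lemma img_disjoint s : [disjoint img s & img (~~ s)].
Proof.
rewrite -setI_eq0; apply/eqP/setP => Phi; rewrite in_set0; apply/negP.
rewrite in_setI => /andP[/imsetP[F hF ->] /imsetP[G hG e]].
have [i [[k kF ks] half _]] := fold_flag_strict lv hF.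
have kn : (-1) ^+ (~~ s) * v k 0 j < 0 by rewrite signr_negb oppr_lt0.
rewrite e in kF half; have [m mG] := fold_flag_neg kF kn hG.
by have := half m mG; rewrite /strict signr_negb oppr_gt0 => /le_lt_trans h /h; rewrite ltxx.
Qed.

Lemma img_sub s : img s \subset D.
Proof. by apply/fintype.subsetP => Phi /imsetP[F hF ->]; apply: (fold_flag_in lv hF). Qed.

Lemma card_img s : #|img s| = #|upper_flags v A j s N|.
Proof. by apply: card_in_imset; apply: (fold_flag_inj lv). Qed.

(** A folded flag has a member in its closed half that is strict but contains no segment in
    direction [e_j] down to [x_j = 0]. Here the members up to [a] are inside [x_j = 0], and the
    later ones contain such a segment, on the side [t]; no member qualifies for either value of
    [s]. *)
Lemma not_in_img (s t : bool) (Phi : {ffun 'I_N.+2 -> {set I}}) (a : nat) : Phi \in D -> (a <= N)%N ->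
  (forall k, k \in Phi (inord a) -> v k 0 j = 0) ->
  (forall k, k \in Phi (inord a.+1) -> 0 <= (-1) ^+ t * v k 0 j) ->
  (exists k k', [/\ k \in Phi (inord a.+1), strict v j t k, k' \in Phi (inord a.+1)
     & v k' = coord_proj [set~ j] (v k)]) ->
  Phi \notin img s.
Proof.
move=> hP aN zero half [k [k' [kP ks k'P e]]]; apply/imsetP => -[F hF eP].
have [i [[m mF ms] hm nd]] := fold_flag_strict lv hF; rewrite -eP in mF hm nd.
rewrite -(inord_val i) in mF hm nd; case: (leqP i a) => ia.
  have /fintype.subsetP/(_ m mF)/zero := chain_sub hP ia (leqW aN).
  by move: ms; rewrite /strict => h z; rewrite z mulr0 ltxx in h.
have iN : (i <= N.+1)%N by rewrite -ltnS.
have /fintype.subsetP sub := chain_sub hP ia iN.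
have [ts|ne] := eqVneq t s.
  subst t; case/negP: nd; apply/exists_inP; exists k; first exact: sub.
  by rewrite ks; apply/exists_inP; exists k'; [apply: sub|rewrite e].
have et : s = ~~ t by move: ne; clear; case: s t => -[].
have := hm k (sub k kP); rewrite et signr_negb oppr_ge0 => /le_lt_trans/(_ ks).
by rewrite ltxx.
Qed.

Definition one_sided (i : 'I_d) s := exists t : bool,
  (forall k, k \in top v A i s -> 0 <= (-1) ^+ t * v k 0 j) /\
  (exists2 k, k \in top v A i s & strict v j t k).

(* Folding turns at least half of the flags of each of the two symmetrized
   configurations into flags of the original one.  The two families are disjoint,
   and a flag through the one-sided face T and its section by x_j = 0 belongs to
   neither. *)
Lemma sym_strict i s : i \in S -> j != i -> one_sided i s ->
  (forall s, 2 ^ N * N`! <= #|chains (pface (vsym v j) (Asym v A j s)) N.+2|)%N ->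
  (2 ^ N * N`! < #|D|)%N.
Proof.
move=> iS ji [t [half [k kT ks]]] hb.
have up s' : (2 ^ N * N`! <= 2 * #|img s'|)%N.
  by rewrite card_img; apply: leq_trans (hb s') _; apply: (card_sym_flags s' lv jS cardS).
have sub : img false :|: img true \subset D by rewrite subUset !img_sub.
have cU : #|img false :|: img true| = (#|img false| + #|img true|)%N.
  by rewrite cardsU (disjoint_setI0 (img_disjoint false)) cards0 subn0.
have b0 : (2 ^ N * N`! <= #|img false :|: img true|)%N.
  by rewrite cU; have := up false; have := up true; clear; lia.
have D0 : D != set0.
  rewrite -card_gt0; apply: leq_trans (subset_leq_card sub); apply: leq_trans b0.
  by rewrite muln_gt0 expn_gt0 fact_gt0.
pose w k := lift1 (v k).
have rA : face_rank w A = N.+1.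
  apply/eqP; rewrite eqn_leq (full_rank D0) andbT -cardS.
  apply: (rank_in_coords (p := 0)) => m mA; rewrite subr0.
  by case: lv => _ h _ _; apply: h.
set T := top v A i s in half kT; pose E := [set m in T | v m 0 j == 0].
have TL : T \in pface v A by apply: top_face.
have EL : E \in pface v A.
  apply: (face_trans TL); rewrite -/(pface v T).
  have -> : E = [set m in T | dotv (v m) (- (-1) ^+ t *: delta_mx 0 j) == 0].
    apply/setP => m; rewrite !inE dotvZr dotv_delta mulNr oppr_eq0 mulf_eq0 signr_eq0 //.
  apply: pface_exposed => m mT; rewrite dotvZr dotv_delta mulNr oppr_le0; exact: half.
have flat m : m \in T -> exists2 m', m' \in E & v m' = coord_proj [set~ j] (v m).
  move=> mT; have [|m' m'T e] := top_proj lv mT (_ : i \in [set~ j]).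
    by rewrite !inE eq_sym.
  by exists m'; rewrite // inE m'T e coord_projE !inE eqxx /=.
have [k' k'E ek'] := flat k kT.
have vk : v k 0 j != 0 by apply: contraTneq ks => h; rewrite /strict h mulr0 ltxx.
have ET : E \proper T.
  apply/properP; split; first by apply/fintype.subsetP => m; rewrite inE => /andP[].
  by exists k; rewrite // inE kT.
(* Points of [T] differ from points of [E] by multiples of [e_j], so [E] and [T] are consecutive in
   any flag containing both. *)
have rT : (face_rank w T <= face_rank w E + 1)%N.
  apply: (@leq_trans (\rank (\sum_(m in E) <<w m>> + <<affine_form (delta_mx 0 j : 'rV[R]_d) 0>>)%MS)).
    apply: mxrankS; apply/sumsmx_subP => m mT; rewrite genmxE.
    have [m' m'E e] := flat m mT.
    have -> : w m = w m' + v m 0 j *: affine_form (delta_mx 0 j) 0.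
      apply: dotv_eq => c; have [a [b ->]] := affine_formP c.
      rewrite dotvDr dotvZr !(dotvC (affine_form a b)) !dotv_lift1 e dotv_flatten.
      rewrite dotv_affine [dotv (delta_mx _ _) _]dotvC dotv_delta mul0r addr0.
      by rewrite addrAC subrK.
    apply: addmx_sub_adds; first exact: span_member.
    by rewrite scalemx_sub // genmxE.
  apply: leq_trans (mxrank_adds_leqif _ _) _.
  by rewrite leq_add2l genmxE rank_leq_row.
have L0 : set0 \in pface v A by apply: pface_set0.
have [||Phi hP hc] := flag_of_chain rA L0 (c := [:: E; T]).
- rewrite /= ET !andbT; apply/properP; split; first exact: sub0set.
  by exists k' => //; rewrite in_set0.
- by rewrite /= EL TL.
have [a aN ea] := hc E (mem_head _ _).
have [b bN eb] : exists2 b, (b <= N.+1)%N & Phi (inord b) = T.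
  by apply: hc; rewrite !inE eqxx orbT.
have rA' : (face_rank w A <= N.+1)%N by rewrite rA.
have ra := flag_rank rA' hP aN; have rb := flag_rank rA' hP bN.
rewrite ea in ra; rewrite eb in rb.
have rET : (face_rank w E < face_rank w T)%N by apply: (face_rank_proper EL (face_sub TL) ET).
have eba : b = a.+1 by move: rT rET; rewrite ra rb; clear; lia.
have nimg s' : Phi \notin img s'.
  apply: (@not_in_img s' t Phi a) => //; first by rewrite -ltnS -eba.
  - by move=> m; rewrite ea inE => /andP[_ /eqP].
  - by move=> m; rewrite -eba eb; apply: half.
  - exists k, k'; rewrite -eba eb; split=> //.
    exact: (fintype.subsetP (proper_sub ET)).
have sub' : Phi |: (img false :|: img true) \subset D by rewrite subUset sub1set hP.
apply: leq_trans (subset_leq_card sub'); rewrite cardsU1 in_setU !negb_or !nimg.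
by rewrite add1n ltnS.
Qed.

End TwoHalves.
End Symmetrization.

(** * The lower bound *)

Section LabTheorem.
Context {R : realType} {d : nat}.
Implicit Types (S : {set 'I_d}).

Definition symmetric_in (I : finType) (v : I -> 'rV[R]_d) (A : {set I}) (l : 'I_d) : Prop :=
  forall k, k \in A -> exists2 k', k' \in A & v k' = refl l (v k).

Definition asymmetry (I : finType) S (v : I -> 'rV[R]_d) (A : {set I}) : nat :=
  #|[set l in S | ~~ `[< symmetric_in v A l >]]|.

Lemma one_sided_asym (I : finType) (v : I -> 'rV[R]_d) (A : {set I}) i j s : j != i ->
  one_sided v A j i s -> ~ symmetric_in v A j.
Proof.
move=> ji [t [half [k kT ks]]] sym; have [kA ki] := (topP v A i s k).1 kT.
have [k' k'A e] := sym k kA.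
have k'T : k' \in top v A i s.
  by apply/topP; rewrite k'A e reflE eq_sym (negbTE ji) ki.
have := half k' k'T; rewrite e reflE eqxx mulrN oppr_ge0 => /le_lt_trans/(_ ks).
by rewrite ltxx.
Qed.

Lemma asymmetry_sym (I : finType) S (v : I -> 'rV[R]_d) (A : {set I}) j s : j \in S ->
  ~ symmetric_in v A j -> (asymmetry S (vsym v j) (Asym v A j s) < asymmetry S v A)%N.
Proof.
move=> jS nsym; apply: proper_card; apply/properP; split.
  apply/fintype.subsetP => l; rewrite !inE => /andP[-> /=]; apply: contra => /asboolP h.
  have lj : l != j by apply/eqP => e; apply: nsym; rewrite -e.
  apply/asboolP => -[k b]; rewrite inE /= => /andP[kA ks]; have [k' k'A e] := h k kA.
  exists (k', b); first by rewrite inE k'A /= e reflE eq_sym (negbTE lj).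
  by rewrite !vsymE /= e; case: b => //; rewrite reflC.
exists j; first by rewrite inE jS; apply/asboolP.
rewrite inE jS negbK; apply/asboolP => -[k b]; rewrite inE /= => /andP[kA ks].
exists (k, ~~ b); first by rewrite inE kA.
by rewrite !vsymE /=; case: b; rewrite /= ?reflK.
Qed.

Lemma not_two_sided (I : finType) S (v : I -> 'rV[R]_d) (A : {set I}) i s : lab S v A ->
  ~ two_sided v A i s -> exists j, [/\ j \in S, j != i & one_sided v A j i s].
Proof.
move=> lv /existsNP[j /not_implyP[ji]] hn; exists j.
have jS k : k \in top v A i s -> v k 0 j != 0 -> j \in S.
  move=> kT; apply: contraR => jS; have [_ h _ _] := lv.
  by rewrite (h k _ j jS) ?eqxx // (fintype.subsetP (top_sub v A i s)).
have [p1|n1] := pselect (exists2 k, k \in top v A i s & 0 < v k 0 j);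
  have [p2|n2] := pselect (exists2 k, k \in top v A i s & v k 0 j < 0).
- by case: hn.
- have [k kT kp] := p1; split => //; first by apply: jS kT _; rewrite gt_eqF.
  exists false; split; last by exists k; rewrite // /strict expr0 mul1r.
  by move=> m mT; rewrite expr0 mul1r leNgt; apply/negP => h; apply: n2; exists m.
- have [k kT kp] := p2; split => //; first by apply: jS kT _; rewrite lt_eqF.
  exists true; split; last by exists k; rewrite // /strict expr1 mulN1r oppr_gt0.
  move=> m mT; rewrite expr1 mulN1r oppr_ge0 leNgt; apply/negP => h.
  by apply: n1; exists m.
- by case: hn.
Qed.

(* Symmetrizing in a coordinate where the configuration is one-sided strictly
   lowers both the number of flags and the asymmetry, so that the configuration
   may be assumed to be two-sided. *)
Lemma lab_flag_bound_aux n : flag_bound (R := R) (d := d) n /\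
  forall (I : finType) (v : I -> 'rV[R]_d) (A : {set I}) S, #|S| = n -> lab S v A ->
    #|chains (pface v A) n.+2| = (2 ^ n * n`!)%N ->
    forall i s, i \in S -> two_sided v A i s.
Proof.
elim/ltn_ind: n => n IH.
have bound : flag_bound (R := R) (d := d) n.
  move=> I v A S cS lv; have [a] := ubnP (asymmetry S v A).
  elim: a I v A lv => // a IHa I v A lv; rewrite ltnS => hA.
  case: n IH cS IHa => [|N] IH cS IHa.
    rewrite expn0 fact0 muln1 card_gt0; apply/set0Pn.
    exists [ffun j : 'I_2 => if j == 0 :> nat then set0 else A].
    have [A0 _ _ _] := lv; apply/chainsP; split => [j|j j']; rewrite !ffunE.
      by case: ifP => _; [apply: pface_set0|apply: face_top].
    case: j j' => [[|[|//]] ?] [[|[|//]] ?] //= _; apply/properP; split; first exact: sub0set.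
    by have /set0Pn[k kA] := A0; exists k; rewrite ?inE.
  have [ts|] := pselect (forall i s, i \in S -> two_sided v A i s).
    have [J [u [lu puv]]] := lab_dual lv.
    have IH' m : (m <= N)%N -> flag_bound (R := R) (d := d) m.
      by move=> mN; case: (IH m) => //; rewrite ltnS.
    by have [] := two_sided_step lv lu puv cS IH' ts.
  case/existsNP => i /existsNP[s] /not_implyP[iS] /(not_two_sided lv)[j [jS ji os]].
  apply/ltnW/(sym_strict lv jS cS iS ji os) => s'.
  apply: (IHa _ _ _ (lab_sym s' lv jS)); apply: leq_trans hA.
  by apply: asymmetry_sym => //; apply: one_sided_asym ji os.
split => // I v A S cS lv e i s iS; apply: contrapT => /(not_two_sided lv)[j [jS ji os]].
have := sym_strict lv jS cS iS ji os; rewrite e ltnn => h; apply/notF/h => s'.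
by apply: bound cS (lab_sym s' lv jS).
Qed.

Lemma lab_flag_bound n : flag_bound (R := R) (d := d) n.
Proof. by case: (lab_flag_bound_aux n). Qed.

Lemma lab_flag_equality (I : finType) (v : I -> 'rV[R]_d) (A : {set I}) S N :
  #|S| = N.+1 -> lab S v A -> #|chains (pface v A) N.+3| = (2 ^ N.+1 * N.+1`!)%N ->
  [/\ forall i s, i \in S -> two_sided v A i s,
      forall F, F \in chains (pface v A) N.+3 ->
        exists i s, i \in S /\ F \in through v A (top v A i s) N
    & forall i s, i \in S -> forall F, F \in through v A (top v A i s) N ->
        grid_like v A (top v A i s) F].
Proof.
move=> cS lv e; have ts := (lab_flag_bound_aux N.+1).2 I v A S cS lv e.
have [J [u [lu puv]]] := lab_dual lv.
by have [_ /(_ e)[]] := two_sided_step lv lu puv cS (fun n _ => @lab_flag_bound n) ts.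
Qed.

End LabTheorem.

(** * The case of equality *)

Section Extremal.
Context {R : realType} {d : nat} {I J : finType}.
Variables (S : {set 'I_d}) (v : I -> 'rV[R]_d) (A : {set I}) (u : J -> 'rV[R]_d) (B : {set J}).
Variable N : nat.
Hypotheses (lv : lab S v A) (puv : polar_pair S v A u B) (cS : #|S| = N.+1).
Hypothesis flags_eq : #|chains (pface v A) N.+3| = (2 ^ N.+1 * N.+1`!)%N.
Local Notation w := (fun k => lift1 (v k)).

Lemma rank_full : face_rank w A = N.+2.
Proof.
have ne : chains (pface v A) N.+3 != set0.
  by rewrite -card_gt0 flags_eq muln_gt0 expn_gt0 fact_gt0.
apply/eqP; rewrite eqn_leq (full_rank ne) andbT -cS.
apply: (rank_in_coords (p := 0)) => m mA; rewrite subr0.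
by case: lv => _ h _ _; apply: h.
Qed.

(** The members of the family that sit at vertices, position 1 of a flag being a vertex. *)
Definition ext : {set I} := [set k | [exists F in chains (pface v A) N.+3, k \in F (inord 1)]].

Lemma ext_sub : ext \subset A.
Proof.
apply/fintype.subsetP => k; rewrite inE => /exists_inP[F hF].
exact: (fintype.subsetP (face_sub (chain_in 1 hF))).
Qed.

Lemma ext_in_face G : G \in pface v A -> G != set0 -> exists2 k, k \in ext & k \in G.
Proof.
move=> hG G0.
have [||F hF sub] := flag_of_chain rank_full (pface_set0 v A) (c := [:: G]).
- by rewrite /= proper0 G0.
- by rewrite /= hG.
have [j jN e] := sub G (mem_head _ _).
have j0 : (0 < j)%N.
  rewrite lt0n; apply: contraNneq G0 => j0; rewrite -e j0.
  by rewrite (flag_bottom _ (pface_set0 v A) hF) // rank_full.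
have := chain_proper hF (ltn0Sn 0) isT; case/properP => _ [k kF _].
exists k; first by rewrite inE; apply/exists_inP; exists F.
by rewrite -e; apply: (fintype.subsetP (chain_sub hF j0 jN)).
Qed.

Lemma ext_max G y : G \in pface v A -> G != set0 ->
  exists2 k, k \in ext :&: G & forall l, l \in G -> dotv (v l) y <= dotv (v k) y.
Proof.
move=> hG /set0Pn[k0 k0G].
case: (@arg_maxP _ R I k0 (mem G) (fun k => dotv (v k) y) k0G) => m mG hm.
have hH : [set k in G | dotv (v k) y == dotv (v m) y] \in pface v A.
  by apply: face_trans hG (pface_exposed _) => k kG; apply: hm.
have [|k kE] := ext_in_face hH; first by apply/set0Pn; exists m; rewrite inE (mG : m \in G) eqxx.
rewrite inE => /andP[kG /eqP e]; exists k; first by rewrite inE kE.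
by move=> l lG; rewrite e; apply: hm.
Qed.

Lemma hull_ext x : hull v A x -> hull v ext x.
Proof.
move=> hx; apply: contrapT => /hull_separation[a [b [ha xb]]].
have [|k] := ext_max (- a) (face_top w A); first by case: lv.
rewrite inE => /andP[kE _] hmax; have := hull_dotv hx hmax.
by rewrite !dotvNr lerN2; have := ha k kE; lra.
Qed.

(** Deleting coordinate [j] from the vertex gives a point [k'] that some facet [Z] through the
    vertex avoids. By equality a flag from the vertex to [Z] belongs to a direction [(i, s)]. For
    the point [y] exposing [Z], coordinate [i] already contributes 1 to [<v k, y> = 1], while
    coordinate [j] contributes a positive amount since [k'] is off [Z]. Hence [i = j]: nonzero
    coordinates of a vertex are extreme. *)
Lemma ext_tip k j : k \in ext -> v k 0 j != 0 -> exists s, k \in top v A j s.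
Proof.
rewrite inE => /exists_inP[F hF kF] kj; set C := F (inord 1) in kF.
have CL : C \in pface v A by apply: chain_in hF.
have rA : (face_rank w A <= N.+2)%N by rewrite rank_full.
have rC : face_rank w C = 1%N by apply: flag_rank hF _ _.
have kA : k \in A := fintype.subsetP (face_sub CL) _ kF.
have C0 : C != set0 by apply/set0Pn; exists k.
have [_ _ proj _] := lv; have [k' k'A e] := proj [set~ j] k kA.
have k'C : k' \notin C.
  apply/negP => k'C.
  have h1 : (face_rank w set0 < face_rank w [set k'])%N.
    apply: (@face_rank_lt _ _ _ w set0 _ (affine_form 0 1) k'); rewrite ?sub0set ?set11 //.
      by move=> i; rewrite inE.
    by rewrite dotv_lift1 dotv0r add0r oner_eq0.
  have h2 : (face_rank w [set k'] < face_rank w C)%N.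
    apply: (@face_rank_lt _ _ _ w _ _ (affine_form (delta_mx 0 j) 0) k); rewrite ?sub1set //.
      move=> i /set1P ->; rewrite dotv_lift1 dotv_delta addr0 e coord_projE !inE eqxx //.
    by rewrite dotv_lift1 dotv_delta addr0.
  by move: h1 h2; rewrite rC face_rank0; case: (face_rank w [set k']).
have [Z [ZL rZ CZ k'Z]] := coatom_avoiding rank_full (pface_set0 v A) CL C0 k'A k'C.
have [Phi hP [eC eZ]] : exists2 Phi, Phi \in chains (pface v A) N.+3 &
    Phi (inord 1) = C /\ Phi (inord N.+1) = Z.
  have Z0 : Z != set0 by apply/set0Pn; exists k; apply: (fintype.subsetP CZ).
  have [||Phi hP hc] := flag_of_chain rank_full (pface_set0 v A)
      (c := if C == Z then [:: C] else [:: C; Z]).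
  - case: eqVneq => CZ'; rewrite /= proper0 C0 //= properEneq CZ' CZ //.
  - by case: eqVneq => _; rewrite /= CL ?ZL.
  exists Phi => //.
  have [a aN ea] : exists2 a, (a <= N.+2)%N & Phi (inord a) = C.
    by apply: hc; case: eqVneq => _; apply: mem_head.
  have [b bN eb] : exists2 b, (b <= N.+2)%N & Phi (inord b) = Z.
    by apply: hc; case: eqVneq => [->|_]; rewrite !inE eqxx ?orbT.
  have ra := flag_rank rA hP aN; have rb := flag_rank rA hP bN.
  have a1 : a = 1%N by rewrite -ra ea.
  have b1 : b = N.+1 by rewrite -rb eb.
  by rewrite a1 in ea; rewrite b1 in eb.
have [_ /(_ Phi hP)[i [s [iS /throughP[_ T1 T2]]]] _] := lab_flag_equality cS lv flags_eq.
rewrite eC in T1; rewrite eZ in T2.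
have ZA : Z != A by apply: contraNneq k'Z => ->.
have [y hy1 ey] := polar_face (polar_pair_sym puv) ZL ZA.
have [_ _ vu _ _] := puv.
have vy l : l \in A -> dotv (v l) y <= 1.
  by move=> lA; rewrite dotvC; apply: hull_dotv hy1 _ => m mB; rewrite dotvC vu.
have ky : dotv (v k) y = 1.
  by have := fintype.subsetP CZ _ kF; rewrite ey inE dotvC => /andP[_ /eqP].
have nn l := polar_prod_ge0 lv l vy kA ky.
have jy : v k 0 j * y 0 j != 0.
  apply: contra k'Z => /eqP z; rewrite ey inE k'A dotvC e dotv_flatten z subr0 ky eqxx //.
have iy : v k 0 i * y 0 i = 1.
  have [p pT ep] := pole_top s lv iS.
  have [_ ->] := (topP v A i s k).1 (fintype.subsetP T1 _ kF).
  have := fintype.subsetP T2 _ pT; rewrite ey inE ep => /andP[_ /eqP].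
  by rewrite /pole dotvZr dotv_delta.
have [<-|ij] := eqVneq i j; first by exists s; apply: (fintype.subsetP T1).
have : dotv (v k) y > 1.
  rewrite /dotv (bigD1 i) //= (bigD1 j) ?(eq_sym j) //= iy addrA.
  have h1 : 0 < v k 0 j * y 0 j by rewrite lt0r jy nn.
  have : 0 <= \sum_(l < d | (l != i) && (l != j)) v k 0 l * y 0 l by apply: sumr_ge0 => l _.
  by lra.
by rewrite ky ltxx.
Qed.

(** Non-adjacency of two directions, before it is known to be independent of the signs. *)
Definition pole_pair i s j t := exists2 k, k \in A & v k = pole v A i s + pole v A j t.

Lemma pole_pairC i s j t : pole_pair i s j t -> pole_pair j t i s.
Proof. by case=> k kA e; exists k => //; rewrite e addrC. Qed.

Lemma top_pair k i s j t : i != j -> k \in top v A i s -> k \in top v A j t -> pole_pair i s j t.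
Proof.
move=> ij /topP[kA ki] /topP[_ kj]; have [_ _ proj _] := lv.
have [k' k'A e] := proj [set i; j] k kA; exists k' => //; rewrite e.
apply/rowP => l; rewrite coord_projE mxE !poleE !inE.
have [->|li] := eqVneq l i; first by rewrite (negbTE ij) addr0.
by have [->|lj] := eqVneq l j; rewrite add0r.
Qed.

(** By two-sidedness [T] reaches strictly to the side [t] of [x_j = 0]. A vertex in [T] furthest on
    that side is extreme in direction [j] by [ext_tip], and its projection to the coordinates [i],
    [j] is the sum of the two poles. *)
Lemma spread_pair i s j t : i \in S -> j \in spread v A i s -> pole_pair i s j t.
Proof.
move=> iS jsp; have [ts _ _] := lab_flag_equality cS lv flags_eq.
have jS : j \in S by have /fintype.subsetP/(_ j jsp) := spread_sub i s lv; rewrite inE => /andP[].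
have [ji] : j != i /\ [exists k in top v A i s, v k 0 j != 0] by apply/andP; move: jsp; rewrite inE.
case/exists_inP => k kT kj; have [h1 h2] := ts i s iS j ji.
have [p1 p2] : (exists2 k, k \in top v A i s & 0 < v k 0 j) /\
    (exists2 k, k \in top v A i s & v k 0 j < 0).
  move: kj; rewrite neq_lt => /orP[h|h].
    by split; [apply: h2|]; exists k.
  by split; [|apply: h1]; exists k.
have [m mT mj] : exists2 m, m \in top v A i s & 0 < (-1) ^+ t * v m 0 j.
  case: t; [case: p2|case: p1] => m mT mj; exists m => //.
    by rewrite expr1 mulN1r oppr_gt0.
  by rewrite expr0 mul1r.
have TL : top v A i s \in pface v A by apply: top_face.
have [|q] := ext_max ((-1) ^+ t *: delta_mx 0 j) TL; first by apply/set0Pn; exists m.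
rewrite inE => /andP[qE qT] /(_ m mT); rewrite !dotvZr !dotv_delta => /(lt_le_trans mj) qj.
have q0 : v q 0 j != 0 by apply: contraTneq qj => ->; rewrite mulr0 ltxx.
have [s' qs'] := ext_tip qE q0; apply: top_pair qT _; first by rewrite eq_sym.
suff <- : s' = t by [].
have [_ e] := (topP v A j s' q).1 qs'; move: qj (tip_gt0 s' lv jS); rewrite e.
by case: (s') (t) => -[] //=; rewrite ?expr0 ?expr1 ?mulN1r ?mul1r; lra.
Qed.

Lemma pair_spread i s j t : j \in S -> j != i -> pole_pair i s j t -> j \in spread v A i s.
Proof.
move=> jS ji [k kA e]; rewrite inE ji; apply/exists_inP; exists k.
  by apply/topP; rewrite kA e mxE !poleE eqxx eq_sym (negbTE ji) addr0.
rewrite e mxE !poleE (negbTE ji) eqxx add0r mulf_neq0 ?signr_eq0 //.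
by rewrite gt_eqF // (tip_gt0 t lv).
Qed.

Lemma spread_sym i s j t : i \in S -> j \in spread v A i s -> i \in spread v A j t.
Proof.
move=> iS jsp; have := fintype.subsetP (spread_sub i s lv) _ jsp; rewrite in_setD1 => /andP[ji jS].
by apply: (pair_spread iS) (pole_pairC (spread_pair t iS jsp)); rewrite eq_sym.
Qed.

(** Going to [j] and back by [spread_sym] changes the sign at [i], so adjacency can be defined with
    one sign. *)
Lemma spread_indep i s j t : i \in S -> j \in spread v A i s -> j \in spread v A i t.
Proof.
move=> iS jsp; have := fintype.subsetP (spread_sub i s lv) _ jsp; rewrite in_setD1 => /andP[_ jS].
exact: spread_sym jS (spread_sym false iS jsp).
Qed.

End Extremal.

(** * Exclusion of induced paths on four vertices *)

Section ForbiddenPath.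
Context {R : realType} {d : nat} {I J : finType}.
Variables (S : {set 'I_d}) (v : I -> 'rV[R]_d) (A : {set I}) (u : J -> 'rV[R]_d) (B : {set J}).
Variable N : nat.
Hypotheses (lv : lab S v A) (lu : lab S u B) (puv : polar_pair S v A u B) (cS : #|S| = N.+1).
Hypothesis flags_eq : #|chains (pface v A) N.+3| = (2 ^ N.+1 * N.+1`!)%N.

Lemma pole_dot_ne i s j t : i != j -> dotv (pole v A i s) (pole u B j t) = 0.
Proof.
move=> ij; rewrite /pole dotvZl dotvZr dotv_delta mxE eq_sym (negbTE ij) andbF.
by rewrite !mulr0.
Qed.

Lemma pole_dot_neg i s : i \in S -> dotv (pole v A i s) (pole u B i (~~ s)) < 0.
Proof.
move=> iS; rewrite /pole dotvZl dotvZr dotv_delta mxE !eqxx mulr1 mulrACA.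
have -> : (-1) ^+ s * (-1) ^+ (~~ s) = -1 :> R by case: s; rewrite /= ?mulr1 ?mul1r.
by rewrite mulN1r oppr_lt0 mulr_gt0 // (tip_gt0 _ lv, tip_gt0 _ lu).
Qed.

Lemma flags_eq_dual : #|chains (pface u B) N.+3| = (2 ^ N.+1 * N.+1`!)%N.
Proof. by rewrite (card_chains_polar _ puv). Qed.

Lemma spread_dualE i s j : i \in S -> j \in S -> j != i ->
  (j \in spread u B i s) = (j \notin spread v A i s).
Proof.
move=> iS jS ji; have [ts _ _] := lab_flag_equality cS lv flags_eq.
by have [-> _] := spread_dual lv lu puv iS (ts i s iS); rewrite !inE ji jS !andbT.
Qed.

(** Adjacent directions are non-adjacent for the polar, whose poles therefore have their sum in the
    polar. *)
Lemma edge_valid i j k : i \in S -> j \in S -> j != i -> j \notin spread v A i false -> k \in A ->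
  dotv (v k) (pole u B i false + pole u B j false) <= 1.
Proof.
move=> iS jS ji na kA.
have : j \in spread u B i false by rewrite spread_dualE.
case/(spread_pair lu (polar_pair_sym puv) cS flags_eq_dual false iS) => l lB <-.
by case: puv => _ _ vu _ _; apply: vu.
Qed.

(* For an edge ij let y_ij be the sum of the poles i and j of the polar.  With T
   the face in direction a, the face F = {y_ab = y_bc = 1} and its proper face
   F' = {y_ab = y_bc = y_ce = 1} have the same meet with T and the same join
   with T, so that a flag through F' and F is not a path in the grid. *)
Lemma no_induced_path a b c e : a \in S -> b \in S -> c \in S -> e \in S ->
  uniq [:: a; b; c; e] ->
  b \notin spread v A a false -> c \notin spread v A b false -> e \notin spread v A c false ->
  c \in spread v A a false -> e \in spread v A a false -> e \in spread v A b false -> False.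
Proof.
move=> aS bS cS' eS uniq_abce nab nbc nce sac sae sbe.
have [ab ac ae] : [/\ a != b, a != c & a != e].
  by move: uniq_abce; rewrite /= !inE !negb_or => /and4P[/and3P[]].
have [bc be ce] : [/\ b != c, b != e & c != e].
  by move: uniq_abce; rewrite /= !inE !negb_or => /and4P[_ /andP[-> ->] -> _].
have [ts _ grid] := lab_flag_equality cS lv flags_eq; have [_ _ vu _ _] := puv.
have [ba ca ea cb] : [/\ b != a, c != a, e != a & c != b] by split; rewrite eq_sym.
have [eb ec] : e != b /\ e != c by split; rewrite eq_sym.
pose p i := pole v A i false; pose q i := pole u B i false.
pose y1 := q a + q b; pose y2 := q b + q c; pose y3 := q c + q e.
have v1 k : k \in A -> dotv (v k) y1 <= 1 by move=> kA; exact: (edge_valid aS bS ba nab kA).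
have v2 k : k \in A -> dotv (v k) y2 <= 1 by move=> kA; exact: (edge_valid bS cS' cb nbc kA).
have v3 k : k \in A -> dotv (v k) y3 <= 1 by move=> kA; exact: (edge_valid cS' eS ec nce kA).
have val i j : i \in S -> dotv (p i) (q j) = (i == j)%:R.
  move=> iS; have [<-|ij] := eqVneq i j; first exact: (pole_polar lv lu puv false iS).
  exact: (pole_dot_ne false false ij).
have val2 i j x y : dotv (x + y) (q i + q j) = dotv x (q i) + dotv x (q j) + (dotv y (q i) + dotv y (q j)).
  by rewrite dotvDl !dotvDr.
have neqs := (negbTE ab, negbTE ac, negbTE ae, negbTE bc, negbTE be, negbTE ce,
  negbTE ba, negbTE ca, negbTE ea, negbTE cb, negbTE eb, negbTE ec, eqxx).
have [kac kacA eac] : exists2 k, k \in A & v k = p a + p c.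
  exact: (spread_pair lv puv cS flags_eq false aS sac).
have [kbe kbeA ebe] : exists2 k, k \in A & v k = p b + p e.
  exact: (spread_pair lv puv cS flags_eq false bS sbe).
have [kbn kbnA ebn] := spread_pair lv puv cS flags_eq true bS sbe.
have [kae kaeA eae] : exists2 k, k \in A & v k = p a + p e.
  exact: (spread_pair lv puv cS flags_eq false aS sae).
have [kan kanA ean] := spread_pair lv puv cS flags_eq true aS sae.
have [ka kaT eka] := pole_top false lv aS.
set T := top v A a false in kaT.
have two : 1 + 1 = 2 :> R by [].
have three : 2 + 1 = 3 :> R := esym (natrD R 2 1).
pose G := [set k in A | dotv (v k) y1 == 1].
pose F := [set k in A | dotv (v k) (y1 + y2) == 2].
pose F' := [set k in A | dotv (v k) (y1 + y2 + y3) == 3].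
have GL : G \in pface v A by apply: pface_exposed.
have FL : F \in pface v A.
  by apply: pface_exposed => k kA; rewrite dotvDr -two lerD ?v1 ?v2.
have F'L : F' \in pface v A.
  apply: pface_exposed => k kA; rewrite dotvDr [dotv (v k) (y1 + y2)]dotvDr.
  by rewrite -three -two !lerD ?v1 ?v2 ?v3.
have TL : T \in pface v A by apply: top_face.
have inF k : k \in F -> [/\ k \in A, dotv (v k) y1 = 1 & dotv (v k) y2 = 1].
  rewrite inE dotvDr => /andP[kA /eqP h]; have := v1 k kA; have := v2 k kA.
  by move=> h2 h1; split => //; move: h h1 h2; clear; lra.
have inF' k : k \in F' -> [/\ k \in F, k \in A, dotv (v k) y1 = 1, dotv (v k) y2 = 1
    & dotv (v k) y3 = 1].
  rewrite inE dotvDr [dotv (v k) (y1 + y2)]dotvDr => /andP[kA /eqP h].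
  have := v1 k kA; have := v2 k kA; have := v3 k kA => h3 h2 h1.
  have [e1 e2 e3] : [/\ dotv (v k) y1 = 1, dotv (v k) y2 = 1 & dotv (v k) y3 = 1].
    by move: h h1 h2 h3; clear => h h1 h2 h3; split; lra.
  by split => //; rewrite inE kA dotvDr e1 e2 two eqxx.
have mkF' k : k \in A -> dotv (v k) y1 = 1 -> dotv (v k) y2 = 1 -> dotv (v k) y3 = 1 -> k \in F'.
  move=> kA e1 e2 e3; rewrite inE kA dotvDr [dotv (v k) (y1 + y2)]dotvDr e1 e2 e3 /=.
  by rewrite two three eqxx.
have acF' : kac \in F'.
  by apply: mkF' => //; rewrite eac val2 !val // !neqs ?add0r ?addr0.
have beF' : kbe \in F'.
  by apply: mkF' => //; rewrite ebe val2 !val // !neqs ?add0r ?addr0.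
(* The positive pole of [b] plus the negative pole of [e] lies in [F], but gives [y3] a negative
   value. *)
have FF' : F' \proper F.
  apply/properP; split; first by apply/fintype.subsetP => k /inF'[].
  exists kbn.
    rewrite inE kbnA ebn dotvDr !val2 -/(p b) !val // !neqs.
    by rewrite !(pole_dot_ne true false) // !addr0 add0r two eqxx.
  apply/negP => /inF'[_ _ _ _]; rewrite ebn val2 -/(p b) !val // !neqs.
  rewrite (pole_dot_ne true false) // => h.
  have := pole_dot_neg true eS; rewrite /= -/(q e).
  by move: h; rewrite !add0r => ->; rewrite ltr10.
have acT : kac \in T.
  by apply/topP; rewrite kacA eac mxE !poleE eqxx (negbTE ac) addr0.
have F'T : F' :&: T \proper F'.
  apply/properP; split; first exact: subsetIl.
  exists kbe => //; rewrite inE beF' /=; apply/negP => /topP[_].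
  rewrite ebe mxE !poleE (negbTE ab) (negbTE ae) addr0 => /esym/eqP.
  by rewrite expr0 mul1r gt_eqF // (tip_gt0 _ lv).
have TG : T \subset G.
  apply/fintype.subsetP => k kT; rewrite inE (fintype.subsetP (top_sub _ _ _ _) _ kT) /=.
  apply/eqP; apply: (top_tight lv v1) kT; last exact: ts.
  by rewrite -/(p a) dotvDr !val // !neqs /= ?addr0.
have FG : F \proper G.
  apply/properP; split; first by apply/fintype.subsetP => k /inF[kA h _]; rewrite inE kA h eqxx.
  exists ka; first exact: (fintype.subsetP TG).
  apply/negP => /inF[_ _]; rewrite eka -/(p a) dotvDr !val // !neqs addr0 => /esym/eqP.
  by rewrite oner_eq0.
(* The nonempty face [F' :&: T] forces the vertex of the flag into [T], and [G], which contains [T],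
   forces its facet above [T]; so the flag is one of those to which [grid] applies. *)
have [||Phi hP hc] := flag_of_chain (rank_full lv cS flags_eq) (pface_set0 v A)
    (c := [:: F' :&: T; F'; F; G]).
- rewrite /= F'T FF' FG !andbT proper0; apply/set0Pn; exists kac.
  by rewrite inE acF' acT.
- by rewrite /= (face_cap F'L TL) F'L FL GL.
have rA : (face_rank (fun k => lift1 (v k)) A <= N.+2)%N.
  by rewrite (rank_full lv cS flags_eq).
have at_rank Y : Y \in [:: F' :&: T; F'; F; G] ->
    exists2 j, Phi (inord j) = Y & [/\ (j <= N.+2)%N, (0 < j)%N & j = face_rank (fun k => lift1 (v k)) Y].
  move=> YL; have [j jN ej] := hc Y YL; exists j => //; rewrite -ej (flag_rank rA hP jN); split => //.
  rewrite lt0n; apply/eqP => j0; move: ej; rewrite j0.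
  rewrite (flag_bottom rA (pface_set0 v A) hP) => e0.
  have : kac \in Y.
    move: YL; rewrite !inE => /or4P[] /eqP ->; first by rewrite inE acF'.
    - by [].
    - by apply: (fintype.subsetP (proper_sub FF')).
    - by apply: (fintype.subsetP (proper_sub FG)); apply: (fintype.subsetP (proper_sub FF')).
  by rewrite -e0 inE.
have [j0 e0 [j0N j0p _]] := at_rank _ (mem_head _ _).
have [j1 e1 [j1N j1p r1]] : exists2 j, Phi (inord j) = F' &
    [/\ (j <= N.+2)%N, (0 < j)%N & j = face_rank (fun k => lift1 (v k)) F'].
  by apply: at_rank; rewrite !inE eqxx orbT.
have [j2 e2 [j2N j2p r2]] : exists2 j, Phi (inord j) = F &
    [/\ (j <= N.+2)%N, (0 < j)%N & j = face_rank (fun k => lift1 (v k)) F].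
  by apply: at_rank; rewrite !inE eqxx !orbT.
have [j3 e3 [j3N j3p r3]] : exists2 j, Phi (inord j) = G &
    [/\ (j <= N.+2)%N, (0 < j)%N & j = face_rank (fun k => lift1 (v k)) G].
  by apply: at_rank; rewrite !inE eqxx !orbT.
have j12 : (j1 < j2)%N by rewrite r1 r2; apply: (face_rank_proper F'L (face_sub FL) FF').
have j23 : (j2 < j3)%N by rewrite r2 r3; apply: (face_rank_proper FL (face_sub GL) FG).
have GA : G \proper A.
  apply/properP; split; first exact: face_sub GL.
  have [_ _ proj _] := lv; have [k0 k0A ek0] := proj set0 ka (fintype.subsetP (top_sub _ _ _ _) _ kaT).
  exists k0 => //; rewrite inE k0A /=.
  have -> : v k0 = 0 by rewrite ek0; apply/rowP => l; rewrite coord_projE inE mxE.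
  by rewrite dotv0l eq_sym oner_eq0.
have j3N' : (j3 <= N.+1)%N.
  rewrite -ltnS r3 -(rank_full lv cS flags_eq).
  exact: (face_rank_proper GL (subxx A) GA).
have Pth : Phi \in through v A T N.
  apply/throughP; split => //.
    apply: subset_trans (chain_sub hP j0p j0N) _; rewrite e0; exact: subsetIr.
  by apply: subset_trans TG _; rewrite -e3; apply: (chain_sub hP j3N').
have stepF : Phi (inord j1.+1) \subset F by rewrite -e2; apply: (chain_sub hP j12 j2N).
(* On [F :&: T] the value of [q a] is 1, so [y1] and [y2] being tight makes [q b] equal to 0 and
   [q c] equal to 1. The point then lies in the top face of [c], on which [y3] is tight; hence it is
   in [F']. *)
have eT : Phi (inord j1) :&: T = Phi (inord j1.+1) :&: T.
  apply/eqP; rewrite eqEsubset setSI; last exact: chain_sub hP (leqnSn _) (leq_trans j12 j2N).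
  rewrite e1 subsetI subsetIr andbT; apply/fintype.subsetP => k; rewrite inE => /andP[/(fintype.subsetP stepF) kF kT].
  have [kA h1 h2] := inF k kF; apply: mkF' => //.
  have xa : dotv (v k) (q a) = 1.
    apply: (top_tight lv _ _ (ts a false aS) kT); last by rewrite val // eqxx.
    have [m mT em] := pole_top false lu aS => l lA; rewrite /q -em.
    by apply: vu lA (fintype.subsetP (top_sub _ _ _ _) _ mT).
  have xc : dotv (v k) (q c) = 1.
    by move: h1 h2; rewrite !dotvDr; lra.
  have kc : k \in top v A c false.
    rewrite inE kA /=; move: xc; rewrite /q /pole dotvZr dotv_delta (tip_polar lv lu puv) // expr0 !mul1r.
    move/(congr1 ( *%R (tip v A c false))); rewrite mulrA mulfV ?mul1r ?mulr1; last first.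
      by rewrite gt_eqF // (tip_gt0 _ lv).
    by move=> ->.
  apply: (top_tight lv v3 _ (ts c false cS') kc).
  by rewrite -/(p c) dotvDr !val // !neqs /= ?addr0.
have j1N' : (j1 <= N)%N by rewrite -ltnS (leq_trans j12) // (leq_trans (ltnW j23)).
have [Y [YL TY F'Y nY]] := grid a false aS Phi Pth j1 j1p j1N' eT.
case/negP: nY; apply: subset_trans stepF _; rewrite e1 in F'Y.
have [->|YA] := eqVneq Y A; first exact: face_sub FL.
have [y hy1 ey] := polar_face (polar_pair_sym puv) YL YA.
have vy l : l \in A -> dotv (v l) y <= 1.
  by move=> lA; rewrite dotvC; apply: hull_dotv hy1 _ => m mB; rewrite dotvC vu.
have inY k : k \in Y -> dotv (v k) y = 1 by rewrite ey inE dotvC => /andP[_ /eqP].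
have ya : dotv (p a) y = 1 by rewrite /p -eka; apply: inY; apply: (fintype.subsetP TY).
(* The pole of [a] is tight for [y], and adding either pole of [e] to it stays in the polytope. *)
have ye0 : dotv (p e) y = 0.
  have h1 := vy _ kaeA; have h2 := vy _ kanA; move: h1 h2.
  rewrite eae ean !dotvDl -/(p a) ya => h1 h2.
  have h3 : y 0 e <= 0.
    move: h1; rewrite /p /pole dotvZl [dotv (delta_mx _ _) _]dotvC dotv_delta expr0 mul1r.
    by rewrite gerDl pmulr_rle0 // (tip_gt0 _ lv).
  have h4 : 0 <= y 0 e.
    move: h2; rewrite /pole dotvZl [dotv (delta_mx _ _) _]dotvC dotv_delta expr1 mulN1r mulNr.
    by rewrite gerDl oppr_le0 pmulr_rge0 // (tip_gt0 _ lv).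
  have ye : y 0 e = 0 by apply/le_anti; rewrite h3 h4.
  by rewrite /p /pole dotvZl dotvC dotv_delta ye mulr0.
have yb : dotv (p b) y = 1.
  have := inY _ (fintype.subsetP F'Y _ beF'); rewrite ebe dotvDl -/(p b) -/(p e) ye0 addr0 //.
(* A vertex in [F] with nonzero coordinate [a] is extreme there, on the positive side because [y1]
   is tight, so it lies in [T]. Otherwise [y1] puts it in the top face of [b]. On both top faces [y]
   is tight. *)
have tight k : k \in ext v A N -> k \in F -> dotv (v k) y = 1.
  move=> kE kF; have [kA h1 _] := inF k kF.
  have na := polar_prod_ge0 lv a v1 kA h1; have nb := polar_prod_ge0 lv b v1 kA h1.
  have [ka0|ka0] := eqVneq (v k 0 a) 0; last first.
    have [s kT] := ext_tip lv puv cS flags_eq kE ka0.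
    case: s kT => kT; last exact: (top_tight lv vy ya (ts a false aS)).
    move: na; have [_ ->] := (topP v A a true k).1 kT.
    rewrite mxE !poleE eqxx (negbTE ab) addr0 expr0 expr1 mul1r mulN1r mulNr oppr_ge0.
    by rewrite leNgt mulr_gt0 // (tip_gt0 _ lv, tip_gt0 _ lu).
  have xb : v k 0 b * tip u B b false = 1.
    move: h1; rewrite dotvDr /q /pole !dotvZr !dotv_delta ka0 mulr0 add0r expr0 mul1r mulrC //.
  have kT : k \in top v A b false.
    rewrite inE kA expr0 mul1r /=; move: xb; rewrite (tip_polar lv lu puv) //.
    move/(congr1 ( *%R^~ (tip v A b false))); rewrite mulfVK ?mul1r; last first.
      by rewrite gt_eqF // (tip_gt0 _ lv).
    by move=> ->.
  exact: (top_tight lv vy yb (ts b false bS)).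
apply/fintype.subsetP => k kF; have [kA _ _] := inF k kF.
have [|m] := ext_max lv cS flags_eq (- y) FL; first by apply/set0Pn; exists k.
rewrite inE => /andP[mE mF] /(_ k kF); rewrite !dotvNr lerN2 (tight m mE mF) => h.
by rewrite ey inE kA dotvC eq_le vy.
Qed.

End ForbiddenPath.

(** * Cographs *)

Section Comparability.
Context {R : realType} {d : nat} {I J : finType}.
Variables (S : {set 'I_d}) (v : I -> 'rV[R]_d) (A : {set I}) (u : J -> 'rV[R]_d) (B : {set J}).
Variable N : nat.
Hypotheses (lv : lab S v A) (lu : lab S u B) (puv : polar_pair S v A u B) (cS : #|S| = N.+1).
Hypothesis flags_eq : #|chains (pface v A) N.+3| = (2 ^ N.+1 * N.+1`!)%N.

(** The adjacency of the graph; in the extremal case fixing the sign [false] loses nothing, by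
    [spread_indep]. *)
Definition separated : rel 'I_d := fun i j => (i != j) && (j \notin spread v A i false).

Lemma separated_irr : irreflexive separated.
Proof. by move=> i; rewrite /separated eqxx. Qed.

Lemma ext_support k i : k \in ext v A N -> v k 0 i != 0 -> i \in S.
Proof.
move=> /(fintype.subsetP (ext_sub v A N)) kA; apply: contraR => iS.
by case: lv => _ h _ _; rewrite h.
Qed.

Lemma ext_not_separated k i j : k \in ext v A N -> v k 0 i != 0 -> v k 0 j != 0 ->
  ~~ separated i j.
Proof.
move=> kE ki kj; rewrite /separated negb_and !negbK; have [//|ij /=] := eqVneq i j.
have iS := ext_support kE ki; have jS := ext_support kE kj.
have [s ks] := ext_tip lv puv cS flags_eq kE ki.
have [t kt] := ext_tip lv puv cS flags_eq kE kj.
have ji : j != i by rewrite eq_sym.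
exact: (spread_indep lv puv cS flags_eq false iS (pair_spread lv jS ji (top_pair lv ij ks kt))).
Qed.

Lemma separated_sym : S = setT -> symmetric separated.
Proof.
move=> ST; suff h i j : separated i j -> separated j i by move=> i j; apply/idP/idP; apply: h.
rewrite /separated => /andP[ij]; rewrite eq_sym ij; apply: contra => hj.
by apply: (spread_sym lv puv cS flags_eq false _ hj); rewrite ST inE.
Qed.

End Comparability.

Definition P4_free (T : finType) (e : rel T) : Prop := forall a b c f,
  uniq [:: a; b; c; f] -> e a b -> e b c -> e c f -> ~~ e a c -> ~~ e a f -> ~~ e b f -> False.

Section Cograph.
Context {T : finType}.
Implicit Types (e : rel T) (V X : {set T}).

Definition complement e : rel T := fun x y => (x != y) && ~~ e x y.

Lemma complement_sym e : symmetric e -> symmetric (complement e).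
Proof. by move=> se x y; rewrite /complement eq_sym se. Qed.

Lemma complement_P4_free e : symmetric e -> P4_free e -> P4_free (complement e).
Proof.
move=> se he a b c f; rewrite /complement /= !inE !negb_or !negb_and !negbK.
case/and4P=> /and3P[ab ac af] /andP[bc bf] cf _ /andP[_ nab] /andP[_ nbc] /andP[_ ncf].
rewrite (negbTE ac) (negbTE af) (negbTE bf) /= => eac eaf ebf.
(* The path a-b-c-f is self-complementary: its complement is the path c-a-f-b. *)
have hu : uniq [:: c; a; f; b].
  by rewrite /= !inE !negb_or (eq_sym c a) ac cf (eq_sym c b) bc ab af /= eq_sym bf.
by apply: (he _ _ _ _ hu); rewrite // se.
Qed.

(** For [c = true] the graph on [V] is the join of [X] and its complement, for [c = false] their
    disjoint union. *)
Definition splits (c : bool) e V X :=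
  [/\ X != set0, X \proper V & forall x y, x \in X -> y \in V :\: X -> e x y = c].

Lemma splitsC c e V X : symmetric e -> splits c e V X -> splits c e V (V :\: X).
Proof.
move=> se [X0 XV h]; have [sXV [y yV yX]] := properP XV; split.
- by apply/set0Pn; exists y; rewrite inE yX.
- rewrite properEneq subsetDl andbT; apply: contraNneq X0 => e1; apply/eqP/setP => x.
  rewrite inE; apply/negP => xX; have := fintype.subsetP sXV _ xX.
  by rewrite -e1 inE xX.
- move=> x z xY; rewrite setDDr setDv set0U => /setIP[_ zX]; rewrite se; exact: h.
Qed.

(* Suppose that v has a neighbour y outside X.  A non-neighbour m of v in X that
   is adjacent to a neighbour z of v in X would give the induced path m-z-v-y,
   so that the non-neighbours of v in X are separated from everything else. *)
Lemma splits_extend e V X v : symmetric e -> irreflexive e -> P4_free e -> v \notin V ->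
  splits false e V X -> exists c Y, splits c e (v |: V) Y.
Proof.
move=> se ie pe vV sX.
have [/forall_inP adj|] := boolP [forall x in V, e v x].
  have [X0 XV _] := sX; exists true, [set v]; split.
  - by apply/set0Pn; exists v; rewrite inE.
  - rewrite properEneq subsetUl andbT; have /set0Pn[x xX] := X0.
    have xV := fintype.subsetP (proper_sub XV) _ xX.
    apply/eqP => /setP/(_ x); rewrite !inE xV orbT => /eqP xv.
    by rewrite -xv xV in vV.
  - move=> x y; rewrite !inE => /eqP -> /andP[/negbTE yv]; rewrite yv /=; exact: adj.
case/forall_inPn => w wV nw.
wlog wX : X sX / w \in X.
  move=> H; have [wX|wX] := boolP (w \in X); first exact: (H X).
  by apply: (H (V :\: X)); [apply: splitsC | rewrite inE wX].
have [X0 XV h] := sX; have sXV := fintype.subsetP (proper_sub XV).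
have xv x : x \in X -> x != v by apply: contraTneq => ->; apply: contra vV; apply: sXV.
have [/forall_inP non|] := boolP [forall y in V :\: X, ~~ e v y].
  exists false, (V :\: X); have [Y0 YV hY] := splitsC se sX; split => //.
    by apply: proper_sub_trans YV _; apply: subsetUr.
  move=> x y xY; rewrite inE => /andP[yY]; rewrite !inE => /orP[/eqP ->|yV].
    by rewrite se; apply/negbTE/non.
  by apply: hY => //; rewrite inE yY yV.
case/forall_inPn => y yY; rewrite negbK => vy.
exists false, [set x in X | ~~ e v x]; split.
- by apply/set0Pn; exists w; rewrite inE wX.
- apply/properP; split; first by apply/fintype.subsetP => x; rewrite !inE => /andP[/sXV -> _]; rewrite orbT.
  by exists v; rewrite !inE ?eqxx // ; apply/negP => /andP[/xv]; rewrite eqxx.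
- move=> m z; rewrite inE => /andP[mX nm]; rewrite !inE negb_and negbK.
  case/andP => hz /orP[/eqP zv|zV]; first by rewrite zv se (negbTE nm).
  have [zX|zX] := boolP (z \in X); last by apply: h => //; rewrite inE zX.
  rewrite zX /= in hz; apply/negbTE/negP => mz.
  have [yX yV] : y \notin X /\ y \in V by move: yY; rewrite inE => /andP.
  have yv : y != v by apply: contraNneq vV => <-.
  have hu : uniq [:: m; z; v; y].
    have neqX x : x \in X -> x != y by move=> xX; apply: contraNneq yX => <-.
    rewrite /= !inE !negb_or (xv m mX) (xv z zX) (eq_sym v) yv !neqX // !andbT.
    by apply: contraTneq mz => ->; rewrite ie.
  by apply: (pe _ _ _ _ hu) => //; first [by rewrite se | by rewrite h].
Qed.

(** Vertices are added one by one. When the split so far is a join, the extension takes place in the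
    complement, where it is a disjoint union. *)
Lemma cograph_splits e V : symmetric e -> irreflexive e -> P4_free e -> (1 < #|V|)%N ->
  exists c X, splits c e V X.
Proof.
move=> se ie pe; move: {2}#|V| (leqnn #|V|) => n; elim: n V => [|n IH] V.
  by rewrite leqn0 => /eqP ->.
move=> Vn V2; have /set0Pn[v vV] : V != set0 by rewrite -card_gt0 ltnW.
have cV : #|V| = #|V :\ v|.+1 by rewrite (cardsD1 v) vV.
have vV' : v \notin V :\ v by rewrite !inE eqxx.
have [V1|V1] := leqP #|V :\ v| 1.
  have /cards1P[w ew] : #|V :\ v| == 1%N by rewrite eqn_leq V1 -ltnS -cV.
  exists (e v w), [set v]; split.
  - by apply/set0Pn; exists v; rewrite inE.
  - by rewrite properEcard sub1set vV cards1 V2.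
  - by move=> x y /set1P ->; rewrite ew => /set1P ->.
have [|c [X sX]] := IH _ _ V1; first by rewrite -ltnS -cV.
rewrite -(setD1K vV); case: c sX => sX; last exact: (splits_extend se ie pe vV' sX).
have sX' : splits false (complement e) (V :\ v) X.
  have [X0 XV h] := sX; split => // x y xX yX; rewrite /complement h // andbF //.
have ic : irreflexive (complement e) by move=> x; rewrite /complement eqxx.
have [c [Y [Y0 YV h]]] := splits_extend (complement_sym se) ic (complement_P4_free se pe) vV' sX'.
exists (~~ c), Y; split => // x y xY yY; have := h x y xY yY; rewrite /complement.
have -> : x != y by apply: contraTneq xY => ->; move: yY; rewrite inE => /andP[].
by move=> /= <-; rewrite negbK.
Qed.

End Cograph.

(** * From cographs to generalized Hanner polytopes *)

Lemma hull_neq0 (R : realType) (d : nat) (I : finType) (v : I -> 'rV[R]_d) (A : {set I}) x :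
  hull v A x -> A != set0.
Proof.
case=> c [_ c1 _]; apply: contra_eq_neq c1 => ->.
by rewrite big_set0 eq_sym oner_eq0.
Qed.

Section ConvexHull.
Context {R : realType} {d : nat}.
Implicit Types (P G : set 'rV[R]_d) (x y : 'rV[R]_d).
Local Open Scope classical_set_scope.

Lemma convex_setP P : @convex_set R 'rV[R]_d P <->
  forall x y t, 0 <= t <= 1 -> P x -> P y -> P (t *: x + (1 - t) *: y).
Proof.
split=> [h x y t /andP[t0 t1] Px Py|h x y t /set_mem Px /set_mem Py].
  by apply: set_mem; apply: (h x y (Itv01 t0 t1)); apply: mem_set.
by apply: mem_set; apply: (h x y t%:num) => //; rewrite ge0 le1.
Qed.

Lemma convex_comb (I : finType) (v : I -> 'rV[R]_d) (A : {set I}) P x :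
  @convex_set R 'rV[R]_d P -> (forall i, i \in A -> P (v i)) -> hull v A x -> P x.
Proof.
move=> /convex_setP cP; elim: {A}_.+1 {-2}A (ltnSn #|A|) x => // n IH A An x vP [c [c0 c1 ->]].
have [k kA ck] : exists2 k, k \in A & c k != 0.
  apply: contrapT => h; have : \sum_(i in A) c i = 0.
    by apply: big1 => i iA; apply/eqP; apply: contrapT => ci; apply: h; exists i => //; apply/negP.
  by rewrite c1 => /eqP; rewrite oner_eq0.
rewrite (bigD1 k) //= in c1; rewrite (bigD1 k) //=.
set s := \sum_(i in A | i != k) c i in c1.
have s0 : 0 <= s by apply: sumr_ge0.
have es : s = 1 - c k by rewrite -c1 [RHS]addrC addKr.
have [z|nz] := eqVneq s 0.
  have ck1 : c k = 1 by rewrite -c1 z addr0.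
  rewrite ck1 scale1r big1 ?addr0 => [|i iA]; first exact: vP.
  suff -> : c i = 0 by rewrite scale0r.
  apply/le_anti; rewrite c0 andbT -z /s (bigD1 i) //= lerDl; exact: sumr_ge0.
have sp : 0 < s by rewrite lt0r nz s0.
pose y := \sum_(i in A :\ k) (c i / s) *: v i.
have -> : \sum_(i in A | i != k) c i *: v i = (1 - c k) *: y.
  rewrite scaler_sumr; apply: eq_big => [i|i _]; first by rewrite !inE andbC.
  by rewrite scalerA -es mulrCA mulfV // mulr1.
apply: cP; first by rewrite c0 -c1 lerDl.
  exact: vP.
apply: (IH (A :\ k)) => [|i|].
- by rewrite (cardsD1 k) kA in An.
- by rewrite inE => /andP[_ /vP].
- exists (fun i => c i / s); split => [i||//]; first by rewrite divr_ge0.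
  rewrite -mulr_suml -[RHS](mulfV nz); congr (_ * _).
  by apply: eq_bigl => i; rewrite !inE andbC.
Qed.

Lemma hull_convex (I : finType) (v : I -> 'rV[R]_d) (A : {set I}) :
  @convex_set R 'rV[R]_d [set x | hull v A x].
Proof.
apply/convex_setP => x y t /andP[t0 t1] [c [c0 c1 ->]] [f [f0 f1 ->]] /=.
exists (fun i => t * c i + (1 - t) * f i); split => [i||].
- by rewrite addr_ge0 ?mulr_ge0 // subr_ge0.
- by rewrite big_split /= -!mulr_sumr c1 f1; ring.
- rewrite !scaler_sumr -big_split; apply: eq_bigr => i _ /=.
  by rewrite !scalerA scalerDl.
Qed.

Lemma convex_hull_convex G : @convex_set R 'rV[R]_d (convex_hull G).
Proof.
apply/convex_setP => x y t t01 hx hy B [cB GB]; move/convex_setP: (cB); apply => //.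
  by apply: hx; split.
by apply: hy; split.
Qed.

Lemma sub_convex_hull G : G `<=` convex_hull G.
Proof. by move=> x Gx B [_]; apply. Qed.

Lemma convex_hull_min G P : @convex_set R 'rV[R]_d P -> G `<=` P -> convex_hull G `<=` P.
Proof. by move=> cP GP x; apply; split. Qed.

Lemma convex_hull_hull (I : finType) (v : I -> 'rV[R]_d) (A : {set I}) :
  convex_hull [set v i | i in [set` A]] = [set x | hull v A x].
Proof.
apply/seteqP; split.
  by apply: convex_hull_min; [apply: hull_convex|move=> _ [i /= iA <-]; apply: hull_mem].
move=> x hx; apply: (convex_comb (@convex_hull_convex _) _ hx) => i iA.
by apply: sub_convex_hull; exists i.
Qed.

End ConvexHull.

Lemma hull_mulmx (R : realType) (d n : nat) (I : finType) (v : I -> 'rV[R]_d) (A : {set I})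
    (M : 'M_(d, n)) x : hull v A x -> hull (fun i => v i *m M) A (x *m M).
Proof.
case=> c [c0 c1 ->]; exists c; split => //.
by rewrite mulmx_suml; apply: eq_bigr => i _; rewrite scalemxAl.
Qed.

Section HannerData.
Context {R : realType}.
Local Open Scope classical_set_scope.

(** Generators of [P] have stable supports and generators of the polar have cliques as supports. No
    flags are mentioned, so the property passes to sections and polars directly. *)
Definition cograph_config d (P : set 'rV[R]_d) (e : rel 'I_d) : Prop :=
  exists (I J : finType) (v : I -> 'rV[R]_d) (A : {set I}) (u : J -> 'rV[R]_d) (B : {set J}),
  [/\ polar_pair setT v A u B, P = [set x | hull v A x],
      forall k i j, k \in A -> v k 0 i != 0 -> v k 0 j != 0 -> ~~ e i j
    & forall k i j, k \in B -> u k 0 i != 0 -> u k 0 j != 0 -> i != j -> e i j].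

Lemma polarK d (I J : finType) (v : I -> 'rV[R]_d) A (u : J -> 'rV[R]_d) B :
  polar_pair setT v A u B -> polar [set x | hull v A x] = [set x | hull u B x].
Proof.
case=> _ _ vu _ hy; apply/seteqP; split => y /= h.
  by apply: hy => [|i iA]; [apply: in_coords_setT | rewrite dotvC; apply: h; apply: hull_mem].
move=> x hx; apply: hull_dotv h _ => j jB; rewrite dotvC.
by apply: hull_dotv hx _ => i iA; apply: vu.
Qed.

Lemma cograph_config_polar d (P : set 'rV[R]_d) e : irreflexive e ->
  cograph_config P e -> cograph_config (polar P) (complement e) /\ polar (polar P) = P.
Proof.
move=> ie [I [J [v [A [u [B [puv -> hv hu]]]]]]]; rewrite (polarK puv).
have pvu := polar_pair_sym puv; split; last by rewrite (polarK pvu).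
exists J, I, u, B, v, A; split => // k i j kB.
  move=> ki kj; rewrite /complement negb_and !negbK; case: eqVneq => //= ij; exact: hu kB ki kj ij.
by move=> ki kj ij; rewrite /complement ij (hv k).
Qed.

Lemma dotv_1 (x y : 'rV[R]_1) : dotv x y = x 0 0 * y 0 0.
Proof. by rewrite /dotv big_ord1. Qed.

Lemma hull_segment (I : finType) (v : I -> 'rV[R]_1) (A : {set I}) m M : m \in A -> M \in A ->
  (forall k, k \in A -> v m 0 0 <= v k 0 0 <= v M 0 0) ->
  [set x | hull v A x] = [set x : 'rV_1 | v m 0 0 <= x 0 0 <= v M 0 0].
Proof.
move=> mA MA h; apply/seteqP; split => x /=; last first.
  case/andP=> xm xM; apply: contrapT => /hull_separation[a [b [ha xb]]].
  have := ha m mA; have := ha M MA; move: xb; rewrite !dotv_1.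
  have [a0|a0] := leP 0 (a 0 0).
    by have := ler_wpM2r a0 xm; lra.
  by have := ler_wnM2r (ltW a0) xM; lra.
move=> hA; apply/andP; split.
  rewrite -lerN2 -!dotv_delta -!dotvNr; apply: hull_dotv hA _ => k kA.
  by rewrite !dotvNr !dotv_delta lerN2; case/andP: (h k kA).
rewrite -[x 0 0]dotv_delta; apply: hull_dotv hA _ => k kA.
by rewrite dotv_delta; case/andP: (h k kA).
Qed.

Lemma Hanner_interval (P : set 'rV[R]_1) e : cograph_config P e -> generalized_Hanner P.
Proof.
case=> I [J [v [A [u [B [puv -> _ _]]]]]].
have [_ _ vu hx _] := puv.
(* The polar has finitely many generators, so a short enough segment on either side of 0 satisfies
   all inequalities. *)
have near0 s : exists2 t : R, 0 < t & hull v A (((-1) ^+ s * t) *: delta_mx 0 0).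
  have [t t0 ht] := @exists_small R J (fun=> 1) (fun j => (-1) ^+ s * u j 0 0) (fun=> ltr01).
  exists t => //; apply: hx; first exact: in_coords_setT.
  move=> j _; rewrite dotv_1 !mxE eqxx mulr1 -mulrA mulrCA; exact: ht.
have [t1 t10 h1] := near0 true; have [t2 t20 h2] := near0 false.
have /set0Pn[k0 k0A] := hull_neq0 h1.
have [m mA hm] := @arg_minP _ R I k0 (mem A) (fun k => v k 0 0) k0A.
have [M MA hM] := @arg_maxP _ R I k0 (mem A) (fun k => v k 0 0) k0A.
have eP : [set x | hull v A x] = [set x : 'rV_1 | v m 0 0 <= x 0 0 <= v M 0 0].
  by apply: hull_segment => // k kA; apply/andP; split; [apply: hm | apply: hM].
have in_segment x : hull v A x -> v m 0 0 <= x 0 0 <= v M 0 0.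
  by have /seteqP[s _] := eP; apply: s.
rewrite eP; apply: Hanner_segment.
  have /andP[h _] := in_segment _ h1; apply: le_lt_trans h _.
  by rewrite !mxE eqxx mulr1 expr1 mulN1r oppr_lt0.
have /andP[_ h] := in_segment _ h2; apply: lt_le_trans h.
by rewrite !mxE eqxx mulr1 expr0 mul1r.
Qed.

End HannerData.

Lemma dotv_trmx (R : realType) (m n : nat) (x : 'rV[R]_m) (y : 'rV[R]_n) (M : 'M_(m, n)) :
  dotv (x *m M) y = dotv x (y *m M^T).
Proof. by rewrite !dotv_mulmx trmx_mul trmxK mulmxA. Qed.

Section CoordinateSelection.
Context {R : realType} {d : nat}.
Implicit Types (X Y : {set 'I_d}).

Definition sel X : 'M[R]_(#|X|, d) := \matrix_(i, j) (enum_val i == j)%:R.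

Lemma mul_selT X n (M : 'M_(n, d)) i j : (M *m (sel X)^T) i j = M i (enum_val j).
Proof.
rewrite mxE (bigD1 (enum_val j)) //= !mxE eqxx mulr1 big1 ?addr0 // => k kj.
by rewrite !mxE eq_sym (negbTE kj) mulr0.
Qed.

Lemma selK X : sel X *m (sel X)^T = 1%:M.
Proof. by apply/matrixP => i j; rewrite mul_selT !mxE (inj_eq enum_val_inj). Qed.

Lemma sel_orth X Y : [disjoint X & Y] -> sel X *m (sel Y)^T = 0.
Proof.
move=> dXY; apply/matrixP => i j; rewrite mul_selT !mxE.
rewrite (_ : enum_val i == enum_val j = false) //; apply/negP => /eqP e.
by have := disjointFr dXY (enum_valP i); rewrite e enum_valP.
Qed.

Lemma selTK X (y : 'rV_d) : y *m (sel X)^T *m sel X = coord_proj X y.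
Proof.
apply/rowP => j; rewrite coord_projE mxE; case: ifP => jX.
  rewrite (bigD1 (enum_rank_in jX j)) //= mul_selT mxE enum_rankK_in // eqxx mulr1.
  rewrite big1 ?addr0 // => k kj; rewrite [sel X k j]mxE; have [e|] := eqVneq (enum_val k) j; last by rewrite mulr0.
  by case/eqP: kj; apply: enum_val_inj; rewrite enum_rankK_in.
by rewrite big1 // => k _; rewrite [sel X k j]mxE; have [e|] := eqVneq (enum_val k) j;
  [rewrite -e enum_valP in jX|rewrite mulr0].
Qed.

End CoordinateSelection.

Section HannerRecursion.
Context {R : realType}.
Local Open Scope classical_set_scope.

(** The constructor asks for the dimension in the form [k + l], whereas [#|X| + #|~: X|] equals [d]
    only by a proof. *)
Lemma Hanner_join_cast (d k l : nat) (P : set 'rV[R]_k) (Q : set 'rV[R]_l)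
    (S : 'M[R]_(k, d)) (T : 'M[R]_(l, d)) :
  d = (k + l)%N -> generalized_Hanner P -> generalized_Hanner Q ->
  S *m S^T = 1%:M -> T *m T^T = 1%:M -> S *m T^T = 0 ->
  generalized_Hanner (convex_hull ([set x *m S | x in P] `|` [set y *m T | y in Q])).
Proof. by move=> e; subst d; apply: Hanner_join. Qed.

(** As [X] is completely adjacent to its complement, a stable support lies on one side, so
    projecting a generator of [P] to R^X either fixes it or gives 0. Section and projection of [P]
    thus agree, and the polar generators can simply be projected. *)
Lemma cograph_config_sel d (P : set 'rV[R]_d) e (X : {set 'I_d}) :
  symmetric e -> splits true e setT X -> cograph_config P e ->
  cograph_config [set x | P (x *m sel X)] (fun i j => e (enum_val i) (enum_val j)).
Proof.
move=> se sX [I [J [v [A [u [B [puv -> hv hu]]]]]]].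
have [_ _ vu hx hy] := puv.
have v0 : hull v A 0.
  by apply: hx => [|j _]; [apply: in_coords_setT | rewrite dotv0l].
have side k : k \in A -> coord_proj X (v k) = v k \/ coord_proj X (v k) = 0.
  move=> kA; have [/existsP[i /andP[iX ki]]|no] := boolP [exists i, (i \in X) && (v k 0 i != 0)].
    left; apply: coord_proj_id => j jX; apply/eqP; apply: contraT => kj.
    have [_ _ h] := sX; have := hv k i j kA ki kj; rewrite h //.
    by rewrite !inE jX.
  right; apply/rowP => j; rewrite coord_projE mxE; case: ifP => // jX.
  by apply/eqP; apply: contraNT no => kj; apply/existsP; exists j; rewrite jX.
have pair k j : k \in A -> j \in B -> dotv (v k *m (sel X)^T) (u j *m (sel X)^T) <= 1.
  move=> kA jB; rewrite -dotv_trmx selTK.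
  by case: (side k kA) => ->; [apply: vu | rewrite dotv0l].
have inv x : hull v A (x *m sel X) -> hull (fun k => v k *m (sel X)^T) A x.
  by move=> /(hull_mulmx (sel X)^T); rewrite -mulmxA selK mulmx1.
exists I, J, (fun k => v k *m (sel X)^T), A, (fun k => u k *m (sel X)^T), B; split.
- split => //; try by move=> *; apply: in_coords_setT.
    move=> x _ xu; apply/inv/hx => [|j jB]; first exact: in_coords_setT.
    by rewrite dotv_trmx; apply: xu.
  move=> y _ yv; rewrite -[y]mulmx1 -(selK X) mulmxA; apply: hull_mulmx.
  apply: hy => [|i iA]; first exact: in_coords_setT.
  by rewrite dotvC dotv_trmx dotvC; apply: yv.
- apply/seteqP; split => x /=; first exact: inv.
  move=> hA; apply: hx => [|j jB]; first exact: in_coords_setT.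
  by rewrite dotv_trmx; apply: hull_dotv hA _ => k kA; apply: pair.
- by move=> k i j kA; rewrite !mul_selT; apply: hv.
- by move=> k i j kB; rewrite !mul_selT => ki kj ij; apply: hu kB ki kj _; rewrite (inj_eq enum_val_inj).
Qed.

Lemma cograph_config_Hanner d (P : set 'rV[R]_d) e : (0 < d)%N ->
  symmetric e -> irreflexive e -> P4_free e -> cograph_config P e -> generalized_Hanner P.
Proof.
move: {2}d (leqnn d) => n; elim: n d P e => [|n IH] d P e.
  by rewrite leqNgt => /negP h /h.
move=> dn d0; have [d1|d1] := leqP d 1.
  have {d1} d1 : d = 1%N by apply/eqP; rewrite eqn_leq d1.
  by subst d => *; apply: (@Hanner_interval R P e).
(* With a split of type [true], each generator has its support on one side, so the polytope is the
   convex hull of its two sections. *)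
have join (P' : set 'rV[R]_d) e' X : symmetric e' -> irreflexive e' -> P4_free e' ->
    cograph_config P' e' -> splits true e' setT X -> generalized_Hanner P'.
  move=> {P e} se ie pe cP sX; have [X0 XT hX] := sX.
  have sY : splits true e' setT (~: X) by rewrite -setTD; apply: splitsC.
  have part Y : splits true e' setT Y ->
      generalized_Hanner [set x : 'rV_#|Y| | P' (x *m sel Y)].
    move=> sY'; have [Y0 YT _] := sY'; apply: IH (cograph_config_sel se sY' cP).
    - by rewrite -ltnS (leq_trans _ dn) // -[d in (_ <= d)%N]card_ord -cardsT proper_card.
    - by rewrite card_gt0.
    - by move=> i j; apply: se.
    - by move=> i; apply: ie.
    - move=> a b c f un; apply: pe; rewrite -(map_inj_uniq enum_val_inj) in un; exact: un.
  have [I [J [v [A [u [B [puv eP hv _]]]]]]] := cP.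
  have -> : P' = convex_hull ([set x *m sel X | x in [set x | P' (x *m sel X)]] `|`
      [set y *m sel (~: X) | y in [set y | P' (y *m sel (~: X))]]).
    apply/seteqP; split; last first.
      apply: convex_hull_min; first by rewrite eP; apply: hull_convex.
      by move=> _ [[x /= Px <-]|[x /= Px <-]].
    rewrite {1}eP => x hx; apply: (convex_comb (@convex_hull_convex _ _ _) _ hx) => k kA.
    apply: sub_convex_hull.
    have Pk : P' (v k) by rewrite eP; apply: hull_mem.
    have mem Y : coord_proj Y (v k) = v k -> [set x *m sel Y | x in [set x | P' (x *m sel Y)]] (v k).
      by move=> e; exists (v k *m (sel Y)^T); rewrite /= selTK e.
    have [/existsP[i /andP[iX ki]]|no] := boolP [exists i, (i \in X) && (v k 0 i != 0)].
      left; apply/mem/coord_proj_id => j jX; apply/eqP; apply: contraT => kj.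
      have := hv k i j kA ki kj; rewrite hX //.
      by rewrite !inE jX.
    right; apply/mem/coord_proj_id => j; rewrite inE negbK => jX; apply/eqP.
    by apply: contraNT no => kj; apply/existsP; exists j; rewrite jX.
  apply: Hanner_join_cast (part _ sX) (part _ sY) _ _ _.
  - by rewrite cardsC card_ord.
  - exact: selK.
  - exact: selK.
  - by apply: sel_orth; rewrite disjoints_subset setCK.
move=> se ie pe cP; have [|c [X sX]] := cograph_splits (V := setT) se ie pe.
  by rewrite cardsT card_ord.
case: c sX => sX; first exact: join cP sX.
(* For a disjoint union the polar is taken: its graph is the complement, hence a join. *)
have [cP' <-] := cograph_config_polar ie cP; apply: Hanner_polar.
have ic : irreflexive (complement e) by move=> x; rewrite /complement eqxx.
apply: join (complement_sym se) ic (complement_P4_free se pe) cP' _.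
have [X0 XT hX] := sX; split; [exact: X0|exact: XT|move=> x y xX yX].
rewrite /complement hX // andbT; apply: contraTneq xX => ->; by move: yX; rewrite inE => /andP[].
Qed.

End HannerRecursion.

Section EqualityCase.
Context {R : realType}.

(** Only vertices are known to have stable or clique supports, so both families are cut down to
    [ext]; hulls and polarity survive because vertices generate. *)
Lemma flag_equality_Hanner (N : nat) (I : finType) (v : I -> 'rV[R]_N.+1) (A : {set I}) :
  lab setT v A -> #|chains (pface v A) N.+3| = (2 ^ N.+1 * N.+1`!)%N ->
  generalized_Hanner [set x | hull v A x]%classic.
Proof.
move=> lv flags_eq; have [J [u [lu puv]]] := lab_dual lv.
have cT : #|[set: 'I_N.+1]| = N.+1 by rewrite cardsT card_ord.
have pvu := polar_pair_sym puv; have flags_eq' := flags_eq_dual puv flags_eq.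
have [hv hu vu hx hy] := puv.
have ev := hull_ext lv cT flags_eq; have eu := hull_ext lu cT flags_eq'.
have sv := fintype.subsetP (ext_sub v A N); have su := fintype.subsetP (ext_sub u setT N).
have eq_hull : [set x | hull v A x]%classic = [set x | hull v (ext v A N) x]%classic.
  by apply/seteqP; split => x /=; [apply: ev | apply/hull_sub/ext_sub].
apply: (@cograph_config_Hanner R _ _ (separated v A)) => //.
- exact: (separated_sym lv puv cT flags_eq).
- exact: separated_irr.
- move=> a b c f un; rewrite /separated => /andP[_ ab] /andP[_ bc] /andP[_ cf].
  have [ac af bf] : [/\ a != c, a != f & b != f].
    by move: un; rewrite /= !inE !negb_or => /and4P[/and3P[_ -> ->] /andP[_ ->]].
  rewrite ac af bf /= !negbK.
  by apply: (no_induced_path lv lu puv cT flags_eq _ _ _ _ un) ab bc cf; rewrite inE.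
- exists I, J, v, (ext v A N), u, (ext u setT N); split.
  + split.
    * by move=> i /sv; apply: hv.
    * by move=> i /su; apply: hu.
    * by move=> i j /sv iA /su; apply: vu.
    * move=> x xT xu; apply/ev/hx => // j jB; rewrite dotvC.
      by apply: hull_dotv (eu _ (hull_mem u jB)) _ => l lE; rewrite dotvC; apply: xu.
    * move=> y yT yv; apply/eu/hy => // i iA.
      by apply: hull_dotv (ev _ (hull_mem v iA)) _ => l lE; apply: yv.
  + exact: eq_hull.
  + by move=> k i j; apply: (ext_not_separated lv puv cT flags_eq).
  + move=> k i j kE ki kj ij.
    have := ext_not_separated lu pvu cT flags_eq' kE ki kj.
    rewrite /separated ij negbK (spread_dualE lv lu puv cT flags_eq) ?inE //.
    by rewrite eq_sym.
Qed.

End EqualityCase.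

(** * Flags of polytopes *)

Section AffineHull.
Context {R : realType} {d : nat}.
Local Open Scope classical_set_scope.
Implicit Types (G : set 'rV[R]_d) (x y : 'rV[R]_d).

Lemma affine_hull_mem (K : finType) G (v : K -> 'rV[R]_d) (c : K -> R) :
  (forall k, G (v k)) -> \sum_k c k = 1 -> affine_hull G (\sum_k c k *: v k).
Proof.
move=> hv c1; exists #|K|, (v \o enum_val), (c \o enum_val); split => [i||] /=; first exact: hv.
  by rewrite -c1 (reindex _ (onW_bij _ (@enum_val_bij K))).
by rewrite (reindex _ (onW_bij _ (@enum_val_bij K))).
Qed.

Lemma affine_hull_shift G x y z t : affine_hull G x -> G y -> G z ->
  affine_hull G (x + t *: (y - z)).
Proof.
case=> n [v [c [vG c1 ->]]] Gy Gz.
pose w (k : 'I_n + bool) := match k with inl i => v i | inr b => if b then y else z end.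
pose f (k : 'I_n + bool) := match k with inl i => c i | inr b => if b then t else - t end.
have -> : \sum_i c i *: v i + t *: (y - z) = \sum_k f k *: w k.
  by rewrite big_sumType /= big_bool /= scalerBr scaleNr.
apply: affine_hull_mem; first by move=> [i|[]]; [apply: vG | |].
by rewrite big_sumType /= big_bool /= c1 subrr addr0.
Qed.

Lemma affine_hull_span G x (s : seq 'rV[R]_d) u : affine_hull G x ->
  (forall a, a \in s -> exists y z, [/\ G y, G z & a = y - z]) -> u \in <<s>>%VS ->
  affine_hull G (x + u).
Proof.
elim: s u x => [|a s IH] u x hx hs; first by rewrite span_nil memv0 => /eqP ->; rewrite addr0.
rewrite span_cons => /memv_addP[_ /vlineP[t ->] [w ws ->]]; rewrite addrA.
apply: IH ws => [|b bs]; last by apply: hs; rewrite inE bs orbT.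
by have [y [z [Gy Gz ->]]] := hs a (mem_head _ _); apply: affine_hull_shift.
Qed.

End AffineHull.

Section FaceDimension.
Context {R : realType} {d : nat} {I : finType}.
Variable v : I -> 'rV[R]_d.
Implicit Types (A X Y : {set I}) (x y : 'rV[R]_d).

Definition face_directions X : {vspace 'rV[R]_d} :=
  <<[seq v p.1 - v p.2 | p <- enum (finset.setX X X)]>>%VS.

Lemma face_directions_mem X k l : k \in X -> l \in X -> v k - v l \in face_directions X.
Proof.
move=> kX lX; apply/memv_span/mapP; exists (k, l) => //.
by rewrite mem_enum inE kX lX.
Qed.

Lemma face_directions_dotv X u y b : (forall k, k \in X -> dotv (v k) y = b) -> u \in face_directions X ->
  dotv u y = 0.
Proof.
move=> h /coord_span ->; rewrite dotv_suml big1 // => i _; rewrite dotvZl.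
have : [seq v p.1 - v p.2 | p <- enum (finset.setX X X)]`_i \in
    [seq v p.1 - v p.2 | p <- enum (finset.setX X X)] by rewrite mem_nth // size_map -cardE.
case/mapP => -[k l]; rewrite mem_enum inE /= => /andP[kX lX] ->.
by rewrite dotvBl !h // subrr mulr0.
Qed.

(** Dimension plus one in terms of direction spaces, as [has_dim] requires; it is the expected
    position in a flag. *)
Definition direction_rank X : nat := if X == set0 then 0%N else (\dim (face_directions X)).+1.

Lemma direction_rank_le X : (direction_rank X <= d.+1)%N.
Proof.
rewrite /direction_rank; case: ifP => // _; rewrite ltnS.
by apply: leq_trans (dimvS (subvf _)) _; rewrite dimvf /dim /= mul1n.
Qed.

Lemma direction_rank_proper A X Y : X \in pface v A -> Y \in pface v A -> X \proper Y ->
  (direction_rank X < direction_rank Y)%N.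
Proof.
move=> /pfaceP[y [b [hA eX]]] YL XY; have [sXY [k kY kX]] := properP XY.
have Y0 : Y != set0 by apply/set0Pn; exists k.
rewrite /direction_rank (negbTE Y0); case: ifPn => // /set0Pn[l lX].
have sub : (face_directions X <= face_directions Y)%VS.
  apply: sub_span => a /mapP[p]; rewrite mem_enum inE => /andP[p1 p2] ->.
  by apply/mapP; exists p; rewrite // mem_enum inE !(fintype.subsetP sXY).
rewrite ltnS ltn_neqAle dimvS // andbT; apply/negP => /eqP e.
have /eqP eU : face_directions X == face_directions Y by rewrite eqEdim sub e leqnn.
have hX m : m \in X -> dotv (v m) y = b by rewrite eX inE => /andP[_ /eqP].
have := face_directions_mem kY (fintype.subsetP sXY _ lX); rewrite -eU => /(face_directions_dotv hX).
rewrite dotvBl (hX l lX) => /eqP; rewrite subr_eq0 => kb.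
by case/negP: kX; rewrite eX inE kb (fintype.subsetP (face_sub YL)).
Qed.

Lemma hull_has_dim X : has_dim [set x | hull v X x]%classic ((direction_rank X)%:Z - 1).
Proof.
rewrite /direction_rank; case: ifPn => [/eqP ->|/set0Pn[k kX]].
  left; split => //; apply/seteqP; split => x //= [c [_ c1 _]].
  by move: c1; rewrite big_set0 => /esym/eqP; rewrite oner_eq0.
right; exists (v k), (face_directions X); split; last by rewrite intS addrC addKr.
have inX m : m \in X -> hull v X (v m) by apply: hull_mem.
apply/seteqP; split => [_ [n [w [c [hw c1 ->]]]]|_ [u /= uX <-]].
  exists (\sum_i c i *: (w i - v k)) => /=.
    apply: memv_suml => i _; apply: memvZ; have [f [f0 f1 ->]] := hw i.
    have -> : \sum_(m in X) f m *: v m - v k = \sum_(m in X) f m *: (v m - v k).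
      rewrite -[v k in LHS]scale1r -f1 scaler_suml -sumrB.
      by apply: eq_bigr => m _; rewrite scalerBr.
    by apply: memv_suml => m mX; apply/memvZ/face_directions_mem.
  have e : v k = \sum_i c i *: v k by rewrite -scaler_suml c1 scale1r.
  rewrite {1}e -big_split /=.
  by apply: eq_bigr => i _; rewrite -scalerDr addrCA subrr addr0.
apply: affine_hull_span uX.
  have := @affine_hull_mem R d unit [set x | hull v X x]%classic (fun=> v k) (fun=> 1).
  by rewrite !big_const /= card_unit /= !addr0 scale1r; apply => // _; apply: inX.
move=> a /mapP[[m l]]; rewrite mem_enum inE /= => /andP[mX lX] ->.
by exists (v m), (v l); split => //; apply: inX.
Qed.

(** A strictly increasing sequence of [d + 2] naturals bounded by [d + 1] has no freedom. *)
Lemma chain_direction_rank A (F : {ffun 'I_d.+2 -> {set I}}) i : F \in chains (pface v A) d.+2 ->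
  direction_rank (F i) = i.
Proof.
move=> hF; have step j : (j < d.+1)%N ->
    (direction_rank (F (inord j)) < direction_rank (F (inord j.+1)))%N.
  move=> jd; apply: direction_rank_proper (chain_in _ hF) (chain_in _ hF) _.
  exact: (chain_proper hF (ltnSn j)).
have lower j : (j <= d.+1)%N -> (j <= direction_rank (F (inord j)))%N.
  by elim: j => // j IH jd; apply: leq_ltn_trans (IH (ltnW jd)) (step j jd).
have upper j : (j <= d.+1)%N -> (direction_rank (F (inord (d.+1 - j))) <= d.+1 - j)%N.
  elim: j => [_|j IH jd]; first by rewrite subn0 direction_rank_le.
  rewrite -ltnS -subSn // subSS; apply: leq_trans (IH (ltnW jd)).
  by rewrite [X in (_ < direction_rank (F (inord X)))%N](_ : _ = (d.+1 - j.+1).+1) ?step //; lia.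
have id : (i <= d.+1)%N by rewrite -ltnS.
have := lower i id; have := upper (d.+1 - i)%N (leq_subr _ _).
by rewrite subKn // inord_val => h1 h2; apply/eqP; rewrite eqn_leq h1.
Qed.

End FaceDimension.

Section FlagCount.
Context {R : realType} {d : nat} {I : finType}.
Variables (v : I -> 'rV[R]_d) (A : {set I}).
Local Notation P := [set x | hull v A x]%classic.

(** A point on the supporting hyperplane puts weight only on tight generators. *)
Lemma hull_tight_face x y b : hull v A x -> (forall i, i \in A -> dotv (v i) y <= b) ->
  dotv x y = b -> hull v [set i in A | dotv (v i) y == b] x.
Proof.
move=> [c [c0 c1 ex]] h e.
have z i : i \in A -> dotv (v i) y != b -> c i = 0.
  move=> iA ne; have s0 : \sum_(i in A) c i * (b - dotv (v i) y) = 0.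
    transitivity ((\sum_(i in A) c i) * b - dotv x y); last by rewrite c1 mul1r e subrr.
    rewrite ex dotv_suml mulr_suml -sumrB; apply: eq_bigr => k _.
    by rewrite dotvZl mulrBr.
  have /eqP : c i * (b - dotv (v i) y) = 0.
    apply: (psumr_eq0P _ s0) iA => k kA; rewrite mulr_ge0 // subr_ge0; exact: h.
  by rewrite mulf_eq0 subr_eq0 [b == _]eq_sym (negbTE ne) orbF => /eqP.
have e' (V : nmodType) (F : I -> V) : (forall i, c i = 0 -> F i = 0) ->
    \sum_(i in A) F i = \sum_(i in [set i in A | dotv (v i) y == b]) F i.
  move=> F0; rewrite (bigID (fun i => dotv (v i) y == b)) /= [X in _ + X]big1 ?addr0.
    by apply: eq_bigl => i; rewrite inE.
  by move=> i /andP[iA ne]; apply/F0/z.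
exists c; split => //; first by rewrite -e'.
by rewrite ex e' // => i ->; rewrite scale0r.
Qed.

Lemma face_hullP F : face P F <-> exists2 X, X \in pface v A & F = [set x | hull v X x]%classic.
Proof.
have tight y b : (forall i, i \in A -> dotv (v i) y <= b) ->
    (P `&` [set x | dotv y x = b] = [set x | hull v [set i in A | dotv (v i) y == b] x])%classic.
  move=> h; apply/seteqP; split => x /=.
    by case=> hx e; apply: hull_tight_face; rewrite // dotvC.
  move=> hx; split; first by apply: hull_sub hx; apply/fintype.subsetP => i; rewrite inE => /andP[].
  apply/le_anti/andP; split.
    rewrite dotvC; apply: hull_dotv hx _ => i; rewrite inE => /andP[_ /eqP ->]; exact: lexx.
  rewrite dotvC -lerN2 -dotvNr; apply: hull_dotv hx _ => i; rewrite inE dotvNr => /andP[_ /eqP ->].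
  exact: lexx.
split=> [[y [b [h ->]]]|[_ /pfaceP[y [b [h ->]]] ->]].
  have h' i : i \in A -> dotv (v i) y <= b by move=> iA; rewrite dotvC; apply/h/hull_mem.
  by exists [set i in A | dotv (v i) y == b]; [apply: pface_exposed | rewrite tight].
exists y, b; split; last by rewrite tight.
by move=> x hx; rewrite dotvC; apply: hull_dotv hx h.
Qed.

Lemma face_hull_subset X Y : X \in pface v A -> Y \in pface v A ->
  ([set x | hull v X x] `<=` [set x | hull v Y x])%classic -> X \subset Y.
Proof.
move=> XL /pfaceP[y [b [h ->]]] s; apply/fintype.subsetP => k kX.
rewrite inE (fintype.subsetP (face_sub XL)) //=.
have /= hk := s (v k) (hull_mem v kX); rewrite eq_le (hull_dotv hk) => [|i]; last first.
  by rewrite inE => /andP[_ /eqP ->]; exact: lexx.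
rewrite -lerN2 -dotvNr; apply: hull_dotv hk _ => i; rewrite inE dotvNr => /andP[_ /eqP ->].
exact: lexx.
Qed.

(** Index faces and geometric faces correspond, and the dimension condition in [flags] holds for
    every strict chain of [d + 2] faces by [chain_direction_rank]. *)
Lemma card_flags : (flags P #= `I_#|chains (pface v A) d.+2|)%card.
Proof.
pose H (F : {ffun 'I_d.+2 -> {set I}}) i := [set x | hull v (F i) x]%classic.
have -> : flags P = [set H F | F in [set` chains (pface v A) d.+2]]%classic.
  apply/seteqP; split => [Phi [faces strict]|_ [F /= hF <-]].
    have /choice[F hF] : forall i, exists X, X \in pface v A /\ Phi i = [set x | hull v X x]%classic.
      by move=> i; have [/face_hullP[X XL ->] _] := faces i; exists X.
    exists [ffun i => F i]; last by apply/funext => i; rewrite /H ffunE; case: (hF i).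
    apply/chainsP; split => [i|i j ij]; rewrite !ffunE; first by case: (hF i).
    have [iL ei] := hF i; have [jL ej] := hF j; have [s ne] := strict i j ij.
    rewrite ei ej in ne s; rewrite properE (face_hull_subset iL jL s) /=.
    by apply/negP => ji; apply: ne => x; apply: hull_sub.
  have [inL strict] := elimT (chainsP _ _) hF; split => [i|i j ij].
    split; first by apply/face_hullP; exists (F i).
    by rewrite /H -(chain_direction_rank i hF); apply: hull_has_dim.
  have := strict i j ij; rewrite properE => /andP[s ns]; split; first by move=> x; apply: hull_sub.
  by move=> s'; case/negP: ns; apply: face_hull_subset.
apply: card_eq_trans (inj_card_eq _) _.
  move=> F G /set_mem/= hF /set_mem/= hG e; apply/ffunP => i.
  have [inF _] := elimT (chainsP _ _) hF; have [inG _] := elimT (chainsP _ _) hG.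
  have ei : H F i = H G i by rewrite e.
  apply/eqP; rewrite eqEsubset !face_hull_subset //.
    by rewrite -/(H G i) -ei.
  by rewrite -/(H G i) -ei.
rewrite card_eq_sym; apply: card_eq_trans card_II _.
have -> : [set` chains (pface v A) d.+2]%classic =
    [set @enum_val _ (mem (chains (pface v A) d.+2)) i | i in [set: 'I_#|chains (pface v A) d.+2|]]%classic.
  apply/seteqP; split => [F /= hF|_ [i _ <-]]; last exact: enum_valP.
  by exists (enum_rank_in hF F) => //; rewrite enum_rankK_in.
by rewrite card_eq_sym; apply: inj_card_eq => i j _ _; apply: enum_val_inj.
Qed.

End FlagCount.

(** * From proper locally anti-blocking polytopes to configurations *)

Section ProperLab.
Context {R : realType} {d : nat}.
Local Open Scope classical_set_scope.
Implicit Types (P : set 'rV[R]_d) (x y : 'rV[R]_d) (K : {set 'I_d}).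

Lemma mem_coord_subspace K x : x \in coord_subspace K <-> in_coords K x.
Proof.
split=> [xK k kK|h].
  rewrite -dotv_delta; move: xK => /coord_span ->; rewrite dotv_suml big1 // => i _.
  rewrite dotvZl dotv_delta.
  have : [seq delta_mx 0 i | i in K]`_i \in [seq (delta_mx 0 i : 'rV[R]_d) | i in K].
    by rewrite mem_nth // size_map -cardE.
  case/mapP => j; rewrite mem_enum => jK ->; rewrite mxE eqxx /=.
  by rewrite (_ : k == j = false) ?mulr0 //; apply: contraNF kK => /eqP ->.
rewrite (row_sum_delta x); apply: memv_suml => k _.
have [kK|kK] := boolP (k \in K); last by rewrite h // scale0r mem0v.
by apply/memvZ/memv_span/mapP; exists k; rewrite ?mem_enum.
Qed.

Lemma polytope_hull P : polytope P ->
  exists n (v : 'I_n -> 'rV[R]_d), P = [set x | hull v [set: 'I_n]%SET x].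
Proof.
case=> s ->; exists (size s), (fun i => s`_i); rewrite -convex_hull_hull; congr convex_hull.
apply/seteqP; split => [x /= xs|_ [i _ <-]] /=; last exact: mem_nth.
have ix : (index x s < size s)%N by rewrite index_mem.
by exists (Ordinal ix); rewrite /= ?inE ?nth_index.
Qed.

Lemma interior_axis P i : interior P 0 -> exists2 t : R, 0 < t &
  forall s, P (((-1) ^+ s * t) *: delta_mx 0 i).
Proof.
move=> /nbhs_ballP[e /= e0 he].
have [t0 te] : 0 < e / 2 /\ e / 2 < e by split; lra.
exists (e / 2) => // s; move: (e / 2) t0 te => t t0 te; apply: he; split => // j k.
rewrite !mxE /ball /= sub0r normrN !normrM normrX normrN1 expr1n mul1r (gtr0_norm t0).
apply: le_lt_trans te; rewrite ler_piMr ?(ltW t0) //.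
by case: (_ && _); rewrite ?normr1 ?normr0 ?ler01.
Qed.

Lemma hull_sign (I : finType) (v : I -> 'rV[R]_d) (A : {set I}) s i x :
  hull v A x -> 0 < (-1) ^+ s * x 0 i -> exists2 k, k \in A & 0 < (-1) ^+ s * v k 0 i.
Proof.
move=> hx xi; apply: contrapT => h; have := hull_dotv (a := (-1) ^+ s *: delta_mx 0 i) (b := 0) hx.
rewrite dotvZr dotv_delta leNgt xi => vi; suff : false by []; apply: vi => k kA.
by rewrite dotvZr dotv_delta leNgt; apply/negP => vk; apply: h; exists k.
Qed.

Lemma lab_of_proper P : proper_locally_anti_blocking P ->
  exists (I : finType) (v : I -> 'rV[R]_d), lab setT v setT /\ P = [set x | hull v setT x].
Proof.
case=> -[/polytope_hull[n [v eP]] proj] P0.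
have Pproj K x : P x -> P (coord_proj K x).
  move=> Px; suff : (orth_proj (coord_subspace K) P) (coord_proj K x) by rewrite proj => -[].
  split; first exact/mem_coord_subspace/coord_proj_in.
  exists x => // y /mem_coord_subspace/coord_proj_id <-.
  by rewrite -coord_projC; apply: big1 => k _; rewrite !mxE; case: (k \in K); rewrite ?subrr mul0r.
pose w (p : 'I_n * {set 'I_d}) := coord_proj p.2 (v p.1).
have wP p : P (w p) by apply: Pproj; rewrite eP; apply: hull_mem.
have eP' : P = [set x | hull w setT x].
  apply/seteqP; split => x /=.
    rewrite {1}eP => hx; apply: (convex_comb (@hull_convex _ _ _ w setT) _ hx) => i _ /=.
    have -> : v i = w (i, setT) by rewrite /w coord_proj_id //; apply: in_coords_setT.
    exact: hull_mem.
  by move=> hx; rewrite eP; apply: (convex_comb (@hull_convex _ _ _ v setT) _ hx) => p _; rewrite -eP.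
exists ('I_n * {set 'I_d})%type, w; split => //; split.
- by move/interior_subset: P0; rewrite {1}eP'; apply: hull_neq0.
- by move=> k _; apply: in_coords_setT.
- move=> K [i L] _; exists (i, K :&: L)%SET; first by rewrite inE.
  by apply/rowP => k; rewrite !coord_projE inE /=; case: (k \in K).
- move=> i _; have [t t0 ht] := interior_axis i P0.
  have sgn s : exists2 k, k \in setT & 0 < (-1) ^+ s * w k 0 i.
    have := ht s; rewrite {1}eP' => /hull_sign; apply.
    by rewrite !mxE !eqxx mulr1 mulrA -expr2 sqrr_sign mul1r.
  have [k _ hk] := sgn false; have [l _ hl] := sgn true; split; [exists k|exists l] => //.
    by rewrite expr0 mul1r in hk.
  by rewrite expr1 mulN1r oppr_gt0 in hl.
Qed.

End ProperLab.

(** * Flags of generalized Hanner polytopes *)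

Section Descents.
Context {T : finType}.
Variables (lt : rel T) (r : T -> nat).
Hypothesis lt_rank : forall x y, lt x y -> (r x < r y)%N.

(* The number of chains [y_1 < ... < y_n < x]. *)
Fixpoint descents (n : nat) (x : T) : nat :=
  if n is m.+1 then (\sum_(y | lt y x) descents m y)%N else 1%N.

Lemma descents_vanish n x : (r x < n)%N -> descents n x = 0%N.
Proof.
elim: n x => // n IH x xn; apply: big1 => y /lt_rank yx.
by apply: IH; apply: leq_trans yx _.
Qed.

End Descents.

Lemma descents_transport (T T' : finType) (lt : rel T) (lt' : rel T') (P : pred T) (f : T -> T') :
  bijective f -> (forall x y, P x -> lt y x -> P y) ->
  (forall x y, P x -> lt' (f y) (f x) = lt y x) ->
  forall n x, P x -> descents lt' n (f x) = descents lt n x.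
Proof.
move=> bf down e; elim=> //= n IH x Px; rewrite (reindex f); last exact: onW_bij.
rewrite (eq_bigl (lt^~ x)) => [|y]; last exact: e.
by apply: eq_bigr => y yx; apply/IH/(down _ _ Px yx).
Qed.

Section ProductDescents.
Context {T1 T2 : finType}.
Variables (lt1 : rel T1) (lt2 : rel T2) (r1 : T1 -> nat) (r2 : T2 -> nat).
Hypothesis lt1_rank : forall x y, lt1 x y -> (r1 x < r1 y)%N.
Hypothesis lt2_rank : forall x y, lt2 x y -> (r2 x < r2 y)%N.

Definition lt_pair : rel (T1 * T2) := fun y x =>
  [&& y != x, (y.1 == x.1) || lt1 y.1 x.1 & (y.2 == x.2) || lt2 y.2 x.2].

Lemma lt_pair_rank x y : lt_pair x y -> (r1 x.1 + r2 x.2 < r1 y.1 + r2 y.2)%N.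
Proof.
case: x y => [x1 x2] [y1 y2]; rewrite /lt_pair xpair_eqE /=.
case: eqP => [->|_] /=; case: eqP => [->|_] //=; rewrite ?andbF //.
- by move=> /lt2_rank; rewrite ltn_add2l.
- by rewrite andbT => /lt1_rank; rewrite ltn_add2r.
- by move=> /andP[/lt1_rank h1 /lt2_rank h2]; exact: (leq_add h1 (ltnW h2)).
Qed.

Lemma sum_lt_pair (F : T1 * T2 -> nat) x1 x2 :
  (forall y1 y2, lt1 y1 x1 -> lt2 y2 x2 -> F (y1, y2) = 0%N) ->
  (\sum_(y | lt_pair y (x1, x2)) F y =
   \sum_(y1 | lt1 y1 x1) F (y1, x2) + \sum_(y2 | lt2 y2 x2) F (x1, y2))%N.
Proof.
move=> F0; have irr1 y : lt1 y y = false by apply/negP => /lt1_rank; rewrite ltnn.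
have irr2 y : lt2 y y = false by apply/negP => /lt2_rank; rewrite ltnn.
rewrite (bigID (fun y => y.2 == x2)) /=; congr (_ + _)%N.
  rewrite (reindex_onto (fun y1 => (y1, x2)) fst) /=; last first.
    by case=> y1 y2 /andP[_ /= /eqP ->].
  apply: eq_bigl => y1; rewrite /lt_pair xpair_eqE /= !eqxx !andbT.
  by have [->|] := eqVneq y1 x1; rewrite ?irr1.
rewrite (bigID (fun y => y.1 == x1)) /= [X in (_ + X)%N]big1 ?addn0.
  rewrite (reindex_onto (fun y2 => (x1, y2)) snd) /=; last first.
    by case=> y1 y2 /andP[_ /= /eqP ->].
  apply: eq_bigl => y2; rewrite /lt_pair xpair_eqE /= !eqxx !andbT /=.
  by have [->|] := eqVneq y2 x2; rewrite ?irr2 // andbT.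
case=> y1 y2 /=; rewrite /lt_pair /= => /andP[/andP[/and3P[_ h1 h2] n2] n1].
by apply: F0; [move: h1; rewrite (negbTE n1) | move: h2; rewrite (negbTE n2)].
Qed.

(** A step lowering both components leaves too little rank for the remaining steps, so only shuffles
    are counted, and the recursion is Pascal's rule. *)
Lemma descents_pair n a b x1 x2 : (a + b = n)%N -> (r1 x1 <= a)%N -> (r2 x2 <= b)%N ->
  descents lt_pair n (x1, x2) = ('C(n, a) * (descents lt1 a x1 * descents lt2 b x2))%N.
Proof.
elim: n a b x1 x2 => [|n IH] a b x1 x2 e h1 h2.
  by move/eqP: e; rewrite addn_eq0 => /andP[/eqP -> /eqP ->].
have := @sum_lt_pair (descents lt_pair n) x1 x2; rewrite /= => -> => [|y1 y2 y1x y2x]; last first.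
  apply: (descents_vanish lt_pair_rank) => /=.
  by move: (lt1_rank y1x) (lt2_rank y2x) h1 h2 e; clear; lia.
have -> : (\sum_(y1 | lt1 y1 x1) descents lt_pair n (y1, x2) =
    (if a is a'.+1 then 'C(n, a') else 0) * (descents lt1 a x1 * descents lt2 b x2))%N.
  case: a e h1 => [|a] e h1; last first.
    rewrite mulnCA /= big_distrl /=; apply: eq_bigr => y1 /lt1_rank y1x.
    rewrite (IH a b) //; first by rewrite mulnCA.
    - by move: e; rewrite addSn => -[].
    - by rewrite -ltnS; apply: leq_trans y1x h1.
  by rewrite mul0n big1 // => y1 /lt1_rank y1x; move: (leq_trans y1x h1); rewrite ltn0.
have -> : (\sum_(y2 | lt2 y2 x2) descents lt_pair n (x1, y2) =
    (if b is b'.+1 then 'C(n, a) else 0) * (descents lt1 a x1 * descents lt2 b x2))%N.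
  case: b e h2 => [|b] e h2; last first.
    rewrite mulnA [descents lt2 b.+1 x2]/= big_distrr /=; apply: eq_bigr => y2 /lt2_rank y2x.
    rewrite (IH a b) //; first by rewrite mulnA.
    - by move: e; rewrite addnS => -[].
    - by rewrite -ltnS; apply: leq_trans y2x h2.
  by rewrite mul0n big1 // => y2 /lt2_rank y2x; move: (leq_trans y2x h2); rewrite ltn0.
rewrite -mulnDl; congr (_ * _)%N.
case: a b e {h1 h2} => [|a] [|b] //=; first by rewrite !bin0.
  by rewrite addn0 => -[->]; rewrite addn0 !binn.
by move=> _; rewrite binS addnC.
Qed.

End ProductDescents.

Section ChainDescents.
Context {I : finType}.
Variable L : {set {set I}}.

Definition lt_in : rel {set I} := fun Y X => (Y \in L) && (Y \proper X).

Lemma card_chains_last n X : X \in L ->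
  #|[set F in chains L n.+1 | F ord_max == X]| = descents lt_in n X.
Proof.
elim: n X => [|n IH] X XL.
  apply/eqP/cards1P; exists [ffun=> X]; apply/setP => F; rewrite [LHS]in_set in_set1.
  apply/andP/eqP => [[_ /eqP e]|->].
    by apply/ffunP => i; rewrite ffunE -e; congr (F _); rewrite [i]ord1 [RHS]ord1.
  rewrite ffunE eqxx; split => //; apply/chainsP; split => [i|i j]; rewrite !ffunE //.
  by rewrite [i]ord1 [j]ord1.
pose ex (G : {ffun 'I_n.+1 -> {set I}}) : {ffun 'I_n.+2 -> {set I}} :=
  [ffun i => if unlift ord_max i is Some j then G j else X].
have exl G j : ex G (lift ord_max j) = G j by rewrite ffunE liftK.
have exm G : ex G ord_max = X by rewrite ffunE unlift_none.
have exI : injective ex by move=> G G' e; apply/ffunP => j; rewrite -!exl e.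
have -> : [set F in chains L n.+2 | F ord_max == X] =
    ex @: [set G in chains L n.+1 | G ord_max \proper X].
  apply/setP => F; rewrite inE; apply/andP/imsetP => [[hF /eqP FX]|[G]].
    have [inL strict] := elimT (chainsP _ _) hF.
    exists [ffun j => F (lift ord_max j)].
      rewrite inE; apply/andP; split.
        apply/chainsP; split => [i|i j ij]; rewrite !ffunE //.
        by apply: strict; rewrite !lift_max.
      by rewrite ffunE -FX; apply: strict; rewrite lift_max /=.
    apply/ffunP => i; rewrite ffunE; case: unliftP => [j|] -> //.
    by rewrite ffunE.
  rewrite inE => /andP[hG GX] ->; rewrite exm eqxx; split => //.
  have [inL strict] := elimT (chainsP _ _) hG.
  apply/chainsP; split => [i|i j]; first by rewrite ffunE; case: unliftP.
  case: (unliftP ord_max i) => [i'|] ->; last by rewrite ltnNge leq_ord.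
  rewrite exl lift_max; case: (unliftP ord_max j) => [j'|] ->.
    by rewrite exl lift_max; apply: strict.
  rewrite exm => _; apply: sub_proper_trans GX.
  rewrite -[i'](inord_val) -[ord_max](inord_val); exact: (chain_sub hG (leq_ord i') (leqnn n)).
rewrite card_imset // -sum1_card (partition_big (fun G : {ffun 'I_n.+1 -> {set I}} => G ord_max) (lt_in^~ X)) /=; last first.
  by move=> G; rewrite inE /lt_in => /andP[/chainsP[inL _] ->]; rewrite inL.
apply: eq_bigr => Y /andP[YL YX]; rewrite -IH // -sum1_card; apply: eq_bigl => G.
rewrite !in_set -andbA; congr (_ && _).
by have [->|] := eqVneq (G ord_max) Y; rewrite ?YX ?andbF.
Qed.

Lemma card_chains_descents n : #|chains L n.+1| = (\sum_(X in L) descents lt_in n X)%N.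
Proof.
rewrite -sum1_card (partition_big (fun F : {ffun 'I_n.+1 -> {set I}} => F ord_max) (mem L)) /=.
  apply: eq_bigr => X XL; rewrite -card_chains_last // -sum1_card.
  by apply: eq_bigl => F; rewrite inE.
by move=> F /chainsP[inL _]; apply: inL.
Qed.

End ChainDescents.

Section FlagDescents.
Context {R : realType} {d : nat} {I : finType}.
Variable v : I -> 'rV[R]_d.
Local Notation L := (pface v setT).
Local Notation rk := (face_rank (fun i => lift1 (v i))).

Lemma lt_in_rank X Y : lt_in L X Y -> (rk X < rk Y)%N.
Proof. by case/andP => XL; apply: face_rank_proper XL (subsetT Y). Qed.

Lemma facet_rank X : lt_in L X setT -> (rk X <= d)%N.
Proof.
move/lt_in_rank => h; rewrite -ltnS; apply: leq_trans h _.
have h : (rk setT <= d + 1)%N := rank_leq_col _.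
by apply: leq_trans h _; rewrite addn1.
Qed.

(** A proper face has rank at most [d], too little for [d + 1] faces below it, so the last member is
    the whole polytope. What remains concerns proper faces only, and those behave well under
    joins. *)
Lemma card_flags_descents :
  #|chains L d.+2| = (\sum_(X | lt_in L X setT) descents (lt_in L) d X)%N.
Proof.
rewrite card_chains_descents (bigD1 setT) ?face_top //= [X in (_ + X)%N]big1 ?addn0 // => X /andP[XL XT].
rewrite -[(\sum_(_ | _) _)%N]/(descents (lt_in L) d.+1 X) (descents_vanish lt_in_rank) //.
by rewrite ltnS; apply: facet_rank; rewrite /lt_in XL properEneq XT subsetT.
Qed.

(** For a nonempty family this says that the origin is interior to the hull. *)
Definition positively_spanning := forall a, (forall i, 0 <= dotv (v i) a) -> a = 0.

Lemma spanning_face X : positively_spanning -> X \in L -> X != setT ->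
  exists2 y, forall i, dotv (v i) y <= 1 & X = [set i | dotv (v i) y == 1].
Proof.
move=> ps /pfaceP[y [b [hb ->]]] XT.
have {}hb i : dotv (v i) y <= b by apply: hb; rewrite inE.
have b0 : 0 < b.
  rewrite ltNge; apply/negP => b0.
  have y0 : y = 0.
    apply/eqP; rewrite -oppr_eq0; apply/eqP/ps => i.
    by rewrite dotvNr oppr_ge0 (le_trans (hb i)).
  have [i _ iX] : exists2 i, i \in setT & i \notin [set i in setT | dotv (v i) y == b].
    by apply/subsetPn; rewrite subTset.
  move: (hb i) iX; rewrite y0 dotv0r => b0'; rewrite !inE dotv0r /= => /eqP; apply.
  by apply/le_anti; rewrite b0 b0'.
exists (b^-1 *: y) => [i|]; first by rewrite dotvZr mulrC ler_pdivrMr // mul1r.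
apply/setP => i; rewrite !inE dotvZr /= -[RHS](inj_eq (mulfI (lt0r_neq0 b0))).
by rewrite mulrA mulfV ?lt0r_neq0 // mul1r mulr1.
Qed.

End FlagDescents.

(** * Flags of a join *)

Section JoinFlags.
Context {R : realType} {k l : nat} {I J : finType}.
Variables (v1 : I -> 'rV[R]_k) (v2 : J -> 'rV[R]_l).
Variables (S : 'M[R]_(k, k + l)) (T : 'M[R]_(l, k + l)).
Hypotheses (SS : S *m S^T = 1%:M) (TT : T *m T^T = 1%:M) (ST : S *m T^T = 0).
Hypotheses (ps1 : positively_spanning v1) (ps2 : positively_spanning v2).
Hypotheses (ne1 : [set: I] != set0) (ne2 : [set: J] != set0).

Definition join_family (m : I + J) : 'rV[R]_(k + l) :=
  match m with inl i => v1 i *m S | inr j => v2 j *m T end.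

Lemma TS : T *m S^T = 0.
Proof. by rewrite -[LHS]trmxK trmx_mul trmxK ST trmx0. Qed.

Lemma join_decompose (a : 'rV_(k + l)) : a = (a *m S^T) *m S + (a *m T^T) *m T.
Proof.
have e : col_mx S T *m (col_mx S T)^T = 1%:M.
  by rewrite tr_col_mx mul_col_mx !mul_mx_row SS ST TS TT -block_mxEv -scalar_mx_block.
have := mulmx1C e; rewrite tr_col_mx mul_row_col => e'.
by rewrite -[LHS]mulmx1 -e' mulmxDr !mulmxA.
Qed.

Lemma join_spanning : positively_spanning join_family.
Proof.
move=> a h; rewrite (join_decompose a).
have -> : a *m S^T = 0 by apply: ps1 => i; rewrite -dotv_trmx; apply: (h (inl i)).
have -> : a *m T^T = 0 by apply: ps2 => j; rewrite -dotv_trmx; apply: (h (inr j)).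
by rewrite !mul0mx addr0.
Qed.

Definition join_set (X : {set I} * {set J}) : {set I + J} :=
  [set m | match m with inl i => i \in X.1 | inr j => j \in X.2 end].

Lemma join_set_bij : bijective join_set.
Proof.
exists (fun Z : {set I + J} => ([set i | inl i \in Z], [set j | inr j \in Z])) => [[X Y]|Z] /=.
  by congr pair; apply/setP => i; rewrite !inE.
by apply/setP => -[i|j]; rewrite !inE.
Qed.

Lemma join_set_subset X Y :
  (join_set X \subset join_set Y) = (X.1 \subset Y.1) && (X.2 \subset Y.2).
Proof.
apply/fintype.subsetP/andP => [h|[/fintype.subsetP h1 /fintype.subsetP h2] [i|j]]; last 2 first.
- by rewrite !inE; apply: h1.
- by rewrite !inE; apply: h2.
by split; apply/fintype.subsetP => i iX; [have := h (inl i)|have := h (inr i)]; rewrite !inE; apply.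
Qed.

Lemma spanning_tight (n : nat) (K : finType) (v : K -> 'rV[R]_n) y :
  positively_spanning v -> [set: K] != set0 -> [set i | dotv (v i) y == 1] != setT.
Proof.
move=> ps /set0Pn[i _]; apply/negP => /eqP e.
have h j : dotv (v j) y = 1 by apply/eqP; have := in_setT j; rewrite -e inE.
by have := h i; rewrite (ps y) => [|j]; rewrite ?h // dotv0r => /esym/eqP; rewrite oner_eq0.
Qed.

(** Proper faces are exposed at level 1. Since the rows of [S] and [T] together form an orthonormal
    basis, a functional [y] at level 1 amounts to the two functionals [y *m S^T] and [y *m T^T],
    both at level 1. *)
Lemma lt_in_join X : lt_in (pface join_family setT) (join_set X) setT =
  lt_in (pface v1 setT) X.1 setT && lt_in (pface v2 setT) X.2 setT.
Proof.
rewrite /lt_in !properEneq !subsetT !andbT; apply/andP/idP => [[XL XT]|].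
  have [y hy e] := spanning_face join_spanning XL XT.
  have mem1 i : (i \in X.1) = (dotv (v1 i) (y *m S^T) == 1).
    by have /setP/(_ (inl i)) := e; rewrite !inE dotv_trmx.
  have mem2 j : (j \in X.2) = (dotv (v2 j) (y *m T^T) == 1).
    by have /setP/(_ (inr j)) := e; rewrite !inE dotv_trmx.
  have -> : X.1 = [set i | dotv (v1 i) (y *m S^T) == 1] by apply/setP => i; rewrite inE.
  have -> : X.2 = [set j | dotv (v2 j) (y *m T^T) == 1] by apply/setP => j; rewrite inE.
  rewrite !spanning_tight // !andbT; apply/andP; split.
    rewrite (_ : [set i | _] = [set i in setT | dotv (v1 i) (y *m S^T) == 1]); last first.
      by apply/setP => i; rewrite !inE.
    by apply: pface_exposed => i _; rewrite -dotv_trmx; apply: (hy (inl i)).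
  rewrite (_ : [set j | _] = [set j in setT | dotv (v2 j) (y *m T^T) == 1]); last first.
    by apply/setP => i; rewrite !inE.
  by apply: pface_exposed => j _; rewrite -dotv_trmx; apply: (hy (inr j)).
case/andP => /andP[XL1 XT1] /andP[XL2 XT2].
have [y1 h1 e1] := spanning_face ps1 XL1 XT1; have [y2 h2 e2] := spanning_face ps2 XL2 XT2.
pose y := y1 *m S + y2 *m T.
have d1 i : dotv (join_family (inl i)) y = dotv (v1 i) y1.
  by rewrite /= dotv_trmx mulmxDl -!mulmxA SS TS mulmx1 mulmx0 addr0.
have d2 j : dotv (join_family (inr j)) y = dotv (v2 j) y2.
  by rewrite /= dotv_trmx mulmxDl -!mulmxA ST TT mulmx1 mulmx0 add0r.
have -> : join_set X = [set m in setT | dotv (join_family m) y == 1].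
  by apply/setP => -[i|j]; rewrite !inE ?d1 ?d2 (e1, e2) inE.
split; first by apply: pface_exposed => -[i|j] _; rewrite ?d1 ?d2.
rewrite (_ : [set m in setT | _] = [set m | dotv (join_family m) y == 1]).
  apply: spanning_tight join_spanning _.
  by have /set0Pn[i _] := ne1; apply/set0Pn; exists (inl i); rewrite inE.
by apply/setP => m; rewrite !inE.
Qed.

Lemma card_flags_join : #|chains (pface join_family setT) (k + l).+2| =
  ('C(k + l, k) * (#|chains (pface v1 setT) k.+2| * #|chains (pface v2 setT) l.+2|))%N.
Proof.
rewrite !card_flags_descents (reindex join_set); last exact: onW_bij join_set_bij.
rewrite (eq_bigl _ _ lt_in_join) big_distrlr /= pair_big big_distrr /=.
apply: eq_bigr => X /andP[X1 X2].
have lt_top X' Y' : lt_in (pface join_family setT) (join_set X') setT ->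
    (join_set Y' \proper join_set X') ->
    lt_in (pface join_family setT) (join_set Y') (join_set X') =
    lt_in (pface join_family setT) (join_set Y') setT.
  move=> /andP[_ h] YX; rewrite /lt_in YX andbT.
  by rewrite (proper_trans YX h) andbT.
pose P (X : {set I} * {set J}) :=
  lt_in (pface v1 setT) X.1 setT && lt_in (pface v2 setT) X.2 setT.
have sub_lt (n : nat) (K : finType) (v : K -> 'rV[R]_n) A B : lt_in (pface v setT) A setT ->
    (B == A) || lt_in (pface v setT) B A = (B \subset A) && lt_in (pface v setT) B setT.
  move=> /andP[AL AT]; have [->|BA] /= := eqVneq B A; first by rewrite subxx /lt_in AL AT.
  rewrite /lt_in properEneq BA /= andbC; apply: andb_id2l => BA'.
  by rewrite (sub_proper_trans BA' AT) andbT.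
have step X' Y' : P X' -> lt_in (pface join_family setT) (join_set Y') (join_set X') =
    lt_pair (lt_in (pface v1 setT)) (lt_in (pface v2 setT)) Y' X'.
  move=> PX; have [X1' X2'] := andP PX; rewrite /lt_pair !sub_lt // andbACA -join_set_subset.
  rewrite -(inj_eq (bij_inj join_set_bij)) -lt_in_join andbA -properEneq.
  have [YX|YX] := boolP (join_set Y' \proper join_set X').
    by rewrite lt_top // lt_in_join.
  by rewrite /lt_in (negbTE YX) andbF.
rewrite (descents_transport (P := P) join_set_bij _ step) ?/P ?X1 ?X2 //.
  case: X X1 X2 => X1 X2 /= h1 h2.
  by rewrite (descents_pair (@lt_in_rank _ _ _ v1) (@lt_in_rank _ _ _ v2) (a := k) (b := l)) ?facet_rank.
move=> X' Y' PX; have [X1' X2'] := andP PX; rewrite /lt_pair !sub_lt //.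
by case/and3P => _ /andP[_ ->] /andP[_ ->].
Qed.

End JoinFlags.

Section HannerFlags.
Context {R : realType}.
Local Open Scope classical_set_scope.

Lemma card_chains_segment (L : {set {set bool}}) : L = [set: {set bool}]%SET ->
  (\sum_(X | lt_in L X setT) descents (lt_in L) 1 X = 2)%N.
Proof.
move=> ->; have ltE X Y : lt_in [set: {set bool}]%SET X Y = (X \proper Y) by rewrite /lt_in inE.
rewrite (bigID (pred1 set0)) /= [X in (X + _)%N]big1 ?add0n => [|X /andP[_ /eqP ->]]; last first.
  by apply: big1 => Y; rewrite ltE properE sub0set andbF.
rewrite (reindex_onto (fun c => [set c]%SET) (fun X => true \in X)) /= => [|X]; last first.
  rewrite ltE properT => /andP[XT X0]; apply/setP => c; rewrite inE.
  have [tX|tX] := boolP (true \in X).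
    case: c => //=; apply/esym/negP => fX.
    by case/eqP: XT; apply/setP => -[]; rewrite inE.
  case: c => /=; first by rewrite (negbTE tX).
  rewrite eqxx; apply/esym; apply: contraNT X0 => fX; apply/eqP/setP => -[]; rewrite inE.
    by rewrite (negbTE tX).
  by rewrite (negbTE fX).
rewrite (eq_bigl predT) => [|c]; last first.
  rewrite ltE properT -card_gt0 cards1 /= andbT inE; apply/andP; split; last by case: c.
  by apply/eqP => /setP/(_ (~~ c)); rewrite !inE; case: c.
rewrite (eq_bigr (fun=> 1%N)) => [|c _]; first by rewrite sum1_card card_bool.
rewrite (eq_bigl (pred1 set0)) ?big_pred1_eq // => Y /=.
rewrite ltE properEneq subset1; have [->|_] //= := eqVneq Y [set c]%SET.
by apply/esym/negbTE; rewrite -card_gt0 cards1.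
Qed.

(** Positive spanning is carried along because forming a polar family and describing the faces of a
    join both rely on it. *)
Lemma generalized_Hanner_flags d (P : set 'rV[R]_d) : generalized_Hanner P ->
  exists (I : finType) (v : I -> 'rV[R]_d),
    [/\ [set: I]%SET != set0, positively_spanning v, P = [set x | hull v [set: I]%SET x]
      & #|chains (pface v setT) d.+2| = (2 ^ d * d`!)%N].
Proof.
elim=> {d P} [a b a0 b0|d P _ [I [v [ne ps -> count]]]|
  k l P Q S T _ [I [v1 [ne1 ps1 -> c1]]] _ [J [v2 [ne2 ps2 -> c2]]] SS TT ST].
- exists bool, (fun c => const_mx (if c then b else a)); split.
  + by apply/set0Pn; exists true; rewrite inE.
  + move=> y h; have := h true; have := h false; rewrite !dotv_1 !mxE => h1 h2.
    apply/rowP => i; rewrite (ord1 i) mxE; apply/le_anti.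
    by rewrite -(nmulr_rge0 _ a0) h1 -(pmulr_rge0 _ b0) h2.
  + rewrite (@hull_segment R _ _ setT false true) ?inE // ?mxE // => k _.
    by rewrite !mxE; case: k; rewrite lexx ?andbT (ltW (lt_trans a0 b0)).
  + rewrite card_flags_descents card_chains_segment //; apply/setP => X; rewrite in_setT.
    have [/andP[tX fX]|nX] := boolP ((true \in X) && (false \in X)).
      rewrite (_ : X = setT); first exact: face_top.
      by apply/setP => -[]; rewrite inE.
    apply/pfaceP.
    (* The weight [1 / b] or [1 / a] gives value 1 at the end belonging to [X] and a negative value
       at the other; for empty [X] the functional is 0. *)
    exists (const_mx ((true \in X)%:R / b + (false \in X)%:R / a)), 1.
    have [bb aa] : b / b = 1 /\ a / a = 1 by split; rewrite divff // ?(gt_eqF b0) ?(lt_eqF a0).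
    have ab : a / b < 0 by rewrite pmulr_llt0 ?invr_gt0.
    have ba : b / a < 0 by rewrite pmulr_rlt0 ?invr_lt0.
    split => [c _|]; first rewrite dotv_1 !mxE.
      move: nX; case: (true \in X); case: (false \in X); case: c => //= _;
        rewrite ?mul0r ?mul1r ?addr0 ?add0r ?mulr0 ?ler01 ?bb ?aa ?lexx // ltW //;
        by [apply: lt_trans ab ltr01 | apply: lt_trans ba ltr01].
    apply/setP => c; rewrite !inE dotv_1 !mxE; move: nX.
    case: c; case: (true \in X); case: (false \in X) => //= _;
      rewrite ?mul0r ?mul1r ?addr0 ?add0r ?mulr0 ?bb ?aa ?eqxx //;
      by rewrite lt_eqF //; first [apply: lt_trans ab ltr01 | apply: lt_trans ba ltr01 | exact: ltr01].
- have [m [u puv]] := polar_pair_exists ne (fun i _ => in_coords_setT (v i))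
    (fun a h k _ => etrans (congr1 (fun x : 'rV_d => x 0 k) (ps a (fun i => h i (in_setT i)))) (mxE _ _ _ _)).
  have [_ _ vu hx _] := puv.
  have psu : positively_spanning u.
    move=> a h; apply/eqP; rewrite -oppr_eq0; apply/eqP/(hull_ray0 (v := v) (A := setT)) => t t0.
    apply: hx => [|j _]; first exact: in_coords_setT.
    rewrite dotvZl dotvNl dotvC mulrN; apply: le_trans ler01.
    by rewrite oppr_le0 mulr_ge0.
  exists 'I_m, u; split => //; last by rewrite (card_chains_polar _ puv).
    apply: (hull_neq0 (x := 0)); case: puv => _ _ _ _; apply; first exact: in_coords_setT.
    by move=> i _; rewrite dotv0r.
  exact: polarK puv.
- exists (I + J)%type, (join_family v1 v2 S T); split.
  + by have /set0Pn[i _] := ne1; apply/set0Pn; exists (inl i); rewrite inE.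
  + exact: join_spanning.
  + apply/seteqP; split.
      apply: convex_hull_min; first exact: hull_convex.
      move=> _ [[x /= hx <-]|[x /= hx <-]].
        apply: (convex_comb (@hull_convex _ _ _ (join_family v1 v2 S T) setT) _ (hull_mulmx S hx)).
        by move=> i _; apply: (hull_mem _ (in_setT (inl i))).
      apply: (convex_comb (@hull_convex _ _ _ (join_family v1 v2 S T) setT) _ (hull_mulmx T hx)).
      by move=> i _; apply: (hull_mem _ (in_setT (inr i))).
    move=> x hx; apply: (convex_comb (@convex_hull_convex _ _ _) _ hx) => -[i|j] _.
      by apply: sub_convex_hull; left; exists (v1 i) => //; apply: hull_mem; rewrite inE.
    by apply: sub_convex_hull; right; exists (v2 j) => //; apply: hull_mem; rewrite inE.
  + rewrite card_flags_join // c1 c2 expnD -(bin_fact (leq_addr l k)) addKn.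
    by rewrite mulnC -!mulnA; congr (_ * _)%N; rewrite !mulnA; lia.
Qed.

End HannerFlags.

Local Open Scope classical_set_scope.
Local Open Scope card_scope.
Local Open Scope ring_scope.

Theorem theorem1p4 (R : realType) (d : nat) (P : set 'rV[R]_d)
    (d_ge1 : (1 <= d)%N) (P_dim : has_dim P d%:Z)
    (P_lab : proper_locally_anti_blocking P) :
  `I_((2 ^ d * d`!)%N) #<= flags P /\
  (flags P #= `I_((2 ^ d * d`!)%N) <-> generalized_Hanner P).
Proof.
have [I [v [lv eP]]] := lab_of_proper P_lab.
have count : flags P #= `I_#|chains (pface v setT) d.+2|.
  by rewrite {1}eP; apply: card_flags.
split.
  rewrite (card_le_eqr count) card_le_II.
  by apply: (@lab_flag_bound R d d I v setT setT _ lv); rewrite cardsT card_ord.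
split=> [flags_eq|/generalized_Hanner_flags[J [w [_ _ -> <-]]]]; last exact: card_flags.
have e : #|chains (pface v setT) d.+2| = (2 ^ d * d`!)%N.
  by apply/card_eq_II; apply: card_eq_trans flags_eq; rewrite card_eq_sym.
rewrite eP {eP count flags_eq P_lab P_dim}; case: d d_ge1 P v lv e => // N _ _ v lv e.
exact: flag_equality_Hanner.
Qed.
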